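(* Let $A$, $W_1$, $W_2$, $\overline W$, the observation $M_\varepsilon$, the posterior distribution $\Pi(\cdot\,|\,M_\varepsilon)$ and the notion of weak convergence in probability be as described in the context. Let $f^\dagger\in\overline W$ be fixed and let $P^M_{f^\dagger}$ be the law of $M_\varepsilon=Af^\dagger+\varepsilon\mathbb W$. Let $\Pi$ be a centred Gaussian Borel probability measure on $\overline W$, with reproducing kernel Hilbert space (RKHS) $V_\Pi$, that satisfies the concentration condition (stated in the context) for $f^\dagger$. Let $\psi\in W_1$ be such that, for some constant $C>0$, $|\langle\psi,\varphi\rangle_{W_1}|\le C\|\varphi\|_{\overline W}$ for all $\varphi\in W_1$, and suppose that $\psi=-A^*A\widetilde\psi$ for some $\widetilde\psi\in V_\Pi$. Then, with $$\widehat\Psi=\langle f^\dagger,\psi\rangle_{W_1}-\varepsilon\langle A\widetilde\psi,\mathbb W\rangle_{W_2},$$ one has, for $f\sim\Pi(\cdot\,|\,M_\varepsilon)$, $$\mathcal L\big(\varepsilon^{-1}(\langle f,\psi\rangle_{W_1}-\widehat\Psi)\,\big|\,M_\varepsilon\big)\to^{\mathcal L}\mathcal N\big(0,\|A\widetilde\psi\|_{W_2}^2\big)$$ in $P^M_{f^\dagger}$-probability as $\varepsilon\to0$.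
   Context: Setting. $W_1,W_2$ are separable Hilbert spaces of real-valued functions, and $A:W_1\to W_2$ is linear, bounded and injective, with adjoint $A^*:W_2\to W_1$, $\langle Af,g\rangle_{W_2}=\langle f,A^*g\rangle_{W_1}$. $\overline W$ is a separable Hilbert space with $W_1\subset\overline W$ dense in the norm of $\overline W$, such that $A:\overline W\to W_2$ is (defined and) continuous; in particular there is $c>0$ with $\|Af\|_{W_2}\le c\|f\|_{\overline W}$ for all $f\in\overline W$. Noise and observation. $\mathbb W=(\mathbb W(\varphi):\varphi\in W_2)$ is a centred Gaussian white noise process with $\mathbb E(\mathbb W(\varphi)\mathbb W(\varphi'))=\langle\varphi,\varphi'\rangle_{W_2}$; we write $\langle\mathbb W,\varphi\rangle_{W_2}=\mathbb W(\varphi)$. For $\varepsilon>0$ the observation is $M_\varepsilon=Af+\varepsilon\mathbb W$, i.e. the Gaussian process $(\langle M_\varepsilon,\varphi\rangle_{W_2}=\langle Af,\varphi\rangle_{W_2}+\varepsilon\mathbb W(\varphi):\varphi\in W_2)$; its law is $P^M_f$. Posterior. For a prior $\Pi$ on $\overline W$, with $p_f(M_\varepsilon)=\exp\{\varepsilon^{-2}\langle M_\varepsilon,Af\rangle_{W_2}-\tfrac12\varepsilon^{-2}\|Af\|_{W_2}^2\}$ the density of $P_f^M$ with respect to $P_0^M$, the posterior is $\Pi(B\,|\,M_\varepsilon)=\int_B p_f(M_\varepsilon)\,d\Pi(f)\big/\int_{\overline W}p_f(M_\varepsilon)\,d\Pi(f)$ for Borel $B\subseteq\overline W$. Concentration condition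 for $\Pi$ and $f^\dagger$. Define, for $\delta>0$, $$\phi_{\Pi,f^\dagger}(\delta)=\inf_{g\in V_\Pi,\ \|g-f^\dagger\|_{\overline W}\le\delta}\frac{\|g\|_{V_\Pi}^2}{2}-\log\Pi(f:\|f\|_{\overline W}\le\delta).$$ The condition is: there exists a sequence $\delta_\varepsilon\to0$ with $\delta_\varepsilon/\varepsilon\to\infty$ as $\varepsilon\to0$ such that $\phi_{\Pi,f^\dagger}(\delta_\varepsilon/(2c))\le(\delta_\varepsilon/\varepsilon)^2$. Conventions. For $\psi$ as in the claim, the functional $\langle\cdot,\psi\rangle_{W_1}$ is extended continuously from $W_1$ to $\overline W$, and $\langle f,\psi\rangle_{W_1}$ for $f\in\overline W$ denotes this extension. $\mathcal L(\cdot\,|\,M_\varepsilon)$ denotes the law under the posterior. For random laws, $\mu_\varepsilon\to^{\mathcal L}\mu$ in probability means that for any metric $d$ for weak convergence of probability measures, $d(\mu_\varepsilon,\mu)\to0$ in probability. *)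

(* Defs.v *)
From HB Require Import structures.
From mathcomp Require Import all_boot all_order all_algebra.
From mathcomp Require Import sesquilinear.
From mathcomp Require Import all_classical all_reals all_analysis.
From mathcomp Require Import measurable_realfun.

Set Implicit Arguments.
Unset Strict Implicit.
Unset Printing Implicit Defensive.

Import Order.TTheory GRing.Theory Num.Theory.
Import numFieldNormedType.Exports.

Local Open Scope classical_set_scope.
Local Open Scope ring_scope.

HB.mixin Record CompleteNormedModule_isHilbert (R : realType) V
    & CompleteNormedModule R V := {
  inner : {dot V for (@idfun R)} ;
  inner_normE : forall u : V, inner u u = `|u| ^+ 2
}.

#[short(type="hilbertType")]
HB.structure Definition Hilbert (R : realType) :=
  {V of CompleteNormedModule R V & CompleteNormedModule_isHilbert R V}.

Definition separable (V : topologicalType) :=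
  exists S : set V, countable S /\ dense S.

Definition bounded_operator (R : realType) (U V : normedModType R)
    (A : U -> V) :=
  exists K : R, forall f, `|A f| <= K * `|f|.

Definition is_adjoint (R : realType) (U V : hilbertType R)
    (A : U -> V) (B : V -> U) :=
  forall f g, inner (A f) g = inner f (B g).

Record dual (R : realType) (V : normedModType R) := Dual {
  dual_fun :> {linear V -> R^o} ;
  dual_continuous : continuous dual_fun
}.

Notation borel V := (g_sigma_algebraType (@open V)).

Lemma continuous_borel_measurable (R : realType) (V : ptopologicalType)
    (f : V -> R) :
  continuous f -> measurable_fun [set: borel V] (f : borel V -> R).
Proof.
move=> /continuousP cf.
apply: (measurability _ (RGenOpens.measurableE R)).
move=> _ [_ [a [b ->] <-]]; rewrite setTI.
by apply: sub_sigma_algebra; exact/cf/interval_open.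
Qed.

Section affine_functional.
Context (R : realType) (V : normedModType R).

Definition rescaled (L : dual V) (eps c : R) : borel V -> R :=
  fun f => eps^-1 * (L f - c).

Let measurable_rescaled (L : dual V) (eps c : R) :
  measurable_fun setT (rescaled L eps c).
Proof.
apply: measurable_funM => //; apply: measurable_funB => //.
exact: (continuous_borel_measurable (@dual_continuous _ _ L)).
Qed.

HB.instance Definition _ L eps c :=
  isMeasurableFun.Build _ _ _ _ (rescaled L eps c) (measurable_rescaled L eps c).

End affine_functional.

(* [normal_prob] lives on [measurableTypeR R], which has the same measurable
   sets as [R] but another display. *)
Definition to_real (R : realType) : measurableTypeR R -> R := idfun.

HB.instance Definition _ (R : realType) :=
  @isMeasurableFun.Build _ _ _ _ (@to_real R) (@measurable_id _ _ setT).

(* The second argument of [normal_prob] is the standard deviation, and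
   [normal_prob m 0] is the uniform law on [0, 1] instead of a point mass. *)
Definition centred_normal (R : realType) (s : R) : probability R R :=
  if s == 0 then dirac (0 : R) : probability R R
  else distribution (normal_prob 0 s) (@to_real R).

Definition has_centred_normal_law d (T : measurableType d) (R : realType)
    (mu : probability T R) (X : T -> R) :=
  exists s : R, forall B, measurable B ->
    mu (X @^-1` B) = centred_normal s B.

Definition centred_gaussian_measure (R : realType) (V : normedModType R)
    (Pi : probability (borel V) R) :=
  forall T : dual V, has_centred_normal_law Pi T.

Definition centred_gaussian_process d (Omega : measurableType d)
    (R : realType) (P : probability Omega R) (I : Type)
    (X : I -> {RV P >-> R}) :=
  forall (n : nat) (a : 'I_n -> R) (i : 'I_n -> I),
    has_centred_normal_law P (fun w => \sum_(k < n) a k * X (i k) w).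

Definition white_noise d (Omega : measurableType d) (R : realType)
    (P : probability Omega R) (H : hilbertType R) (W : H -> {RV P >-> R}) :=
  centred_gaussian_process W /\
  forall phi phi' : H, ('E_P[(W phi \* W phi')%R] = (inner phi phi')%:E)%E.

Section rkhs.
Context (R : realType) (V : normedModType R) (Pi : probability (borel V) R).

(* [h] is the (Pettis) integral of [xi f * f] with respect to [Pi], where [xi]
   lies in the closure of the dual of [V] in L^2(Pi); the RKHS is the space of
   all such [h], with the L^2(Pi)-norm of the (a.e. unique) [xi] as the norm
   of [h]. *)
Definition rkhs_repr (h : V) (xi : borel V -> R) :=
  [/\ measurable_fun setT xi,
      forall eta : R, 0 < eta -> exists T : dual V,
        ('N[Pi]_2%:E[EFin \o (xi \- T)%R] <= eta%:E)%E
    & forall T : dual V, T h = \int[Pi]_f (xi f * T f)].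

Definition rkhs : set V := [set h | exists xi, rkhs_repr h xi].

Definition rkhs_norm (h : V) : R :=
  fine ('N[Pi]_2%:E[EFin \o xget (cst 0) (rkhs_repr h)]).

Definition concentration_function (f0 : V) (delta : R) : \bar R :=
  (ereal_inf [set (rkhs_norm g ^+ 2 / 2)%:E
             | g in [set g | rkhs g /\ (`|g - f0| <= delta)%R]]
   - lne (Pi [set f : V | (`|f| <= delta)%R]))%E.

Definition concentration_condition (c : R) (f0 : V) :=
  exists delta : R -> R,
    [/\ delta eps @[eps --> 0^'+] --> 0,
        delta eps / eps @[eps --> 0^'+] --> +oo
      & \forall eps \near 0^'+,
          (concentration_function f0 (delta eps / (2 * c))
             <= ((delta eps / eps) ^+ 2)%:E)%E].

End rkhs.

Section tilt.
Context d (X : measurableType d) (R : realType).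
Variables (mu : {measure set X -> \bar R}) (l : {mfun X >-> R}).

Definition tilt (B : set X) : \bar R := (\int[mu]_(x in B) (expR (l x))%:E)%E.

Let tilt0 : tilt set0 = 0%E. Proof. exact: integral_set0. Qed.

Let tilt_ge0 B : (0 <= tilt B)%E.
Proof. by apply: integral_ge0 => x _; rewrite lee_fin expR_ge0. Qed.

Let tilt_sigma_additive : semi_sigma_additive tilt.
Proof.
move=> F mF tF mUF; rewrite /tilt/= ge0_integral_bigcup//=.
- apply: is_cvg_ereal_nneg_natsum_cond => n _ _.
  by apply: integral_ge0 => x _; rewrite lee_fin expR_ge0.
- apply: measurable_funTS; apply/measurable_EFinP.
  exact: measurableT_comp.
Qed.

HB.instance Definition _ :=
  isMeasure.Build _ _ _ tilt tilt0 tilt_ge0 tilt_sigma_additive.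

End tilt.

(* [mnormalize] divides by the total mass; its default value [Pi] is only used
   when that mass is 0 or infinite. *)
Definition posterior d (X : measurableType d) (R : realType)
    (Pi : probability X R) (l : {mfun X >-> R}) : probability X R :=
  mnormalize (tilt Pi l) Pi.

Section observation.
Context d (Omega : measurableType d) (R : realType) (P : probability Omega R).
Context (V H : hilbertType R) (A : V -> H) (W : H -> {RV P >-> R}).

Definition observation (f0 : V) (eps : R) (phi : H) (w : Omega) : R :=
  inner (A f0) phi + eps * W phi w.

Definition log_likelihood (f0 : V) (eps : R) (f : V) (w : Omega) : R :=
  eps ^- 2 * observation f0 eps (A f) w - 2^-1 * eps ^- 2 * `|A f| ^+ 2.

(* [log_likelihood] need not be measurable in [f] for fixed [w], since a white
   noise is only given up to a null set for each [phi]; the posterior is built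
   from a version that is jointly measurable in [(f, w)]. *)
Definition log_likelihood_version (f0 : V)
    (l : R -> Omega -> {mfun borel V >-> R}) :=
  forall eps : R, 0 < eps ->
    measurable_fun setT (fun z : borel V * Omega => l eps z.2 z.1) /\
    forall f : V, {ae P, forall w, l eps w f = log_likelihood f0 eps f w}.

End observation.

Definition weak_cvg (R : realType) (mu_ : nat -> probability R R)
    (mu : probability R R) :=
  forall h : R -> R, continuous h -> (exists K, forall x, `|h x| <= K) ->
    (\int[mu_ n]_x h x) @[n --> \oo] --> \int[mu]_x h x.

(* Two values of type [probability R R] may differ on non-measurable sets, so
   that separation is stated with equality on measurable sets. *)
Definition weak_metric (R : realType)
    (dist : probability R R -> probability R R -> R) :=
  [/\ forall mu nu, 0 <= dist mu nu,
      forall mu nu, dist mu nu = 0 <->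
        forall B, measurable B -> mu B = nu B,
      forall mu nu, dist mu nu = dist nu mu,
      forall mu nu la, dist mu la <= dist mu nu + dist nu la
    & forall mu_ mu, weak_cvg mu_ mu <->
        dist (mu_ n) mu @[n --> \oo] --> 0].

(* The outer probability [P^*] coincides with [P] on measurable sets. *)
Definition cvg0_in_probability d (Omega : measurableType d) (R : realType)
    (P : probability Omega R) (X : R -> Omega -> R) :=
  forall eta : R, 0 < eta ->
    (P^*)%mu [set w | eta < `|X eps w|] @[eps --> 0^'+] --> 0%E.

Definition weak_cvg_in_probability d (Omega : measurableType d) (R : realType)
    (P : probability Omega R) (mu_ : R -> Omega -> probability R R)
    (mu : probability R R) :=
  forall dist, weak_metric dist ->
    cvg0_in_probability P (fun eps w => dist (mu_ eps w) mu).

(* Main.v *)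
(* Since [L f = - inner (A f) (A h)], translating [f] by [t * eps *: h] adds
   [t * Z f - t ^+ 2 / 2 * sigma ^+ 2] to the log-likelihood, where [Z] is the
   rescaled functional and [sigma = `|A h|]. By the Cameron-Martin formula the
   same translation multiplies the prior by
   [expR (t * eps * xi - (t * eps) ^+ 2 / 2 * v)], where [xi] represents [h] and
   [v] is its squared L2 norm. The concentration condition makes the evidence
   large enough for this factor to be close to 1 in mean under the posterior,
   for bounded [t], with probability tending to 1. Hence the posterior law of
   [Z] almost satisfies [E (G Z * expR (t * Z - t ^+ 2 / 2 * sigma ^+ 2)) =
   E (G (Z + t * sigma ^+ 2))], an identity that characterizes the centred normal
   law of standard deviation [sigma].

   The Cameron-Martin formula itself holds because both sides are finite measures
   with the same exponential moments, and these determine a Borel measure on a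
   separable Hilbert space: they determine the integrals of trigonometric
   polynomials in continuous functionals, and iterating [x |-> (3 x - x ^ 3) / 2]
   turns sines into indicators of half-spaces. *)

Require Import Defs.
From HB Require Import structures.
From mathcomp Require Import all_boot all_order all_algebra.
From mathcomp Require Import sesquilinear.
From mathcomp Require Import all_classical all_reals all_analysis.
From mathcomp Require Import measurable_realfun.
From mathcomp Require Import ring lra.
Set Implicit Arguments.
Unset Strict Implicit.
Unset Printing Implicit Defensive.
Import Order.TTheory GRing.Theory Num.Theory.
Import numFieldNormedType.Exports.
Local Open Scope classical_set_scope.
Local Open Scope ring_scope.

(** The metric for weak convergence is arbitrary, so no rate for it can be computed. Instead a
    property [almost_normal], indexed by an integer and tested on rational shifts only, is converted
    into closeness for the given metric by a contradiction argument; countably many shifts cost a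
    single null set.

    All randomness of the likelihood is handled through means. Relative to the likelihood at the
    truth, the ratio [expR U] has mean 1 and [expR (- U)] has mean
    [expR (|A (f - fdag)|^2 / eps^2)]. Tonelli and Markov's inequality then bound the evidence from
    below and the posterior mean of [expR (lam * |xi|)] from above, where [lam = delta / eps],
    outside an event of probability at most [2 * expR (- lam^2)]. So under the posterior [|xi|] is
    of order [lam], and [t * eps * xi] is of order [t * delta]: this is where both [delta -> 0] and
    [delta / eps -> oo] enter.

    When [A h = 0] the limit is a point mass, which has no density, and that case is settled
    directly. *)

(** * Densities, dominated convergence and exponential bounds *)

Section integral_tilt.
Context d (X : measurableType d) (R : realType).
Variables (mu : {measure set X -> \bar R}) (l : {mfun X >-> R}).
Local Open Scope ereal_scope.
Import HBNNSimple.

Let mexpl : measurable_fun setT (fun x => (expR (l x))%:E).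
Proof. by apply/measurable_EFinP; exact: measurableT_comp. Qed.

(** The definition of [tilt] gives the formula for indicators; simple functions and monotone
    convergence do the rest. *)
Lemma ge0_integral_tilt (G : X -> \bar R) : measurable_fun setT G ->
  (forall x, 0 <= G x) ->
  \int[tilt mu l]_x G x = \int[mu]_x (G x * (expR (l x))%:E).
Proof.
move=> mG G0; pose f_ := nnsfun_approx measurableT mG.
have cvgf x : (f_ n x)%:E @[n --> \oo] --> G x.
  by apply: cvg_nnsfun_approx.
transitivity (limn (fun n => \int[tilt mu l]_x (f_ n x)%:E)).
  rewrite -monotone_convergence//=.
  - by apply: eq_integral => x _; apply/esym/cvg_lim.
  - by move=> n; apply/measurable_EFinP.
  - by move=> n x _; rewrite lee_fin.
  - by move=> x _ a b ab; rewrite lee_fin//; exact/lefP/nd_nnsfun_approx.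
rewrite (_ : (fun n => _) =
    (fun n => \int[mu]_x ((f_ n x)%:E * (expR (l x))%:E))); last first.
  apply/funext => n; transitivity (\sum_(k \in range (f_ n))
      \int[mu]_x ((k * \1_(f_ n @^-1` [set k]) x)%:E * (expR (l x))%:E)).
    under eq_integral do rewrite fimfunE -fsumEFin//.
    rewrite ge0_integral_fsum//; last 2 first.
    - by move=> y; exact/measurable_EFinP/measurable_funM.
    - by move=> y x _; rewrite nnfun_muleindic_ge0.
    apply: eq_fsbigr => r _; rewrite integralZl_indic_nnsfun// integral_indic//=.
    rewrite setIT; under [RHS]eq_integral do rewrite EFinM -muleA.
    have [r0|r0] := leP 0%R r.
      rewrite ge0_integralZl//; last first.
        apply: emeasurable_funM => //; apply/measurable_EFinP.
        exact: measurable_indic.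
      congr (_ * _); rewrite /tilt integral_mkcond.
      by apply: eq_integral => x _; rewrite epatch_indic muleC.
    rewrite preimage_nnfun0// measure0 mule0.
    by rewrite integral0_eq// => x _; rewrite indic0 mul0e mule0.
  rewrite -ge0_integral_fsum//; last 2 first.
  - move=> r; apply: emeasurable_funM => //.
    by apply/measurable_EFinP/measurable_funM => //; exact: measurable_indic.
  - by move=> r x _; rewrite mule_ge0// ?lee_fin ?expR_ge0// -lee_fin EFinM nnfun_muleindic_ge0.
  apply: eq_integral => x _.
  rewrite [in RHS]fimfunE -fsumEFin// ge0_mule_fsuml// => r.
  by rewrite EFinM nnfun_muleindic_ge0.
rewrite -monotone_convergence//=.
- apply: eq_integral => x _; apply/cvg_lim => //.
  apply: cvgeZr => //; exact: cvgf.
- by move=> n; apply: emeasurable_funM => //; exact/measurable_EFinP.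
- by move=> n x _; rewrite mule_ge0// lee_fin// expR_ge0.
- move=> x _ a b ab; rewrite lee_wpmul2r ?lee_fin ?expR_ge0//.
  exact/lefP/nd_nnsfun_approx.
Qed.

End integral_tilt.

Section Rintegral_dominated.
Context d (T : measurableType d) (R : realType).
Variables (mu : {measure set T -> \bar R}).

Lemma integrable_le (f g : T -> R) : measurable_fun setT f ->
  mu.-integrable setT (EFin \o g) -> (forall x, `|f x| <= g x) ->
  mu.-integrable setT (EFin \o f).
Proof.
move=> mf ig fg; apply: le_integrable ig => //; first exact/measurable_EFinP.
by move=> x _ /=; rewrite lee_fin (le_trans (fg x))// ler_norm.
Qed.

Lemma Rintegral_dominated_cvg (f_ : nat -> T -> R) (f g : T -> R) :
  (forall n, measurable_fun setT (f_ n)) ->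
  (forall x, f_ n x @[n --> \oo] --> f x) ->
  mu.-integrable setT (EFin \o g) ->
  (forall n x, `|f_ n x| <= g x) ->
  \int[mu]_x f_ n x @[n --> \oo] --> \int[mu]_x f x.
Proof.
move=> mf ff ig fg.
have cvg_ff x : (f_ n x)%:E @[n --> \oo] --> (f x)%:E.
  by apply: cvg_EFin; [exact: nearW|exact: ff].
have [||||intf _ H] := @dominated_convergence _ _ _ mu setT measurableT
    (fun n => EFin \o f_ n) (EFin \o f) (EFin \o g) _ _ _ ig.
- by move=> n; exact/measurable_EFinP.
- apply: (emeasurable_fun_cvg (fun n => EFin \o f_ n)) => [n|x _].
    exact/measurable_EFinP.
  exact: cvg_ff.
- by apply: aeW => x _; exact: cvg_ff.
- by apply: aeW => x n _; rewrite /= lee_fin.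
apply: fine_cvg; rewrite fineK//; exact: integrable_fin_num.
Qed.

End Rintegral_dominated.

Section exp_bounds.
Context (R : realType).
Implicit Types x y : R.

Lemma expRB1_le_mul x : expR x - 1 <= x * expR x.
Proof.
have := ler_wpM2l (expR_ge0 x) (expR_ge1Dx (- x)).
by rewrite expRxMexpNx_1; lra.
Qed.

Lemma normr_expRB1 x : `|expR x - 1| <= `|x| * expR `|x|.
Proof.
have := expRB1_le_mul x; have := expR_ge1Dx x.
have [x0|x0] := ger0P x => h1 h2; first by rewrite ger0_norm; lra.
rewrite ler0_norm; last by rewrite subr_le0 -[leRHS]expR0 ler_expR ltW.
rewrite (@le_trans _ _ (- x))//; first by lra.
by rewrite ler_peMr ?oppr_ge0 ?(ltW x0)// -[leLHS]expR0 ler_expR oppr_ge0 ltW.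
Qed.

Lemma expR_norm_le x : expR `|x| <= expR x + expR (- x).
Proof.
by case: (ger0P x) => _; rewrite ?lerDl ?lerDr expR_ge0.
Qed.

Lemma exprn_norm_le (n : nat) x : `|x| ^+ n <= n`!%:R * expR `|x|.
Proof.
case: n => [|n]; first by rewrite expr0 fact0 mul1r -expR0 ler_expR.
rewrite mulrC -ler_pdivrMr ?ltr0n ?fact_gt0//.
by apply: le_trans (expR_ge1Dxn n (normr_ge0 x)); rewrite lerDr.
Qed.

End exp_bounds.

(** * Equal exponential moments of a real random variable *)

Section exponential_moments.
Context d (T : measurableType d) (R : realType).
Variables (mu nu : {measure set T -> \bar R}) (X : T -> R).
Hypothesis mX : measurable_fun setT X.
Hypothesis intmu :
  forall a, mu.-integrable setT (EFin \o (fun x => expR (a * X x))).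
Hypothesis intnu :
  forall a, nu.-integrable setT (EFin \o (fun x => expR (a * X x))).
Hypothesis eq_mgf :
  forall a, \int[mu]_x expR (a * X x) = \int[nu]_x expR (a * X x).

Let integrable_dom (m : {measure set T -> \bar R}) :
  (forall a, m.-integrable setT (EFin \o (fun x => expR (a * X x)))) ->
  forall K a : R, m.-integrable setT (EFin \o (fun x => K * expR (a * `|X x|))).
Proof.
move=> im K a.
have : m.-integrable setT (EFin \o (fun x => `|K| * (expR (a * X x) + expR (- a * X x)))).
  rewrite (_ : _ \o _ = (fun x => `|K|%:E * ((EFin \o (fun x => expR (a * X x))) \+
    (EFin \o (fun x => expR (- a * X x)))) x))%E; last exact/funext.
  by apply: integrableZl => //; apply: integrableD.
move=> ih; apply: (integrable_le _ ih) => [|x].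
  apply: measurable_funM => //; apply: measurableT_comp => //.
  by apply: measurable_funM => //; exact: measurableT_comp.
rewrite normrM ler_wpM2l// (ger0_norm (expR_ge0 _)).
case: (ger0P (X x)) => _; first by rewrite lerDl expR_ge0.
by rewrite mulrN -mulNr lerDr expR_ge0.
Qed.

Let mpow (k : nat) (b : R) : measurable_fun setT (fun x => X x ^+ k * expR (b * X x)).
Proof.
apply: measurable_funM; first exact: measurable_funX.
by apply: measurableT_comp => //; exact: measurable_funM.
Qed.

Let pow_le (k : nat) (b : R) x :
  `|X x ^+ k * expR (b * X x)| <= k`!%:R * expR ((`|b| + 1) * `|X x|).
Proof.
rewrite normrM normrX (ger0_norm (expR_ge0 _)) mulrDl mul1r expRD mulrCA mulrC.
rewrite ler_pM ?expR_ge0 ?exprn_ge0 ?exprn_norm_le//.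
by rewrite ler_expR -normrM ler_norm.
Qed.

Let integrable_pow (m : {measure set T -> \bar R}) :
  (forall a, m.-integrable setT (EFin \o (fun x => expR (a * X x)))) ->
  forall k b, m.-integrable setT (EFin \o (fun x => X x ^+ k * expR (b * X x))).
Proof.
move=> im k b; apply: (integrable_le _ (@integrable_dom m im k`!%:R (`|b| + 1))).
  exact: mpow.
exact: pow_le.
Qed.

(** Difference quotient of [b |-> X ^+ k * expR (b * X)] with step [1 / (j + 1)]. Its limit carries
    one more power of [X], so differentiation under the integral propagates equality of exponential
    moments to all moments. *)
Let quot (k : nat) (b : R) (j : nat) x : R :=
  j.+1%:R * (X x ^+ k * expR ((b + j.+1%:R^-1) * X x) - X x ^+ k * expR (b * X x)).

Let quotE k b j x : quot k b j x =
  X x ^+ k * expR (b * X x) * (j.+1%:R * (expR (j.+1%:R^-1 * X x) - 1)).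
Proof. by rewrite /quot mulrDl expRD; ring. Qed.

Let quot_cvg k b x : quot k b j x @[j --> \oo] --> X x ^+ k.+1 * expR (b * X x).
Proof.
under eq_fun do rewrite quotE.
rewrite exprSr -mulrA (mulrC (X x)) mulrA; apply: cvgMr.
have lim1 : X x * expR (j.+1%:R^-1 * X x) @[j --> \oo] --> X x.
  rewrite -[X in _ --> X]mulr1; apply: cvgMr.
  suff : expR (j.+1%:R^-1 * X x) @[j --> \oo] --> expR (0 * X x).
    by rewrite mul0r expR0.
  apply: continuous_cvg; first exact: continuous_expR.
  by apply: cvgMl; exact: cvg_harmonic.
apply: squeeze_cvgr lim1; last exact: cvg_cst.
apply: nearW => j; set y := j.+1%:R^-1 * X x.
have Xy : X x = j.+1%:R * y by rewrite /y mulrA mulfV ?mul1r// pnatr_eq0.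
rewrite {1 2}Xy -mulrA !ler_pM2l ?ltr0n//; apply/andP; split.
  by rewrite lerBrDl expR_ge1Dx.
exact: expRB1_le_mul.
Qed.

(** A bound uniform in [j], as dominated convergence requires. The [+ 2] in the exponent pays once
    for the difference quotient and once for absorbing [|X| ^+ k.+1]. *)
Let quot_le k b j x :
  `|quot k b j x| <= k.+1`!%:R * expR ((`|b| + 2) * `|X x|).
Proof.
rewrite quotE normrM.
apply: (@le_trans _ _ (`|X x ^+ k * expR (b * X x)| * (`|X x| * expR `|X x|))).
  rewrite ler_wpM2l//.
  rewrite normrM (ger0_norm (ler0n _ _)).
  set y := j.+1%:R^-1 * X x.
  have Xy : X x = j.+1%:R * y by rewrite /y mulrA mulfV ?mul1r// pnatr_eq0.
  have nXy : `|X x| = j.+1%:R * `|y|.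
    by rewrite [in LHS]Xy normrM ger0_norm ?ler0n.
  have -> : `|X x| * expR `|X x| = j.+1%:R * (`|y| * expR `|X x|).
    by rewrite [X in X * _]nXy mulrA.
  rewrite ler_pM2l ?ltr0n// (le_trans (normr_expRB1 y))// ler_wpM2l// ler_expR.
  by rewrite nXy ler_peMl// ler1n.
rewrite normrM normrX (ger0_norm (expR_ge0 _)).
have -> : expR ((`|b| + 2) * `|X x|) =
    expR `|X x| * expR (`|b| * `|X x|) * expR `|X x|.
  by rewrite -!expRD; congr expR; ring.
rewrite [leLHS](_ : _ = `|X x| ^+ k.+1 * expR (b * X x) * expR `|X x|); last first.
  by rewrite exprSr; ring.
rewrite !mulrA ler_wpM2r ?expR_ge0// ler_pM ?exprn_ge0 ?expR_ge0//.
  exact: exprn_norm_le.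
by rewrite ler_expR -normrM ler_norm.
Qed.

Let eq_moments k b : \int[mu]_x (X x ^+ k * expR (b * X x)) =
  \int[nu]_x (X x ^+ k * expR (b * X x)).
Proof.
elim: k b => [|k ih] b.
  by under eq_Rintegral do rewrite expr0 mul1r;
     under [RHS]eq_Rintegral do rewrite expr0 mul1r.
have cvgq (m : {measure set T -> \bar R}) (im : forall a, m.-integrable setT (EFin \o (fun x => expR (a * X x)))) :
    \int[m]_x quot k b j x @[j --> \oo] --> \int[m]_x (X x ^+ k.+1 * expR (b * X x)).
  apply: (@Rintegral_dominated_cvg _ _ _ m (quot k b) _
    (fun x => k.+1`!%:R * expR ((`|b| + 2) * `|X x|))) => //.
  - by move=> j; apply: measurable_funM => //; apply: measurable_funB; exact: mpow.
  - exact: integrable_dom.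
have := cvgq _ intnu; rewrite (_ : (fun j => _) = (fun j => \int[mu]_x quot k b j x)).
  by move/(cvg_unique _ (cvgq _ intmu)); exact.
apply/funext => j.
have iB (m : {measure set T -> \bar R}) (im : forall a, m.-integrable setT (EFin \o (fun x => expR (a * X x)))) :
  m.-integrable setT (EFin \o (fun x => X x ^+ k * expR ((b + j.+1%:R^-1) * X x) - X x ^+ k * expR (b * X x))).
  exact: (integrableB measurableT (integrable_pow im k _) (integrable_pow im k b)).
rewrite !RintegralZl//; try exact: iB.
by rewrite !RintegralB// ?ih//; exact: integrable_pow.
Qed.

(** The bound on the coefficients makes every partial sum at most [expR |X|], which is integrable,
    so the equality of moments can be summed term by term. *)
Lemma eq_mgf_pseries (c : R^nat) (F : R -> R) :
  (forall n, `|c n| <= n`!%:R^-1) ->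
  (forall x, series (fun n => c n * x ^+ n) n @[n --> \oo] --> F x) ->
  \int[mu]_x F (X x) = \int[nu]_x F (X x).
Proof.
move=> cle cF.
have cvgS (m : {measure set T -> \bar R}) (im : forall a, m.-integrable setT (EFin \o (fun x => expR (a * X x)))) :
    \int[m]_x series (fun n => c n * X x ^+ n) n @[n --> \oo] --> \int[m]_x F (X x).
  apply: (@Rintegral_dominated_cvg _ _ _ m _ _
    (fun x => 1 * expR (1 * `|X x|))) => //.
  - move=> n; rewrite /series/=; apply: measurable_sum => i.
    by apply: measurable_funM => //; exact: measurable_funX.
  - exact: integrable_dom.
  - move=> n x; rewrite !mul1r (le_trans (ler_norm_sum _ _ _))//.
    have := is_cvg_series_exp_coeff `|X x|.
    move=> /nondecreasing_cvgn_le; rewrite -/(expR `|X x|) => /(_ _ n) h.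
    apply: le_trans (h _); last first.
      apply: nondecreasing_series => i _ _; exact: exp_coeff_ge0.
    apply: ler_sum => i _; rewrite normrM normrX /exp_coeff/= mulrC.
    by rewrite ler_wpM2l ?exprn_ge0.
have := cvgS _ intnu; rewrite (_ : (fun n => _) =
    (fun n => \int[mu]_x series (fun n => c n * X x ^+ n) n)).
  by move/(cvg_unique _ (cvgS _ intmu)); exact.
have isum (m : {measure set T -> \bar R}) (im : forall a, m.-integrable setT (EFin \o (fun x => expR (a * X x)))) n :
    m.-integrable setT (EFin \o (fun x => series (fun n => c n * X x ^+ n) n)).
  rewrite (_ : _ \o _ = (fun x => (\sum_(0 <= i < n)
     ((c i)%:E * (X x ^+ i * expR (0 * X x))%:E))%E)); last first.
    apply/funext => x /=; rewrite /series/= -sumEFin; apply: eq_bigr => i _; congr EFin.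
    by rewrite mul0r expR0 mulr1.
  by apply: integrable_sum => // i _; apply: integrableZl => //; exact: integrable_pow.
have ipow (m : {measure set T -> \bar R}) (im : forall a, m.-integrable setT (EFin \o (fun x => expR (a * X x)))) n :
    m.-integrable setT (EFin \o (fun x => X x ^+ n)).
  have := integrable_pow im n 0; apply: eq_integrable => // x _ /=.
  by rewrite mul0r expR0 mulr1.
apply/funext => n; elim: n => [|n ih].
  by under eq_Rintegral do rewrite /series/= big_nil;
     under [RHS]eq_Rintegral do rewrite /series/= big_nil;
     rewrite !Rintegral_cst// !mul0r.
under eq_Rintegral do rewrite seriesSr.
under [RHS]eq_Rintegral do rewrite seriesSr.
have icpow (m : {measure set T -> \bar R}) (im : forall a, m.-integrable setT (EFin \o (fun x => expR (a * X x)))) :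
    m.-integrable setT (EFin \o (fun x => c n * X x ^+ n)).
  by have := integrableZl measurableT (c n) (ipow _ im n).
rewrite !RintegralD//; try exact: isum; try exact: icpow.
rewrite ih !RintegralZl//; try exact: ipow.
congr (_ + _ * _); have := eq_moments n 0.
by under eq_Rintegral do rewrite mul0r expR0 mulr1;
   under [RHS]eq_Rintegral do rewrite mul0r expR0 mulr1.
Qed.

Let finite1 (m : {measure set T -> \bar R}) (im : forall a, m.-integrable setT (EFin \o (fun x => expR (a * X x)))) :
  m.-integrable setT (cst 1%:E).
Proof. by have := im 0; apply: eq_integrable => // x _ /=; rewrite mul0r expR0. Qed.

(** The phase [a] covers sine and cosine at once and gives a family whose products are again
    combinations of its members. *)
Lemma eq_mgf_cos a : \int[mu]_x cos (X x + a) = \int[nu]_x cos (X x + a).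
Proof.
have ecos : \int[mu]_x cos (X x) = \int[nu]_x cos (X x).
  apply: (@eq_mgf_pseries (fun n => (~~ odd n)%:R * (-1) ^+ n./2 * n`!%:R^-1)).
    move=> n; rewrite !normrM normrX normrN normr1 expr1n mulr1.
    rewrite (ger0_norm (ler0n _ _)) [X in _ * X]ger0_norm ?invr_ge0//.
    by rewrite ler_piMl ?invr_ge0//; case: odd.
  by move=> x; rewrite cosE; have := @is_cvg_series_cos_coeff R x; rewrite cos_coeffE.
have esin : \int[mu]_x sin (X x) = \int[nu]_x sin (X x).
  apply: (@eq_mgf_pseries (fun n => (odd n)%:R * (-1) ^+ n.-1./2 * n`!%:R^-1)).
    move=> n; rewrite !normrM normrX normrN normr1 expr1n mulr1.
    rewrite (ger0_norm (ler0n _ _)) [X in _ * X]ger0_norm ?invr_ge0//.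
    by rewrite ler_piMl ?invr_ge0//; case: odd.
  by move=> x; rewrite sinE; have := @is_cvg_series_sin_coeff R x; rewrite sin_coeffE.
have icos (m : {measure set T -> \bar R}) (im : forall a, m.-integrable setT (EFin \o (fun x => expR (a * X x)))) :
    m.-integrable setT (EFin \o (fun x => cos (X x))).
  apply: (integrable_le _ (finite1 im)); last by move=> x; exact: cos_max.
  by apply: measurableT_comp => //; apply: continuous_measurable_fun; exact: continuous_cos.
have isin (m : {measure set T -> \bar R}) (im : forall a, m.-integrable setT (EFin \o (fun x => expR (a * X x)))) :
    m.-integrable setT (EFin \o (fun x => sin (X x))).
  apply: (integrable_le _ (finite1 im)); last by move=> x; exact: sin_max.
  by apply: measurableT_comp => //; apply: continuous_measurable_fun; exact: continuous_sin.
have E (m : {measure set T -> \bar R}) (im : forall a, m.-integrable setT (EFin \o (fun x => expR (a * X x)))) :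
    \int[m]_x cos (X x + a) = cos a * \int[m]_x cos (X x) - sin a * \int[m]_x sin (X x).
  under eq_Rintegral do rewrite cosD (mulrC (cos (X _))) (mulrC (sin (X _))).
  rewrite RintegralB//; first by rewrite !RintegralZl//; [exact: isin|exact: icos].
    by have := integrableZl measurableT (cos a) (icos _ im).
  by have := integrableZl measurableT (sin a) (isin _ im).
by rewrite !E// ecos esin.
Qed.

End exponential_moments.

(** * The normal density *)

Section normal_pdf_theory.
Context (R : realType) (sigma : R).
Hypothesis sigma0 : sigma != 0.
Local Notation mu := (@lebesgue_measure R).
Implicit Types (m t r x y : R).

Lemma normal_pdf_subr x y : normal_pdf 0 sigma (x - y) = normal_pdf x sigma y.
Proof. by rewrite !normal_pdfE// /normal_fun subr0 -(sqrrN (x - y)) opprB. Qed.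

Lemma normal_pdf_addr x y : normal_pdf 0 sigma (x + y) = normal_pdf (- x) sigma y.
Proof. by rewrite !normal_pdfE// /normal_fun subr0 opprK addrC. Qed.

Lemma ge0_integral_normal_prob (G : R -> \bar R) : measurable_fun setT G ->
  (forall x, 0 <= G x)%E ->
  (\int[normal_prob 0 sigma]_x G x =
   \int[mu]_x (G x * (normal_pdf 0 sigma x)%:E))%E.
Proof.
move=> mG G0.
(* The logarithm of the density, so that the normal law becomes a [tilt] of Lebesgue measure. *)
pose l (x : measurableTypeR R) : R := ln (normal_peak sigma) - x ^+ 2 / (sigma ^+ 2 *+ 2).
have ml : measurable_fun setT l.
  by apply: measurable_funB => //; apply: measurable_funM => //; exact: measurable_funX.
pose L : {mfun measurableTypeR R >-> R} := HB.pack l (isMeasurableFun.Build _ _ _ _ _ ml).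
have pdfE x : normal_pdf 0 sigma x = expR (l x).
  rewrite normal_pdfE// /normal_fun /l expRD subr0 lnK ?posrE ?normal_peak_gt0//.
  by rewrite mulNr.
rewrite (@eq_measure_integral _ _ _ _ (tilt lebesgue_measure L)); last first.
  by move=> A mA _; apply: eq_integral => x _; rewrite pdfE.
rewrite ge0_integral_tilt//.
by apply: eq_integral => x _; rewrite pdfE.
Qed.

Lemma ge0_integral_centred_normal (G : R -> \bar R) : measurable_fun setT G ->
  (forall x, 0 <= G x)%E ->
  (\int[centred_normal sigma]_x G x =
   \int[mu]_x (G x * (normal_pdf 0 sigma x)%:E))%E.
Proof.
move=> mG G0; rewrite /centred_normal (negbTE sigma0) ge0_integral_distribution//.
exact: ge0_integral_normal_prob.
Qed.

Lemma integral_expR_normal_pdf m t :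
  (\int[mu]_y (expR (t * y) * normal_pdf m sigma y)%:E)%E =
  (expR (t * m + t ^+ 2 / 2 * sigma ^+ 2))%:E.
Proof.
transitivity (\int[mu]_y ((expR (t * m + t ^+ 2 / 2 * sigma ^+ 2))%:E *
    (normal_pdf (m + t * sigma ^+ 2) sigma y)%:E))%E.
  apply: eq_integral => y _; rewrite -!EFinM; congr EFin.
  rewrite !normal_pdfE// /normal_fun mulrCA [RHS]mulrCA -!expRD.
  by congr (_ * expR _); field.
rewrite ge0_integralZl//.
- by rewrite integral_normal_pdf mule1.
- by apply/measurable_EFinP; exact: measurable_normal_pdf.
- by move=> x _; rewrite lee_fin normal_pdf_ge0.
Qed.

(** Chernoff bound for the mass that a normal law of mean [m] puts outside [[-r, r]]. Being linear
    in [expR m + expR (- m)], it can be integrated in [m] against any law with these exponential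
    moments. *)
Definition normal_tail r m : R :=
  expR (- r) * (expR (sigma ^+ 2 / 2) * (expR m + expR (- m))).

Lemma normal_tail_ge0 r m : 0 <= normal_tail r m.
Proof. by rewrite !mulr_ge0 ?addr_ge0 ?expR_ge0. Qed.

Lemma normal_tail_le (w : R -> R) r m : measurable_fun setT w ->
  (forall y, 0 <= w y <= 1) ->
  (\int[mu]_y (w y * normal_pdf m sigma y)%:E <=
   \int[mu]_(y in `[(- r)%R, r]%classic) (w y * normal_pdf m sigma y)%:E +
   (normal_tail r m)%:E)%E.
Proof.
move=> mw w01.
have mpdf : measurable_fun setT (normal_pdf m sigma) by exact: measurable_normal_pdf.
have mexp t : measurable_fun setT (fun y : R => expR (t * y)).
  by apply: measurableT_comp => //; exact: measurable_funM.
have mexpP t : measurable_fun setT (fun y : measurableTypeR R => (expR (t * y) * normal_pdf m sigma y)%:E).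
  by apply/measurable_EFinP; exact: (measurable_funM (mexp t) mpdf).
have mwP : measurable_fun setT (fun y : measurableTypeR R => (w y * normal_pdf m sigma y)%:E).
  by apply/measurable_EFinP; exact: (measurable_funM mw mpdf).
have tailE : (normal_tail r m)%:E = (\int[mu]_y ((expR (- r))%:E *
    ((expR (1 * y) * normal_pdf m sigma y)%:E +
     (expR (-1 * y) * normal_pdf m sigma y)%:E)))%E.
  have mD : measurable_fun setT (fun y : measurableTypeR R =>
      (expR (1 * y) * normal_pdf m sigma y)%:E +
      (expR (-1 * y) * normal_pdf m sigma y)%:E)%E.
    exact: emeasurable_funD.
  have E0 t y : (0 <= (expR (t * y) * normal_pdf m sigma y)%:E)%E.
    by rewrite lee_fin mulr_ge0 ?expR_ge0 ?normal_pdf_ge0.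
  rewrite (ge0_integralZl _ measurableT mD)//; last by move=> y _; rewrite adde_ge0.
  rewrite (ge0_integralD _ measurableT)//.
  rewrite !integral_expR_normal_pdf -EFinD -EFinM; congr EFin.
  rewrite /normal_tail sqrrN expr1n !mul1r mulN1r !expRD (mulrC 2^-1).
  by ring.
have h0 y : 0 <= w y * normal_pdf m sigma y.
  by rewrite mulr_ge0 ?normal_pdf_ge0//; have /andP[] := w01 y.
have E0 t y : (0 <= (expR (t * y) * normal_pdf m sigma y)%:E)%E.
  by rewrite lee_fin mulr_ge0 ?expR_ge0 ?normal_pdf_ge0.
have mI : measurable_fun setT ((fun y : measurableTypeR R =>
    (w y * normal_pdf m sigma y)%:E) \_ `[- r, r]).
  by apply/(measurable_restrictT _ (measurable_itv _)); exact: measurable_funTS.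
have I0 y : (0 <= ((fun y => (w y * normal_pdf m sigma y)%:E) \_ `[(- r)%R, r]%classic) y)%E.
  by rewrite patchE; case: ifP => // _; rewrite lee_fin.
have mS : measurable_fun setT (fun y : measurableTypeR R => (expR (- r))%:E *
      ((expR (1 * y) * normal_pdf m sigma y)%:E +
      (expR (-1 * y) * normal_pdf m sigma y)%:E))%E.
  by apply: emeasurable_funM => //; exact: emeasurable_funD.
have S0 (y : R) : (0 <= (expR (- r))%:E * ((expR (1 * y) * normal_pdf m sigma y)%:E +
      (expR (-1 * y) * normal_pdf m sigma y)%:E))%E.
  by rewrite mule_ge0 ?adde_ge0// lee_fin expR_ge0.
rewrite tailE [X in (_ <= X + _)%E]integral_mkcond -(ge0_integralD _ measurableT)//.
apply: ge0_le_integral => //.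
- by move=> y _; rewrite lee_fin.
- exact: emeasurable_funD.
move=> y _; rewrite patchE; case: ifPn => [_|].
  by rewrite leeDl// mule_ge0 ?adde_ge0// lee_fin expR_ge0.
rewrite notin_setE/= in_itv/= -ler_norml => /negP; rewrite -ltNge => ry.
rewrite add0e -EFinD -EFinM lee_fin -mulrDl mulrA ler_wpM2r ?normal_pdf_ge0//.
have /andP[_ w1] := w01 y; apply: (le_trans w1).
rewrite mul1r mulN1r; apply: (@le_trans _ _ (expR (- r) * expR `|y|)).
  by rewrite -expRD -[leLHS]expR0 ler_expR addrC subr_ge0 ltW.
by rewrite ler_wpM2l ?expR_ge0// expR_norm_le.
Qed.

Lemma integral_translation (G : R -> R) x : continuous G ->
  (forall y, 0 <= G y) ->
  (\int[mu]_y (G (x + y))%:E = \int[mu]_y (G y)%:E)%E.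
Proof.
move=> cG G0.
have dF : (fun y : R => x + y)^`()%classic = cst 1.
  by apply/funext => y; rewrite derive1E deriveD// derive_cst derive_id add0r.
rewrite [RHS](@increasing_ge0_integration_by_substitutionT _ (fun y => x + y))//.
- by apply: eq_integral => y _; rewrite dF !fctE/= mulr1.
- by move=> a b; rewrite ltrD2l.
- by rewrite dF => y; exact: cvg_cst.
- by rewrite dF; exact: is_cvg_cst.
- by rewrite dF; exact: is_cvg_cst.
- exact: cvg_addrl_Ny.
- exact: cvg_addrl.
Qed.

End normal_pdf_theory.

(** * Borel sets of a separable Hilbert space and linear functionals *)

Section inner_theory.
Context (R : realType) (H : hilbertType R).
Implicit Types u v w : H.

Lemma innerC u v : inner u v = inner v u.
Proof. by rewrite [LHS]hermC expr0 mul1r. Qed.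

Lemma innerDl u v w : inner (u + v) w = inner u w + inner v w.
Proof. exact: linearDl. Qed.

Lemma innerDr u v w : inner u (v + w) = inner u v + inner u w.
Proof. by rewrite ![inner u _]innerC innerDl. Qed.

Lemma innerZl (a : R) u w : inner (a *: u) w = a * inner u w.
Proof. by rewrite linearZl_LR. Qed.

Lemma innerZr (a : R) u w : inner u (a *: w) = a * inner u w.
Proof. by rewrite ![inner u _]innerC innerZl. Qed.

Lemma innerNl u w : inner (- u) w = - inner u w.
Proof. exact: linearNl. Qed.

Lemma innerNr u w : inner u (- w) = - inner u w.
Proof. by rewrite ![inner u _]innerC innerNl. Qed.

Lemma innerBl u v w : inner (u - v) w = inner u w - inner v w.
Proof. exact: linearBl. Qed.

Lemma inner_le_norm u v : inner u v <= `|u| * `|v|.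
Proof.
have [->|u0] := eqVneq u 0; first by rewrite linear0l normr0 mul0r.
have [->|v0] := eqVneq v 0; first by rewrite innerC linear0l normr0 mulr0.
have := sqr_ge0 `| `|v| *: u - `|u| *: v|.
rewrite -inner_normE innerDl innerNl !innerDr !innerNr !innerZl !innerZr.
rewrite !inner_normE (innerC v u) => h.
have uv : 0 < `|u| * `|v| by rewrite mulr_gt0 ?normr_gt0.
rewrite -(ler_pM2l uv); lra.
Qed.

Lemma normr_inner_le u v : `|inner u v| <= `|u| * `|v|.
Proof.
rewrite ler_norml inner_le_norm andbT lerNl -innerNl -(normrN u).
exact: inner_le_norm.
Qed.

Lemma inner_continuousl (e : H) : continuous (fun u : H => inner u e).
Proof.
move=> u; apply/cvgrPdist_le => eps eps0.
near=> v; rewrite -innerBl (le_trans (normr_inner_le _ _))//.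
rewrite (@le_trans _ _ (`|u - v| * (`|e| + 1)))//.
  by rewrite ler_wpM2l// lerDl.
rewrite -ler_pdivlMr ?ltr_wpDl//; near: v; apply: cvgr_dist_le => //.
by rewrite divr_gt0// ltr_wpDl.
Unshelve. all: by end_near. Qed.

Definition inner_dual_fun (e : H) (u : H) : R^o := inner u e.

Let inner_dual_linear e : linear (inner_dual_fun e).
Proof. by move=> a u v; rewrite /inner_dual_fun innerDl innerZl. Qed.

HB.instance Definition _ e :=
  GRing.isLinear.Build R H R^o _ (inner_dual_fun e) (inner_dual_linear e).

Definition inner_dual (e : H) : dual H :=
  @Dual R H (inner_dual_fun e) (@inner_continuousl e).

End inner_theory.

Section dual_theory.
Context (R : realType) (V : normedModType R).
Implicit Types T S : dual V.

Let dualD_continuous T S : continuous (T \+ S : V -> R^o).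
Proof. by move=> x; apply: cvgD; exact: dual_continuous. Qed.

Definition dualD T S : dual V := @Dual R V (T \+ S) (@dualD_continuous T S).

Let dualZ_continuous (a : R) T : continuous (a \*: T : V -> R^o).
Proof. by move=> x; apply: cvgZr; exact: dual_continuous. Qed.

Definition dualZ (a : R) T : dual V := @Dual R V (a \*: T) (@dualZ_continuous a T).

Lemma measurable_dual T : measurable_fun [set: borel V] (T : borel V -> R).
Proof. exact: (continuous_borel_measurable (@dual_continuous _ _ T)). Qed.

End dual_theory.

(** * Polynomial iteration towards the sign function *)

Section sign_iteration.
Context (R : realType).

(** The Newton-Schulz step for the sign: an odd cubic that preserves [[-1, 1]], with attracting
    fixed points 1 and -1. As a polynomial, it stays inside any algebra of functions. *)
Definition sign_step (x : R) : R := (3 * x - x ^+ 3) / 2.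

Lemma sign_step_norm x : `|x| <= 1 -> `|sign_step x| <= 1.
Proof.
rewrite !ler_norml /sign_step => /andP[x1 x2].
have h1 : 0 <= (1 - x) ^+ 2 * (2 + x) by rewrite mulr_ge0 ?sqr_ge0//; lra.
have h2 : 0 <= (1 + x) ^+ 2 * (2 - x) by rewrite mulr_ge0 ?sqr_ge0//; lra.
by apply/andP; split; lra.
Qed.

Lemma sign_step_iter_norm n x : `|x| <= 1 -> `|iter n sign_step x| <= 1.
Proof. by move=> x1; elim: n => //= n; exact: sign_step_norm. Qed.

(** [1 - sign_step y] is [1 - y] times [(1 - y) * (2 + y) / 2], and the latter factor is at most
    [1 - x / 2] as soon as [y >= x]. The iterates never drop below the starting point, so the rate
    is geometric. *)
Let iter_gt0 n x : 0 < x <= 1 ->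
  x <= iter n sign_step x <= 1 /\ 1 - iter n sign_step x <= (1 - x / 2) ^+ n.
Proof.
move=> /andP[x0 x1]; elim: n => [|n [/andP[h1 h2] h3]] /=.
  by rewrite lexx x1 expr0; split => //; lra.
set y := iter n sign_step x in h1 h2 h3 *; rewrite /sign_step; split.
  have h4 : 0 <= (1 - y) ^+ 2 * (2 + y) by rewrite mulr_ge0 ?sqr_ge0//; lra.
  have h5 : 0 <= y * (1 - y ^+ 2).
    by rewrite mulr_ge0 ?subr_ge0 ?expr_le1//; lra.
  by apply/andP; split; lra.
rewrite [leRHS]exprS; apply: (@le_trans _ _ ((1 - x / 2) * (1 - y))); last first.
  by rewrite ler_wpM2l//; lra.
have h4 : 0 <= (1 - y) * (y - x) by rewrite mulr_ge0//; lra.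
have h5 : 0 <= (1 - y) * y ^+ 2 by rewrite mulr_ge0 ?sqr_ge0//; lra.
lra.
Qed.

Lemma sign_step_iterN n x : iter n sign_step (- x) = - iter n sign_step x.
Proof.
by elim: n => //= n ->; rewrite /sign_step exprNn; ring.
Qed.

Lemma sign_step_iter_cvg x : `|x| <= 1 ->
  iter n sign_step x @[n --> \oo] --> Num.sg x.
Proof.
have pos y : 0 < y <= 1 -> iter n sign_step y @[n --> \oo] --> (1 : R).
  move=> y01; have /andP[y0 y1] := y01.
  apply: (@squeeze_cvgr _ _ _ _ (fun n => 1 - (1 - y / 2) ^+ n) (cst 1)).
  - apply: nearW => n; have [/andP[_ h1] h2] := iter_gt0 n y01.
    by rewrite h1 andbT; lra.
  - rewrite -[X in _ --> X]subr0; apply: cvgB; first exact: cvg_cst.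
    by apply: cvg_expr; rewrite ger0_norm; lra.
  - exact: cvg_cst.
have [x0 xle|x0 xle|-> _] := ltrgt0P x.
- by rewrite gtr0_sg//; apply: pos; rewrite x0 (le_trans _ xle) ?ler_norm.
- rewrite ltr0_sg// -(opprK x); under eq_fun do rewrite sign_step_iterN.
  by apply: cvgN; apply: pos; rewrite oppr_gt0 x0 (le_trans _ xle)// -normrN ler_norm.
- rewrite sgr0 (_ : (fun n => _) = cst 0); first exact: cvg_cst.
  by apply/funext; elim=> //= n ->; rewrite /sign_step expr0n/=; ring.
Qed.

End sign_iteration.

(** * Half-spaces generate the Borel sets *)

Section separable_borel.
Context (R : realType) (V : hilbertType R).

Lemma separable_sequence : separable V ->
  exists s : nat -> V, forall (x : V) (e : R), 0 < e -> exists n, `|x - s n| < e.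
Proof.
move=> [S [/pcard_leP/unsquash f dS]].
exists (fun n => xget 0 [set x | S x /\ f x = n]) => x e e0.
have [||y [xy Sy]] := dS (ball x e); first by exists x; exact: ballxx.
  exact: ball_open.
exists (f y); case: xgetP => [z _ [Sz fzy]|/(_ y)/= []]; last by split.
have -> : z = y by apply: (@inj _ _ _ f); rewrite ?inE.
by move: xy; rewrite -ball_normE.
Qed.

(** If [y = f - a] is longer than [q], a normal [s m] close enough to [y] already separates [f] from
    the ball. The half-spaces are complements of sets [T f < b], the form of the generators used
    below. *)
Lemma closed_ball_half_spaces (s : nat -> V) (a : V) (q : R) : 0 < q ->
  (forall (x : V) (e : R), 0 < e -> exists n, `|x - s n| < e) ->
  [set f | `|f - a| <= q] =
  \bigcap_m (~` [set f | inner_dual (- s m) f < - (q * `|s m|) - inner a (s m)]).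
Proof.
move=> q0 ds; apply/seteqP; split => f /=.
  move=> faq m _ /=; apply/negP; rewrite -leNgt /inner_dual_fun innerNr.
  rewrite -opprD lerN2 -lerBlDr -innerBl (le_trans (inner_le_norm _ _))//.
  by rewrite ler_wpM2r.
move=> H; set y := f - a.
have {}H m : inner y (s m) <= q * `|s m|.
  have /negP := H m I; rewrite -leNgt /= /inner_dual_fun innerNr.
  by rewrite -opprD lerN2 -lerBlDr -innerBl.
rewrite leNgt; apply/negP => qy.
have y0 : 0 < `|y| by exact: lt_trans qy.
(* Chosen so that [e * (q + |y|)] is half of [|y| * (|y| - q)], which contradicts
   [|y| ^+ 2 <= q * (|y| + e) + |y| * e]. *)
pose e := `|y| * (`|y| - q) / (2 * (q + `|y|)).
have e0 : 0 < e by rewrite divr_gt0 ?mulr_gt0 ?subr_gt0// addr_gt0.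
have [m ym] := ds y e e0.
have : `|y| ^+ 2 <= q * (`|y| + e) + `|y| * e.
  rewrite -inner_normE -[X in inner _ X](subrK (s m)) addrC innerDr lerD//.
    rewrite (le_trans (H m))// ler_wpM2l ?(ltW q0)//.
    rewrite -[s m](subKr y) (le_trans (ler_normB _ _))// lerD2l.
    exact: ltW.
  rewrite (le_trans (inner_le_norm _ _))// ler_wpM2l//; exact: ltW.
have : e * (2 * (q + `|y|)) = `|y| * (`|y| - q).
  by rewrite /e divfK// gt_eqF// mulr_gt0// addr_gt0.
nra.
Qed.

(* Closed balls are countable intersections of half-spaces, with normals in a
   countable dense set. *)
Lemma borel_half_spaces (G : set (set V)) : separable V ->
  sigma_algebra setT G ->
  (forall (T : dual V) (b : R), G [set f | T f < b]) ->
  forall B : set V, measurable (B : set (borel V)) -> G B.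
Proof.
move=> /separable_sequence[s ds] [G0 GC GU] Ghalf B mB.
have Gcompl A : G A -> G (~` A) by rewrite -setTD; exact: GC.
have Gcap (A_ : nat -> set V) : (forall n, G (A_ n)) -> G (\bigcap_n A_ n).
  by move=> GA; rewrite -(setCK (\bigcap_n _)) setC_bigcap; apply/Gcompl/GU => n; exact/Gcompl/GA.
suff openG : (@open V) `<=` G.
  by apply: (mB : <<s @open V >> B); split => //; split.
move=> U oU.
pose cb n k := [set f | `|f - s n| <= k.+1%:R^-1].
have -> : U = \bigcup_n \bigcup_k (if `[< cb n k `<=` U >] then cb n k else set0).
  apply/seteqP; split => [x Ux|x [n _ [k _]]]; last by case: asboolP => [h|_]//; exact: h.
  have /nbhs_ballP[r /= r0 rU] : nbhs x U by exact: open_nbhs_nbhs.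
  have [k] : exists k : nat, k.+1%:R^-1 < r / 2.
    have := @ltr_add_invr R 0 (r / 2) ; rewrite divr_gt0// => /(_ isT)[k].
    by rewrite add0r; exists k.
  move=> kr; have [n xn] := ds x k.+1%:R^-1 ltac:(by []).
  exists n => //; exists k => //; case: asboolP => [_|].
    by rewrite /cb/= ltW.
  case=> z /= zn; apply: rU; rewrite -ball_normE/=.
  rewrite (le_lt_trans (ler_distD (s n) _ _))//.
  rewrite (splitr r) ltrD// ?(lt_trans xn)//.
  by rewrite distrC (le_lt_trans zn).
apply: (GU) => n; apply: (GU) => k; case: asboolP => // _.
by rewrite /cb (closed_ball_half_spaces _ _ ds)//; apply: Gcap => m; exact/Gcompl/Ghalf.
Qed.

End separable_borel.

(** * Borel measures with equal exponential moments *)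

Lemma cosM_cosD (R : realType) (x y : R) :
  cos x * cos y = 2^-1 * (cos (x + y) + cos (x - y)).
Proof. by rewrite !cosD cosN sinN; field. Qed.

Section eq_mgf_measure.
Context (R : realType) (V : hilbertType R).
Variables (mu nu : {measure set (borel V) -> \bar R}).
Hypothesis intmu : forall T : dual V,
  mu.-integrable setT (EFin \o (fun f : borel V => expR (T f))).
Hypothesis intnu : forall T : dual V,
  nu.-integrable setT (EFin \o (fun f : borel V => expR (T f))).
Hypothesis eq_mgf : forall T : dual V,
  \int[mu]_f expR (T f) = \int[nu]_f expR (T f).

Let eq_cos (T : dual V) a : \int[mu]_f cos (T f + a) = \int[nu]_f cos (T f + a).
Proof.
apply: eq_mgf_cos; first exact: measurable_dual.
- by move=> b; exact: (intmu (dualZ b T)).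
- by move=> b; exact: (intnu (dualZ b T)).
- by move=> b; exact: (eq_mgf (dualZ b T)).
Qed.

Let bdd (g : borel V -> R) :=
  measurable_fun setT g /\ exists K, forall x, `|g x| <= K.

Let int_bdd (m : {measure set (borel V) -> \bar R}) g :
  (forall T : dual V, m.-integrable setT (EFin \o (fun f : borel V => expR (T f)))) ->
  bdd g -> m.-integrable setT (EFin \o g).
Proof.
move=> im [mg [K gK]].
(* [dualZ 0 (inner_dual 0)] serves as the zero functional; its exponential is 1, so constants are
   integrable. *)
have iK : m.-integrable setT (EFin \o (fun x : borel V => K * expR (dualZ 0 (inner_dual 0) x))).
  by have := integrableZl measurableT K (im (dualZ 0 (inner_dual 0))).
apply: (integrable_le mg iK) => x /=; rewrite /GRing.scale/= mul0r expR0 mulr1.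
exact: gK.
Qed.

Let bdd_cst c : bdd (cst c).
Proof. by split => //; exists `|c|. Qed.

Let bddM g h : bdd g -> bdd h -> bdd (fun x => g x * h x).
Proof.
move=> [mg [K gK]] [mh [L hL]]; split; first exact: measurable_funM.
by exists (K * L) => x; rewrite normrM ler_pM.
Qed.

Let bddD g h : bdd g -> bdd h -> bdd (fun x => g x + h x).
Proof.
move=> [mg [K gK]] [mh [L hL]]; split; first exact: measurable_funD.
by exists (K + L) => x; rewrite (le_trans (ler_normD _ _))// lerD.
Qed.

Let bdd_cos (T : dual V) a : bdd (fun f => cos (T f + a)).
Proof.
split; last by exists 1 => x; exact: cos_max.
apply: (@measurableT_comp _ _ _ _ _ _ (@cos R)).
  by apply: continuous_measurable_fun; exact: continuous_cos.
by apply: measurable_funD => //; exact: measurable_dual.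
Qed.

(** Testing against every cosine with a phase, instead of comparing plain integrals, leaves room for
    a further cosine factor through the product-to-sum formula. *)
Let N1 g := bdd g /\ forall (T : dual V) a,
  \int[mu]_f (g f * cos (T f + a)) = \int[nu]_f (g f * cos (T f + a)).

(* [N1] is not obviously stable under products; its multipliers are. *)
Let N2 g := bdd g /\ forall q, N1 q -> N1 (fun f => g f * q f).

Let N1_cvg (g_ : nat -> borel V -> R) g K : (forall n, N1 (g_ n)) ->
  (forall n x, `|g_ n x| <= K) -> (forall x, g_ n x @[n --> \oo] --> g x) -> N1 g.
Proof.
move=> Ng gK cg.
have bg : bdd g.
  split; last first.
    exists K => x; apply: (cvgr_to_le (cvg_norm (cg x))).
    by apply: nearW => n; exact: gK.
  apply: (@measurable_fun_cvg _ _ _ _ g_) => [n|x _]; last exact: cg.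
  by have [[]] := Ng n.
split => // T a.
have cvgi (m : {measure set (borel V) -> \bar R}) :
  (forall T : dual V, m.-integrable setT (EFin \o (fun f : borel V => expR (T f)))) ->
    \int[m]_f (g_ n f * cos (T f + a)) @[n --> \oo] --> \int[m]_f (g f * cos (T f + a)).
  move=> im; apply: (@Rintegral_dominated_cvg _ _ _ m _ _ (cst K)) => //.
  - by move=> n; have [] := bddM (Ng n).1 (bdd_cos T a).
  - by move=> x; apply: cvgM; [exact: cg|exact: cvg_cst].
  - exact: int_bdd.
  - move=> n x; rewrite normrM (le_trans _ (gK n x))// ler_piMr//.
    exact: cos_max.
have := cvgi _ intnu; rewrite (_ : (fun n => _) =
    (fun n => \int[mu]_f (g_ n f * cos (T f + a)))).
  by move/(cvg_unique (@Rhausdorff R) (cvgi _ intmu)).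
by apply/funext => n; rewrite (Ng n).2.
Qed.

Let N1D g h : N1 g -> N1 h -> N1 (fun f => g f + h f).
Proof.
move=> [bg Ng] [bh Nh]; split; first exact: bddD.
move=> T a; under eq_Rintegral do rewrite mulrDl.
under [RHS]eq_Rintegral do rewrite mulrDl.
rewrite !RintegralD ?Ng ?Nh//.
all: by apply: int_bdd => //; exact: bddM.
Qed.

Let N1Z c g : N1 g -> N1 (fun f => c * g f).
Proof.
move=> [bg Ng]; split; first by apply: (bddM (bdd_cst c)).
move=> T a; under eq_Rintegral do rewrite -mulrA.
under [RHS]eq_Rintegral do rewrite -mulrA.
rewrite !RintegralZl ?Ng//.
all: by apply: int_bdd => //; exact: bddM.
Qed.

Let N1_ext g h : N1 g -> g =1 h -> N1 h.
Proof. by move=> Ng /funext <-. Qed.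

Let N1_cos (T : dual V) a : N1 (fun f => cos (T f + a)).
Proof.
split => // S b.
have E (m : {measure set (borel V) -> \bar R}) :
  (forall T : dual V, m.-integrable setT (EFin \o (fun f : borel V => expR (T f)))) ->
  \int[m]_f (cos (T f + a) * cos (S f + b)) =
  2^-1 * (\int[m]_f cos (dualD T S f + (a + b)) +
          \int[m]_f cos (dualD T (dualZ (-1) S) f + (a - b))).
  move=> im.
  rewrite -RintegralD//; [|by apply: int_bdd => //; exact: bdd_cos..].
  rewrite -RintegralZl//; last first.
    by apply: int_bdd => //; apply: bddD; exact: bdd_cos.
  apply: eq_Rintegral => f _ /=.
  rewrite (_ : T f + S f + (a + b) = (T f + a) + (S f + b)); last by ring.
  rewrite (_ : T f + (-1) *: S f + (a - b) = (T f + a) - (S f + b)); last first.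
    by rewrite scaleN1r; ring.
  exact: cosM_cosD.
by rewrite !E// !eq_cos.
Qed.

Let N2_N1 g : N2 g -> N1 g.
Proof.
move=> [bg Ng]; have := Ng _ (N1_cos (inner_dual 0) 0).
move/N1_ext; apply => f /=.
by rewrite /inner_dual_fun innerC linear0l add0r cos0 mulr1.
Qed.

Let N2_ext g h : N2 g -> g =1 h -> N2 h.
Proof. by move=> Ng /funext <-. Qed.

Let N2_cst c : N2 (cst c).
Proof. by split => // q; exact: N1Z. Qed.

Let N2D g h : N2 g -> N2 h -> N2 (fun f => g f + h f).
Proof.
move=> [bg Ng] [bh Nh]; split; first exact: bddD.
move=> q Nq; apply: (N1_ext (N1D (Ng _ Nq) (Nh _ Nq))) => f.
by rewrite mulrDl.
Qed.

Let N2M g h : N2 g -> N2 h -> N2 (fun f => g f * h f).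
Proof.
move=> [bg Ng] [bh Nh]; split; first exact: bddM.
move=> q Nq; apply: (N1_ext (Ng _ (Nh _ Nq))) => f.
by rewrite mulrA.
Qed.

Let N2_cvg (g_ : nat -> borel V -> R) g K : (forall n, N2 (g_ n)) ->
  (forall n x, `|g_ n x| <= K) -> (forall x, g_ n x @[n --> \oo] --> g x) -> N2 g.
Proof.
move=> Ng gK cg; split.
  by have [] := N1_cvg (fun n => N2_N1 (Ng n)) gK cg.
move=> q Nq; have [[_ [L qL]] _] := Nq.
apply: (@N1_cvg (fun n f => g_ n f * q f) _ (K * L)).
- by move=> n; exact: (Ng n).2.
- by move=> n x; rewrite normrM ler_pM.
- by move=> x; apply: cvgM; [exact: cg|exact: cvg_cst].
Qed.

Let N2_cos (T : dual V) a : N2 (fun f => cos (T f + a)).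
Proof.
split => // q [bq Nq]; split; first exact: bddM.
move=> S b.
have E (m : {measure set (borel V) -> \bar R}) :
  (forall T : dual V, m.-integrable setT (EFin \o (fun f : borel V => expR (T f)))) ->
  \int[m]_f (cos (T f + a) * q f * cos (S f + b)) =
  2^-1 * (\int[m]_f (q f * cos (dualD T S f + (a + b))) +
          \int[m]_f (q f * cos (dualD T (dualZ (-1) S) f + (a - b)))).
  move=> im.
  rewrite -RintegralD//; [|by apply: int_bdd => //; apply: bddM => //; exact: bdd_cos..].
  rewrite -RintegralZl//; last first.
    by apply: int_bdd => //; apply: bddD; apply: bddM => //; exact: bdd_cos.
  apply: eq_Rintegral => f _ /=.
  rewrite (_ : T f + S f + (a + b) = (T f + a) + (S f + b)); last by ring.
  rewrite (_ : T f + (-1) *: S f + (a - b) = (T f + a) - (S f + b)); last first.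
    by rewrite scaleN1r; ring.
  by rewrite (mulrC _ (q f)) -mulrA cosM_cosD; field.
by rewrite !E// !Nq.
Qed.

Let N2_sign_iter g n : N2 g -> N2 (fun f => iter n (@sign_step R) (g f)).
Proof.
move=> Ng; elim: n => //= n ih.
apply: (@N2_ext (fun f => 3 / 2 * iter n (@sign_step R) (g f) + - 2^-1 *
  (iter n (@sign_step R) (g f) * (iter n (@sign_step R) (g f) * iter n (@sign_step R) (g f))))).
  apply: N2D; apply: N2M => //; try exact: N2_cst.
  by apply: N2M => //; exact: N2M.
by move=> f; rewrite /sign_step; field.
Qed.

Let N2_sign g : N2 g -> (forall x, `|g x| <= 1) -> N2 (fun f => Num.sg (g f)).
Proof.
move=> Ng g1; apply: (@N2_cvg (fun n f => iter n (@sign_step R) (g f)) _ 1).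
- by move=> n; exact: N2_sign_iter.
- by move=> n x; exact: sign_step_iter_norm.
- by move=> x; exact: sign_step_iter_cvg.
Qed.

(** The sign of [sin ((b - T f) / (n + 1))] equals that of [b - T f] once
    [|b - T f| < (n + 1) * pi]. At fixed [n] it is the limit of the sign iteration started from a
    function in the algebra [N2]. *)
Let N2_half_space (T : dual V) (b : R) : N2 (\1_[set f | T f < b]).
Proof.
have sgE : N2 (fun f => Num.sg (b - T f)).
  apply: (@N2_cvg (fun n f => Num.sg (cos (dualZ n.+1%:R^-1 T f - n.+1%:R^-1 * b + pi / 2))) _ 1).
  - move=> n; apply: N2_sign; last by move=> x; exact: cos_max.
    by apply: (N2_ext (N2_cos (dualZ n.+1%:R^-1 T) (- (n.+1%:R^-1 * b) + pi / 2))) => f; rewrite addrA.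
  - by move=> n x; case: sgrP; rewrite ?normr0 ?normrN1 ?normr1.
  move=> f; apply: cvg_near_cst.
  have [k kb] : exists k : nat, `|b - T f| / pi < k%:R.
    by exists (Num.bound (`|b - T f| / pi)); apply: archi_boundP; rewrite divr_ge0 ?pi_ge0.
  exists k => // n /= kn; rewrite cosDpihalf -sinN /=.
  rewrite (_ : - (_ + _) = n.+1%:R^-1 * (b - T f)); last first.
    by rewrite /GRing.scale/=; ring.
  have npi : `|b - T f| < n.+1%:R * pi.
    rewrite -ltr_pdivrMr ?pi_gt0// (lt_le_trans kb)// ler_nat.
    exact: (leq_trans kn).
  have ninv : 0 < n.+1%:R^-1 :> R by rewrite invr_gt0.
  have [d0|d0|->] := ltrgt0P (b - T f); last by rewrite mulr0 sin0.
  - rewrite (gtr0_sg d0) gtr0_sg// sin_gt0_pi// mulr_gt0//=.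
    by rewrite mulrC ltr_pdivrMr// mulrC (le_lt_trans _ npi)// ler_norm.
  - rewrite (ltr0_sg d0) ltr0_sg// -oppr_gt0 -sinN -mulrN.
    rewrite sin_gt0_pi// mulr_gt0 ?oppr_gt0//=.
    by rewrite mulrC ltr_pdivrMr// mulrC (le_lt_trans _ npi)// -normrN ler_norm.
(* On the values -1, 0, 1 of [s], the polynomial [(s * s + s) / 2] is the indicator of [s = 1],
   which excludes the boundary [T f = b]. *)
apply: (@N2_ext (fun f => 2^-1 * (Num.sg (b - T f) * Num.sg (b - T f) + Num.sg (b - T f)))).
  by apply: N2M; [exact: N2_cst|apply: N2D => //; exact: N2M].
move=> f; rewrite indicE; have [d0|d0|d0] := ltrgt0P (b - T f).
- rewrite gtr0_sg// mem_set/=; last by rewrite -subr_gt0.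
  by field.
- rewrite ltr0_sg// memNset/=; last by apply/negP; rewrite -leNgt -subr_le0 ltW.
  by rewrite mulr0n; ring.
- rewrite d0 sgr0 memNset/=; last by apply/negP; rewrite -leNgt -subr_le0 d0.
  by rewrite mulr0n; ring.
Qed.

Let N2_sigma_algebra : sigma_algebra setT [set B : set V | N2 (\1_B)].
Proof.
have NC B : N2 (\1_B) -> N2 (\1_(~` B)).
  move=> NB; apply: (N2_ext (N2D (N2_cst 1) (N2M (N2_cst (-1)) NB))) => f /=.
  by rewrite !indicE in_setC; case: (f \in B); rewrite /=; ring.
split => /=.
- by apply: (N2_ext (N2_cst 0)) => f; rewrite indic0.
- by move=> A NA; rewrite setTD; exact: NC.
move=> A NA.
have NU B C : N2 (\1_B) -> N2 (\1_C) -> N2 (\1_(B `|` C)).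
  move=> NB NC'.
  apply: (N2_ext (N2D (N2D NB NC') (N2M (N2_cst (-1)) (N2M NB NC')))) => f /=.
  by rewrite !indicE in_setU; case: (f \in B); case: (f \in C); rewrite /=; ring.
have NI n : N2 (\1_(\big[setU/set0]_(k < n) A k)).
  elim: n => [|n ih]; last by rewrite big_ord_recr/=; exact: NU.
  by apply: (N2_ext (N2_cst 0)) => f; rewrite big_ord0 indic0.
apply: (@N2_cvg (fun n => \1_(\big[setU/set0]_(k < n) A k)) _ 1) => //.
  by move=> n x; rewrite indicE; case: (_ \in _); rewrite ?normr1 ?normr0.
move=> x; apply: cvg_near_cst.
have [[k _ Akx]|nA] := pselect ((\bigcup_n A n) x).
  exists k.+1 => // n /= kn; rewrite !indicE mem_set ?mem_set//; first by exists k.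
  by rewrite -bigcup_mkord; exists k.
apply: nearW => n; rewrite !indicE !memNset//.
by rewrite -bigcup_mkord => -[k _ Akx]; apply: nA; exists k.
Qed.

Lemma eq_mgf_measure : separable V ->
  forall B, measurable B -> mu B = nu B.
Proof.
move=> sepV B mB.
(* The cosine of the zero functional with phase 0 is 1, so membership in [N1] specializes to
   equality of the measures of [B]. *)
have /N2_N1[_ /(_ (inner_dual 0) 0)] : N2 (\1_B).
  exact: (borel_half_spaces sepV N2_sigma_algebra N2_half_space).
have E (m : {measure set (borel V) -> \bar R}) :
  (forall T : dual V, m.-integrable setT (EFin \o (fun f : borel V => expR (T f)))) ->
  m B = (\int[m]_f (\1_B f * cos (inner_dual 0 f + 0)))%:E.
  move=> im; under eq_Rintegral do
    rewrite /= /inner_dual_fun innerC linear0l add0r cos0 mulr1.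
  have i1 : m.-integrable setT (EFin \o (\1_B : borel V -> R)).
    apply: int_bdd => //; split; first exact: measurable_indic.
    by exists 1 => x; rewrite indicE; case: (_ \in _); rewrite ?normr1 ?normr0.
  by rewrite /Rintegral fineK ?integrable_fin_num// integral_indic// setIT.
by rewrite !E// => ->.
Qed.

End eq_mgf_measure.

(** * Gaussian measures and the Cameron-Martin formula *)

Lemma cvg_expRB1_quot (R : realType) (u : R^nat) (a : R) :
  (forall n, 0 < u n) -> u n @[n --> \oo] --> 0 ->
  (expR (a * u n) - 1) / u n @[n --> \oo] --> a.
Proof.
move=> u0 cu.
have lim1 : a * expR (a * u n) @[n --> \oo] --> a.
  rewrite -[X in _ --> X]mulr1; apply: cvgMr.
  suff : expR (a * u n) @[n --> \oo] --> expR (a * 0) by rewrite mulr0 expR0.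
  by apply: continuous_cvg; [exact: continuous_expR|exact: cvgMr].
apply: squeeze_cvgr lim1; last exact: cvg_cst.
apply: nearW => n; rewrite ler_pdivlMr// ler_pdivrMr// mulrAC.
by rewrite lerBrDl expR_ge1Dx expRB1_le_mul.
Qed.

Section gaussian_law.
Context d (T : measurableType d) (R : realType) (mu : probability T R).
Variable X : T -> R.
Hypothesis mX : measurable_fun setT X.

Hypothesis lawX : has_centred_normal_law mu X.

Let law_mgf : exists s, forall t,
  (\int[mu]_x (expR (t * X x))%:E = (expR (t ^+ 2 / 2 * s ^+ 2))%:E)%E.
Proof.
have [s Hs] := lawX; exists s => t.
have mexp : measurable_fun setT (fun x : R => (expR (t * x))%:E).
  by apply/measurable_EFinP; apply: measurableT_comp => //; exact: measurable_funM.
rewrite -(@ge0_integral_pushforward _ _ _ _ _ _ mX mu setT (fun x : R => (expR (t * x))%:E))//.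
rewrite (@eq_measure_integral _ _ _ _ (centred_normal s)); last first.
  by move=> A mA _; exact: Hs.
have [->|s0] := eqVneq s 0.
  rewrite /centred_normal eqxx integral_dirac// diracT mul1e.
  by rewrite mulr0 expR0 expr0n/= mulr0 expR0.
rewrite ge0_integral_centred_normal//.
under eq_integral do rewrite -EFinM.
by rewrite integral_expR_normal_pdf// mulr0 add0r.
Qed.

Let integrable_mgf s : (forall t,
  (\int[mu]_x (expR (t * X x))%:E = (expR (t ^+ 2 / 2 * s ^+ 2))%:E)%E) ->
  forall t, mu.-integrable setT (EFin \o (fun x => expR (t * X x))).
Proof.
move=> H t; apply/integrableP; split.
  by apply/measurable_EFinP; apply: measurableT_comp => //; exact: measurable_funM.
rewrite (eq_integral (fun x => (expR (t * X x))%:E)) ?H ?ltry// => x _.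
by rewrite /= ger0_norm ?expR_ge0.
Qed.

Let sq_bound (x : R) : x ^+ 2 * expR `|x| <= 2 * (expR (2 * x) + expR (- 2 * x)).
Proof.
rewrite -(real_normK (num_real x)).
apply: (@le_trans _ _ ((2 * expR `|x|) * expR `|x|)).
  by rewrite ler_wpM2r ?expR_ge0//; exact: (exprn_norm_le 2).
rewrite -mulrA ler_wpM2l// -expRD; case: (ger0P x) => _.
  by rewrite (_ : x + x = 2 * x) ?lerDl ?expR_ge0//; ring.
by rewrite (_ : - x + - x = - 2 * x) ?lerDr ?expR_ge0//; ring.
Qed.

(** The law gives [expR (t ^+ 2 / 2 * s ^+ 2)], and [s ^+ 2] has to be identified with the second
    moment. [X ^+ 2] is the limit of [((expR (u X / 2) - expR (- u X / 2)) / u) ^+ 2], whose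
    integral is [2 * (expR (s ^+ 2 / 2 * u ^+ 2) - 1) / u ^+ 2] and tends to [s ^+ 2]. *)
Lemma gaussian_mgf : exists v : R,
  [/\ (\int[mu]_x ((X x) ^+ 2)%:E)%E = v%:E &
  forall t, (\int[mu]_x (expR (t * X x))%:E = (expR (t ^+ 2 / 2 * v))%:E)%E].
Proof.
have [s Hs] := law_mgf; exists (s ^+ 2); split => //.
have im := integrable_mgf Hs.
pose u (n : nat) : R := n.+1%:R^-1.
have u0 n : 0 < u n by rewrite invr_gt0.
have cu : u n @[n --> \oo] --> 0 by exact: cvg_harmonic.
pose f n x := ((expR (2^-1 * u n * X x) - expR (- (2^-1 * u n * X x))) / u n) ^+ 2.
have mf n : measurable_fun setT (f n).
  apply: measurable_funX; apply: measurable_funM => //.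
  apply: measurable_funB; apply: measurableT_comp => //.
    exact: measurable_funM.
  by apply: measurableT_comp => //; exact: measurable_funM.
have cf x : f n x @[n --> \oo] --> X x ^+ 2.
  rewrite (_ : (fun n => f n x) = (fun n => ((expR ((X x / 2) * u n) - 1) / u n -
      (expR ((- (X x / 2)) * u n) - 1) / u n) ^+ 2)).
    have -> : X x ^+ 2 = (X x / 2 - - (X x / 2)) ^+ 2 by field.
    apply: (@continuous_cvg _ _ _ _ _ _ (fun y : R => y ^+ 2)).
      exact: exprn_continuous.
    by apply: cvgB; exact: cvg_expRB1_quot.
  apply/funext => n; rewrite /f; congr (_ ^+ 2).
  rewrite (_ : 2^-1 * u n * X x = X x / 2 * u n); last by ring.
  by rewrite mulNr; ring.
pose g x := 2 * (expR (2 * X x) + expR (- 2 * X x)).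
have ig : mu.-integrable setT (EFin \o g).
  by have := integrableZl measurableT 2 (integrableD measurableT (im 2) (im (- 2))).
have fg n x : `|f n x| <= g x.
  apply: le_trans (sq_bound (X x)); rewrite /f normrX.
  set z := 2^-1 * u n * X x.
  have hz : `|expR z - expR (- z)| <= 2 * (`|z| * expR `|z|).
    rewrite (_ : expR z - expR (- z) = (expR z - 1) - (expR (- z) - 1)); last by ring.
    rewrite (le_trans (ler_normB _ _))// mulr2n mulrDl mul1r lerD ?normr_expRB1//.
    by have := normr_expRB1 (- z); rewrite normrN.
  have un1 : u n <= 1 by rewrite invf_le1 ?ler1n.
  have zE : `|z| = 2^-1 * u n * `|X x|.
    by rewrite /z normrM ger0_norm// mulr_ge0// ltW.
  rewrite normrM normfV (gtr0_norm (u0 n)).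
  apply: (@le_trans _ _ ((`|X x| * expR `|z|) ^+ 2)).
    rewrite lerXn2r// ?nnegrE ?mulr_ge0 ?expR_ge0 ?invr_ge0 ?(ltW (u0 n))//.
    by rewrite ler_pdivrMr// (le_trans hz)// zE; lra.
  rewrite exprMn (real_normK (num_real _)) ler_wpM2l ?sqr_ge0//.
  rewrite -expRM_natl ler_expR zE !mulrA mulfV// mul1r ler_piMl//.
have iX2 : mu.-integrable setT (EFin \o (fun x => X x ^+ 2)).
  apply: (integrable_le _ ig) => [|x]; first exact: measurable_funX.
  apply: le_trans (sq_bound (X x)); rewrite normrX (real_normK (num_real _)).
  by rewrite ler_peMr ?sqr_ge0// -expR0 ler_expR.
have H1 := Rintegral_dominated_cvg mf cf ig fg.
have H2 : \int[mu]_x f n x @[n --> \oo] --> s ^+ 2.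
  rewrite (_ : (fun n => _) = (fun n => 2 * ((expR ((s ^+ 2 / 2) * u n ^+ 2) - 1) / u n ^+ 2))).
    rewrite [X in _ --> X](_ : s ^+ 2 = 2 * (s ^+ 2 / 2)); last by field.
    apply: cvgMr.
    apply: (@cvg_expRB1_quot _ (fun n => u n ^+ 2)) => [n|]; first by rewrite exprn_gt0.
    rewrite -[X in _ --> X](expr0n R 2).
    by apply: (@continuous_cvg _ _ _ _ _ _ (fun y : R => y ^+ 2)) => //; exact: exprn_continuous.
  apply/funext => n.
  have RH t : \int[mu]_x expR (t * X x) = expR (t ^+ 2 / 2 * s ^+ 2).
    by rewrite /Rintegral Hs.
  have i1 : mu.-integrable setT (EFin \o (fun x => expR (u n * X x) + expR (- u n * X x))).
    by have := integrableD measurableT (im (u n)) (im (- u n)).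
  have i2 : mu.-integrable setT (EFin \o (fun=> - 2 : R)).
    exact: finite_measure_integrable_cst.
  transitivity (\int[mu]_x ((u n ^+ 2)^-1 * (expR (u n * X x) + expR (- u n * X x) + - 2))).
    apply: eq_Rintegral => x _; rewrite /f exprMn exprVn mulrC; congr (_ * _).
    rewrite (_ : u n * X x = 2 * (2^-1 * u n * X x)); last by field.
    rewrite (_ : - u n * X x = 2 * - (2^-1 * u n * X x)); last by field.
    rewrite !expRM_natl; set z := 2^-1 * _ * _.
    have := expRxMexpNx_1 z; set a := expR z; set b := expR (- z) => ab.
    rewrite [X in _ = _ + X](_ : - 2 = - 2 * (a * b)); last by rewrite ab mulr1.
    by ring.
  rewrite RintegralZl//; last by have := integrableD measurableT i1 i2.
  rewrite RintegralD// RintegralD//; [|exact: im..].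
  rewrite !RH Rintegral_cst//.
  rewrite [X in fine X](_ : _ = 1%E); last exact: probability_setT.
  rewrite mulr1 sqrrN.
  rewrite (_ : u n ^+ 2 / 2 * s ^+ 2 = s ^+ 2 / 2 * u n ^+ 2); last by ring.
  by ring.
have := cvg_unique (@Rhausdorff R) H1 H2 => <-.
by rewrite /Rintegral fineK// integrable_fin_num.
Qed.

End gaussian_law.

Section square_integrable.
Context d (T : measurableType d) (R : realType) (mu : {measure set T -> \bar R}).
Implicit Types f g : T -> R.

Definition sq_integrable f := measurable_fun setT f /\
  mu.-integrable setT (EFin \o (fun x => f x ^+ 2)).

Let mul_le (x y e : R) : 0 < e ->
  `|x * y| <= 2^-1 * (e^-1 * x ^+ 2 + e * y ^+ 2).
Proof.
move=> e0; rewrite normrM -(real_normK (num_real x)) -(real_normK (num_real y)).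
rewrite -(ler_pM2l (_ : 0 < 2 * e)) ?mulr_gt0//.
have -> : 2 * e * (2^-1 * (e^-1 * `|x| ^+ 2 + e * `|y| ^+ 2)) =
  `|x| ^+ 2 + (e * `|y|) ^+ 2 by field; rewrite gt_eqF.
have := sqr_ge0 (`|x| - e * `|y|); lra.
Qed.

Lemma sq_integrableM f g : sq_integrable f -> sq_integrable g ->
  mu.-integrable setT (EFin \o (fun x => f x * g x)).
Proof.
move=> [mf f2] [mg g2].
have i2 : mu.-integrable setT (EFin \o (fun x => 2^-1 * (f x ^+ 2 + g x ^+ 2))).
  by have := integrableZl measurableT 2^-1 (integrableD measurableT f2 g2).
apply: (integrable_le _ i2) => [|x]; first exact: measurable_funM.
by have := @mul_le (f x) (g x) 1 ltr01; rewrite invr1 !mul1r.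
Qed.

Lemma sq_integrableD f g : sq_integrable f -> sq_integrable g ->
  sq_integrable (fun x => f x + g x).
Proof.
move=> [mf f2] [mg g2].
have i2 : mu.-integrable setT (EFin \o (fun x => 2 * (f x ^+ 2 + g x ^+ 2))).
  by have := integrableZl measurableT 2 (integrableD measurableT f2 g2).
split; first exact: measurable_funD.
apply: (integrable_le _ i2) => [|x].
  by apply: measurable_funX; exact: measurable_funD.
rewrite normrX (real_normK (num_real _)); have := sqr_ge0 (f x - g x); lra.
Qed.

Lemma sq_integrableZ (a : R) f : sq_integrable f -> sq_integrable (fun x => a * f x).
Proof.
move=> [mf f2]; split; first exact: measurable_funM.
have := integrableZl measurableT (a ^+ 2) f2.
by apply: eq_integrable => // x _ /=; rewrite exprMn.
Qed.

(* Cauchy-Schwarz in the linearized form given by the AM-GM inequality. *)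
Lemma Rintegral_mul_le f g e : 0 < e -> sq_integrable f -> sq_integrable g ->
  \int[mu]_x `|f x * g x| <=
  2^-1 * (e^-1 * \int[mu]_x (f x ^+ 2) + e * \int[mu]_x (g x ^+ 2)).
Proof.
move=> e0 sf sg; have [mf f2] := sf; have [mg g2] := sg.
have i1 := integrableZl measurableT e^-1 f2.
have i2 := integrableZl measurableT e g2.
have i3 : mu.-integrable setT
    (EFin \o (fun x => e^-1 * f x ^+ 2 + e * g x ^+ 2)).
  by have := integrableD measurableT i1 i2.
rewrite -!RintegralZl// -RintegralD// -RintegralZl//.
apply: le_Rintegral => //.
- exact/integrable_norm/sq_integrableM.
- by have := integrableZl measurableT 2^-1 i3.
- by move=> x _; exact: mul_le.
Qed.

Lemma Rintegral_sqD f g (a : R) : sq_integrable f -> sq_integrable g ->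
  \int[mu]_x ((f x + a * g x) ^+ 2) = \int[mu]_x (f x ^+ 2) +
    2 * a * (\int[mu]_x (g x * f x)) + a ^+ 2 * \int[mu]_x (g x ^+ 2).
Proof.
move=> sf sg; have [mf f2] := sf; have [mg g2] := sg.
have i1 := integrableZl measurableT (2 * a) (sq_integrableM sg sf).
have i2 := integrableZl measurableT (a ^+ 2) g2.
have i3 := integrableD measurableT f2 i1.
rewrite -!RintegralZl//; last exact: sq_integrableM.
rewrite -RintegralD// -RintegralD//.
by apply: eq_Rintegral => x _; ring.
Qed.

End square_integrable.

(** * The L2-closure of the dual *)

Section gaussian_closure.
Context (R : realType) (V : normedModType R) (Pi : probability (borel V) R).
Hypothesis gaussPi : centred_gaussian_measure Pi.
Implicit Types (T S : dual V) (xi : borel V -> R).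

Lemma dual_sq_integrable T : sq_integrable Pi (T : borel V -> R).
Proof.
split; first exact: measurable_dual.
have [v [Hv _]] := gaussian_mgf (measurable_dual T) (gaussPi T).
apply/integrableP; split.
  by apply/measurable_EFinP/measurable_funX; exact: measurable_dual.
rewrite (eq_integral (fun f : borel V => (T f ^+ 2)%:E)) ?Hv ?ltry// => f _ /=.
by rewrite ger0_norm ?sqr_ge0.
Qed.

Lemma dual_mgf T (t : R) : (\int[Pi]_f (expR (t * T f))%:E)%E =
  (expR (t ^+ 2 / 2 * \int[Pi]_f (T f ^+ 2)))%:E.
Proof.
have [v [Hv ->]] := gaussian_mgf (measurable_dual T) (gaussPi T).
by rewrite /Rintegral Hv.
Qed.

(** The approximation clause of [rkhs_repr], with the L2 norm unfolded into an integral of squares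
    and without the representation clause. In this form it is stable under scaling and under adding
    a functional. *)
Definition gaussian_closure xi := measurable_fun setT xi /\
  forall eta, 0 < eta -> exists T : dual V,
    (\int[Pi]_f ((xi f - T f) ^+ 2)%:E <= eta%:E)%E.

Lemma gaussian_closureDZ S (a : R) xi : gaussian_closure xi ->
  gaussian_closure (fun f => S f + a * xi f).
Proof.
move=> [mxi cxi]; split.
  by apply: measurable_funD; [exact: measurable_dual|exact: measurable_funM].
move=> eta eta0; have [|T HT] := cxi (eta / (a ^+ 2 + 1)).
  by rewrite divr_gt0// ltr_wpDl ?sqr_ge0.
exists (dualD S (dualZ a T)).
rewrite (eq_integral (fun f : borel V => (a ^+ 2)%:E * ((xi f - T f) ^+ 2)%:E)%E); last first.
  move=> f _; rewrite -EFinM /=; congr EFin.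
  by rewrite /GRing.scale/=; ring.
rewrite ge0_integralZl//; last 3 first.
- apply/measurable_EFinP/measurable_funX; apply: measurable_funB => //.
  exact: measurable_dual.
- by move=> f _; rewrite lee_fin sqr_ge0.
- by rewrite lee_fin sqr_ge0.
apply: le_trans (lee_wpmul2l _ HT) _; first by rewrite lee_fin sqr_ge0.
rewrite -EFinM lee_fin mulrCA ler_piMr ?(ltW eta0)//.
by rewrite ler_pdivrMr ?mul1r ?lerDl// ltr_wpDl ?sqr_ge0.
Qed.

Section closure_mgf.
Variables (xi : borel V -> R) (cxi : gaussian_closure xi).

Let sqB T eta : (\int[Pi]_f ((xi f - T f) ^+ 2)%:E <= eta%:E)%E ->
  sq_integrable Pi (fun f => xi f - T f) /\
  \int[Pi]_f ((xi f - T f) ^+ 2) <= eta.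
Proof.
have mB : measurable_fun setT (fun f : borel V => xi f - T f).
  by apply: measurable_funB; [exact: cxi.1|exact: measurable_dual].
move=> H.
have i2 : Pi.-integrable setT (EFin \o (fun f => (xi f - T f) ^+ 2)).
  apply/integrableP; split; first exact/measurable_EFinP/measurable_funX.
  rewrite (eq_integral (fun f : borel V => ((xi f - T f) ^+ 2)%:E)).
    by rewrite (le_lt_trans H)// ltry.
  by move=> f _ /=; rewrite ger0_norm ?sqr_ge0.
split => //.
by rewrite -lee_fin /Rintegral fineK// integrable_fin_num.
Qed.

Lemma closure_sq_integrable : sq_integrable Pi xi.
Proof.
have [T /sqB[sB _]] := cxi.2 1 ltr01.
have := sq_integrableD sB (dual_sq_integrable T).
by rewrite (_ : (fun f => _) = xi)//; apply/funext => f; rewrite subrK.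
Qed.

Let approx : exists T_ : nat -> dual V, forall n,
  (\int[Pi]_f ((xi f - T_ n f) ^+ 2)%:E <= (n.+1%:R^-1 ^+ 2)%:E)%E.
Proof.
have /choice : forall n : nat, exists T : dual V,
  (\int[Pi]_f ((xi f - T f) ^+ 2)%:E <= (n.+1%:R^-1 ^+ 2)%:E)%E.
  by move=> n; apply: cxi.2; rewrite exprn_gt0// invr_gt0.
by move=> [T_ HT]; exists T_.
Qed.

Let v := \int[Pi]_f (xi f ^+ 2).

Let sum_bound (f g : borel V -> R) : sq_integrable Pi f -> sq_integrable Pi g ->
  \int[Pi]_x ((f x + g x) ^+ 2) <= 2 * (\int[Pi]_x (f x ^+ 2) + \int[Pi]_x (g x ^+ 2)).
Proof.
move=> sf sg; have [_ f2] := sf; have [_ g2] := sg.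
have i3 : Pi.-integrable setT (EFin \o (fun x => f x ^+ 2 + g x ^+ 2)).
  by have := integrableD measurableT f2 g2.
rewrite -RintegralD// -RintegralZl//; apply: le_Rintegral => //.
- exact: (sq_integrableD sf sg).2.
- by have := integrableZl measurableT 2 i3.
- move=> x _; have := sqr_ge0 (f x - g x); lra.
Qed.

(** The map [u |-> expR (min u k)] is Lipschitz with constant [expR k]. The truncation is there
    because the integrability of [expR (2 * xi)] is what is being proved. *)
Let exp_min_le (x y : R) (k : R) :
  expR (Num.min (2 * x) k) <= expR (2 * y) + 2 * expR k * `|x - y|.
Proof.
set m := Num.min _ _; have [mx mk] : m <= 2 * x /\ m <= k.
  by rewrite /m ge_min lexx/= ge_min lexx orbT.
have := expR_ge0 (2 * y); have [my|my] := leP m (2 * y).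
  move=> _; rewrite (@le_trans _ _ (expR (2 * y))) ?ler_expR//.
  by rewrite lerDl !mulr_ge0// expR_ge0.
move=> _; rewrite -lerBlDl.
have -> : expR m - expR (2 * y) = expR m * (1 - expR (2 * y - m)).
  by rewrite mulrBr mulr1 -expRD; congr (_ - expR _); ring.
apply: (@le_trans _ _ (expR k * (m - 2 * y))).
  rewrite ler_pM ?expR_ge0 ?ler_expR//.
    by rewrite subr_ge0 -[leRHS]expR0 ler_expR subr_le0 ltW.
  by have := expR_ge1Dx (2 * y - m); lra.
rewrite [leRHS](_ : _ = expR k * (2 * `|x - y|)); last by ring.
rewrite ler_wpM2l ?expR_ge0//.
by have := ler_norm (x - y); lra.
Qed.

Let mexp (a : R) : measurable_fun setT (fun f : borel V => expR (a * xi f)).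
Proof. by apply: measurableT_comp => //; apply: measurable_funM => //; exact: cxi.1. Qed.

Let dual_exp_integrable T (t : R) :
  Pi.-integrable setT (EFin \o (fun f : borel V => expR (t * T f))) /\
  \int[Pi]_f expR (t * T f) = expR (t ^+ 2 / 2 * \int[Pi]_f (T f ^+ 2)).
Proof.
split; last by rewrite /Rintegral dual_mgf.
apply/integrableP; split.
  apply/measurable_EFinP; apply: measurableT_comp => //.
  by apply: measurable_funM => //; exact: measurable_dual.
rewrite (eq_integral (fun f : borel V => (expR (t * T f))%:E)) ?dual_mgf ?ltry//.
by move=> f _ /=; rewrite ger0_norm ?expR_ge0.
Qed.

(** At a fixed truncation level, functionals [T_ n] converge to [xi] in L2 and have explicit
    exponential moments, with second moment at most [2 * (v + 1)]. The bound does not depend on the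
    level, and monotone convergence removes it. *)
Let exp2_bound : (\int[Pi]_f (expR (2 * xi f))%:E <= (expR (2 * (2 * (v + 1))))%:E)%E.
Proof.
have [T_ HT] := approx.
pose e n : R := n.+1%:R^-1.
have e0 n : 0 < e n by rewrite invr_gt0.
have sxi := closure_sq_integrable.
have i1 : Pi.-integrable setT (EFin \o (cst 1 : borel V -> R)).
  exact: finite_measure_integrable_cst.
have s1 : sq_integrable Pi (cst 1 : borel V -> R).
  by split => //; apply: eq_integrable i1 => // x _ /=; rewrite expr1n.
set B := expR (2 * (2 * (v + 1))).
have trunc (k : nat) : (\int[Pi]_f (expR (Num.min (2 * xi f) k%:R))%:E <= B%:E)%E.
  have mmin : measurable_fun setT (fun f : borel V => expR (Num.min (2 * xi f) k%:R)).
    apply: measurableT_comp => //; apply: measurable_minr => //.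
    by apply: measurable_funM => //; exact: cxi.1.
  have imin : Pi.-integrable setT
      (EFin \o (fun f : borel V => expR (Num.min (2 * xi f) k%:R))).
    have ik : Pi.-integrable setT (EFin \o (cst (expR k%:R) : borel V -> R)).
      exact: finite_measure_integrable_cst.
    apply: (integrable_le mmin ik) => x.
    by rewrite ger0_norm ?expR_ge0// ler_expR ge_min lexx orbT.
  suff : \int[Pi]_f expR (Num.min (2 * xi f) k%:R) <= B.
    by rewrite -lee_fin /Rintegral fineK// integrable_fin_num.
  have cB : B + 2 * expR k%:R * e n @[n --> \oo] --> B.
    rewrite -[X in _ --> X]addr0; apply: cvgD; first exact: cvg_cst.
    by rewrite -[X in _ --> X](mulr0 (2 * expR k%:R)); apply: cvgMr; exact: cvg_harmonic.
  apply: (cvgr_to_ge cB); apply: nearW => n.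
  have [sd dn] := sqB (HT n).
  have sd1 : sq_integrable Pi (fun f => T_ n f - xi f).
    have := sq_integrableZ (-1) sd; rewrite (_ : (fun _ => _) = (fun f => T_ n f - xi f))//.
    by apply/funext => f; rewrite mulN1r opprB.
  have un : \int[Pi]_f (T_ n f ^+ 2) <= 2 * (v + 1).
    have := sum_bound sxi sd1; under eq_Rintegral do rewrite addrC subrK.
    move/le_trans; apply; rewrite ler_wpM2l// lerD2l.
    rewrite (_ : Rintegral _ _ _ = \int[Pi]_f ((xi f - T_ n f) ^+ 2)); last first.
      by apply: eq_Rintegral => f _; rewrite -sqrrN opprB.
    by rewrite (le_trans dn)// expr_le1 ?invf_le1 ?ler1n// ltW.
  have [iT ET] := dual_exp_integrable (T_ n) 2.
  have iabs : Pi.-integrable setT (EFin \o (fun f => `|(xi f - T_ n f) * cst 1 f|)).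
    exact/integrable_norm/sq_integrableM.
  have iabs2 := integrableZl measurableT (2 * expR k%:R) iabs.
  apply: (@le_trans _ _ (\int[Pi]_f (expR (2 * T_ n f) + 2 * expR k%:R * `|(xi f - T_ n f) * cst 1 f|))).
    apply: le_Rintegral => //.
    - by have := integrableD measurableT iT iabs2.
    - by move=> f _; rewrite mulr1; exact: exp_min_le.
  rewrite RintegralD// RintegralZl// ET lerD//.
    by rewrite ler_expR (_ : 2 ^+ 2 / 2 = 2 :> R) ?ler_wpM2l//; field.
  rewrite ler_wpM2l ?mulr_ge0 ?expR_ge0//.
  (* With weight [e n] and squared L2 error at most [e n ^+ 2], both terms are at most [e n], which
     bounds the L1 distance. *)
  apply: le_trans (Rintegral_mul_le (e0 n) sd s1) _.
  under [X in _ + _ * X]eq_Rintegral do rewrite expr1n.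
  rewrite Rintegral_cst// mul1r.
  rewrite [X in fine X](_ : _ = 1%E); last exact: probability_setT.
  have : (e n)^-1 * \int[Pi]_f ((xi f - T_ n f) ^+ 2) <= e n.
    by rewrite -ler_pdivlMl ?invr_gt0// invrK -expr2.
  rewrite /=; lra.
have mc := @cvg_monotone_convergence _ _ _ Pi setT measurableT
  (fun (k : nat) (f : borel V) => (expR (Num.min (2 * xi f) k%:R))%:E).
rewrite (eq_integral (fun f : borel V =>
    limn (fun k : nat => (expR (Num.min (2 * xi f) k%:R))%:E))); last first.
  move=> f _; apply/esym/cvg_lim => //; apply: cvg_near_cst.
  exists (Num.bound (2 * xi f)) => // k /= fk; rewrite min_l//.
  have [f0|f0] := leP (2 * xi f) 0; first by rewrite (le_trans f0).
  by rewrite ltW// (lt_le_trans (archi_boundP (ltW f0)))// ler_nat.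
apply: (cvge_to_le (mc _ _ _)).
- move=> k; apply/measurable_EFinP; apply: measurableT_comp => //.
  apply: measurable_minr => //.
  by apply: measurable_funM => //; exact: cxi.1.
- by move=> k f _; rewrite lee_fin expR_ge0.
- move=> f _ a b ab; rewrite lee_fin ler_expR.
  by rewrite le_min ge_min lexx/= ge_min ler_nat ab orbT.
- by apply: nearW => k; exact: trunc.
Qed.

Let exp_sq_integrable : sq_integrable Pi (fun f => expR (xi f)).
Proof.
split; first by apply: measurableT_comp => //; exact: cxi.1.
apply/integrableP; split.
  apply/measurable_EFinP/measurable_funX; apply: measurableT_comp => //.
  exact: cxi.1.
rewrite (eq_integral (fun f : borel V => (expR (2 * xi f))%:E)).
  by rewrite (le_lt_trans exp2_bound)// ltry.
by move=> f _ /=; rewrite ger0_norm ?sqr_ge0// expRM_natl.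
Qed.

Let exp_dist_le (x y : R) :
  `|expR x - expR y| <= `|(x - y) * (expR x + expR y)|.
Proof.
wlog xy : x y / y <= x.
  move=> H; have [/H//|/ltW/H] := leP y x.
  by rewrite distrC => /le_trans; apply; rewrite !normrM (distrC y) (addrC (expR y)).
have exy : expR y <= expR x by rewrite ler_expR.
rewrite normrM !ger0_norm ?subr_ge0 ?addr_ge0 ?expR_ge0//.
have -> : expR x - expR y = expR x * (1 - expR (y - x)).
  by rewrite mulrBr mulr1 -expRD; congr (_ - expR _); ring.
rewrite mulrC ler_pM ?expR_ge0//.
- by rewrite subr_ge0 -[leRHS]expR0 ler_expR subr_le0.
- by have := expR_ge1Dx (y - x); lra.
- by rewrite lerDl expR_ge0.
Qed.

(** By [exp_dist_le] and Cauchy-Schwarz, exponential moments pass to the L2 limit as long as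
    [expR (T_ n)] and [expR xi] are bounded in L2; for [xi] this is [exp2_bound]. *)
Lemma closure_mgf : (\int[Pi]_f (expR (xi f))%:E)%E = (expR (v / 2))%:E.
Proof.
have [T_ HT] := approx.
pose e n : R := n.+1%:R^-1.
have e0 n : 0 < e n by rewrite invr_gt0.
have e1 n : e n <= 1 by rewrite invf_le1 ?ler1n.
have ce : e n @[n --> \oo] --> 0 by exact: cvg_harmonic.
have sxi := closure_sq_integrable.
have i1 : Pi.-integrable setT (EFin \o (cst 1 : borel V -> R)).
  exact: finite_measure_integrable_cst.
have s1 : sq_integrable Pi (cst 1 : borel V -> R).
  by split => //; apply: eq_integrable i1 => // x _ /=; rewrite expr1n.
have v0 : 0 <= v by apply: Rintegral_ge0 => x _; exact: sqr_ge0.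
have cu : \int[Pi]_f (T_ n f ^+ 2) @[n --> \oo] --> v.
  apply: (@squeeze_cvgr _ _ _ _ (fun n => v - (v + 1) * e n) (fun n => v + (v + 2) * e n)).
  - apply: nearW => n; have [sd dn] := sqB (HT n).
    have := Rintegral_sqD (-1) sxi sd.
    under [X in X = _ -> _]eq_Rintegral do rewrite mulN1r opprB addrC subrK.
    rewrite sqrrN expr1n mul1r -/v mulrN1 => ->.
    have i2 := sq_integrableM sd sxi.
    have h0 := le_normr_Rintegral measurableT i2.
    have h1 := le_trans h0 (Rintegral_mul_le (e0 n) sd sxi).
    have h2 : (e n)^-1 * \int[Pi]_f ((xi f - T_ n f) ^+ 2) <= e n.
      by rewrite -ler_pdivlMl ?invr_gt0// invrK -expr2.
    have h3 : 0 <= \int[Pi]_f ((xi f - T_ n f) ^+ 2).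
      by apply: Rintegral_ge0 => x _; exact: sqr_ge0.
    have h4 : e n ^+ 2 <= e n by rewrite expr2 ler_piMl// ltW.
    move: h1; rewrite -/v ler_norml => /andP[h5 h6].
    by apply/andP; split; rewrite -/(e n) in dn; lra.
  - rewrite -[X in _ --> X]subr0; apply: cvgB; first exact: cvg_cst.
    by rewrite -[X in _ --> X](mulr0 (v + 1)); apply: cvgMr.
  - rewrite -[X in _ --> X]addr0; apply: cvgD; first exact: cvg_cst.
    by rewrite -[X in _ --> X](mulr0 (v + 2)); apply: cvgMr.
pose K := 2 * (\int[Pi]_f (expR (xi f) ^+ 2) + expR (2 * (v + (v + 2)))).
have ei : Pi.-integrable setT (EFin \o (fun f => expR (xi f))).
  have := sq_integrableM exp_sq_integrable s1.
  by apply: eq_integrable => // f _ /=; rewrite mulr1.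
have cT : \int[Pi]_f expR (T_ n f) @[n --> \oo] --> \int[Pi]_f expR (xi f).
  have bnd : \forall n \near \oo, \int[Pi]_f (T_ n f ^+ 2) <= v + (v + 2).
    have : v < v + (v + 2) by rewrite ltrDl ltr_wpDl.
    by move=> /(cvgr_lt _ cu); apply: filterS => n /ltW.
  apply: (@squeeze_cvgr _ _ _ _ (fun n => \int[Pi]_f expR (xi f) - (2^-1 * (1 + K)) * e n)
    (fun n => \int[Pi]_f expR (xi f) + (2^-1 * (1 + K)) * e n)).
  - move: bnd; apply: filterS => n un; have [sd dn] := sqB (HT n).
    have [i2T E2T] := dual_exp_integrable (T_ n) 2.
    have [i1T _] := dual_exp_integrable (T_ n) 1.
    have i1T' : Pi.-integrable setT (EFin \o (fun f : borel V => expR (T_ n f))).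
      by apply: eq_integrable i1T => // f _ /=; rewrite mul1r.
    have sT : sq_integrable Pi (fun f => expR (T_ n f)).
      split; first by apply: measurableT_comp => //; exact: measurable_dual.
      by apply: eq_integrable i2T => // f _ /=; rewrite expRM_natl.
    have E2T' : \int[Pi]_f (expR (T_ n f) ^+ 2) <= expR (2 * (v + (v + 2))).
      under eq_Rintegral do rewrite -expRM_natl.
      by rewrite E2T ler_expR (_ : 2 ^+ 2 / 2 = 2 :> R) ?ler_wpM2l//; field.
    have sS := sq_integrableD exp_sq_integrable sT.
    have h1 := Rintegral_mul_le (e0 n) sd sS.
    have h2 : (e n)^-1 * \int[Pi]_f ((xi f - T_ n f) ^+ 2) <= e n.
      by rewrite -ler_pdivlMl ?invr_gt0// invrK -expr2.
    have h3 := sum_bound exp_sq_integrable sT.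
    have h3' : \int[Pi]_f ((expR (xi f) + expR (T_ n f)) ^+ 2) <= K.
      by rewrite (le_trans h3)// /K ler_wpM2l// lerD2l.
    have iB : Pi.-integrable setT (EFin \o (fun f => expR (xi f) - expR (T_ n f))).
      by have := integrableB measurableT ei i1T'.
    have h4 : `|\int[Pi]_f (expR (xi f) - expR (T_ n f))| <=
        \int[Pi]_f `|(xi f - T_ n f) * (expR (xi f) + expR (T_ n f))|.
      apply: (le_trans (le_normr_Rintegral measurableT iB)).
      apply: le_Rintegral => //; first exact: integrable_norm.
      - exact/integrable_norm/sq_integrableM.
    have h5 : e n * \int[Pi]_f ((expR (xi f) + expR (T_ n f)) ^+ 2) <= e n * K.
      by rewrite ler_wpM2l// ltW.
    move: h4; rewrite RintegralB// => /le_trans/(_ h1).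
    rewrite ler_norml => /andP[h6 h7].
    by apply/andP; split; lra.
  - rewrite -[X in _ --> X]subr0; apply: cvgB; first exact: cvg_cst.
    by rewrite -[X in _ --> X](mulr0 (2^-1 * (1 + K))); apply: cvgMr.
  - rewrite -[X in _ --> X]addr0; apply: cvgD; first exact: cvg_cst.
    by rewrite -[X in _ --> X](mulr0 (2^-1 * (1 + K))); apply: cvgMr.
rewrite -[LHS]fineK ?integrable_fin_num//; congr EFin.
apply: (cvg_unique (@Rhausdorff R) cT).
rewrite (_ : (fun n => _) = (fun n => expR (\int[Pi]_f (T_ n f ^+ 2) / 2))).
  apply: continuous_cvg; first exact: continuous_expR.
  by apply: cvgMl.
apply/funext => n; have [_] := dual_exp_integrable (T_ n) 1.
under eq_Rintegral do rewrite mul1r; move=> ->; congr expR; ring.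
Qed.

End closure_mgf.
End gaussian_closure.

(** * Shifts and reflection of a Gaussian measure *)

Lemma continuous_measurable_borel (R : realType) (V : normedModType R)
    (g : V -> V) : continuous g ->
  measurable_fun [set: borel V] (g : borel V -> borel V).
Proof.
move=> /continuousP cg.
apply: (@measurability _ _ (borel V) (borel V) setT g (@open V) (erefl _)).
move=> _ [A oA <-]; rewrite setTI.
by apply: sub_sigma_algebra; exact: cg.
Qed.

Lemma ge0_Rintegrable d (T : measurableType d) (R : realType)
    (mu : {measure set T -> \bar R}) (f : T -> R) (r : R) :
  measurable_fun setT f -> (forall x, 0 <= f x) ->
  (\int[mu]_x (f x)%:E)%E = r%:E ->
  mu.-integrable setT (EFin \o f) /\ \int[mu]_x f x = r.
Proof.
move=> mf f0 fr; split; last by rewrite /Rintegral fr.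
apply/integrableP; split; first exact/measurable_EFinP.
rewrite (eq_integral (EFin \o f)) ?fr ?ltry// => x _ /=.
by rewrite ger0_norm.
Qed.

Lemma measurable_closed_norm_ball (R : realType) (V : normedModType R) (h : V) (r : R) :
  measurable ([set f : V | `|f - h| <= r] : set (borel V)).
Proof.
have mnorm : measurable_fun setT (fun f : borel V => `|(f : V) - h|).
  apply: (@continuous_borel_measurable _ V (fun f => `|f - h|)) => f.
  by apply: cvg_norm; apply: cvgB; [exact: cvg_id|exact: cvg_cst].
have := mnorm measurableT `]-oo, r]%classic (measurable_itv _).
rewrite setTI (_ : _ @^-1` _ = [set f : V | `|f - h| <= r])//.
Qed.

Section cameron_martin.
Context (R : realType) (V : hilbertType R) (Pi : probability (borel V) R).
Hypothesis sepV : separable V.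
Hypothesis gaussPi : centred_gaussian_measure Pi.

Lemma rkhs_repr_closure h xi : rkhs_repr Pi h xi -> gaussian_closure Pi xi.
Proof.
move=> [mxi axi _]; split => // eta eta0.
have [|T HT] := axi (Num.sqrt eta); first by rewrite sqrtr_gt0.
exists T; rewrite (eq_integral (fun f : borel V =>
  (`|(EFin \o (xi \- T)%R) f| `^ 2)%E)); last first.
  move=> f _ /=; rewrite ?poweR_EFin powR_mulrn// -normrX ger0_norm//.
  exact: sqr_ge0.
rewrite -powR_Lnorm//.
rewrite -(sqr_sqrtr (ltW eta0)) -powR_mulrn ?sqrtr_ge0// -poweR_EFin.
apply: gt0_ler_poweR => //.
- by rewrite in_itv/= leey Lnorm_ge0.
- by rewrite in_itv/= leey lee_fin sqrtr_ge0.
Qed.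

Section shift.
Variables (h : V) (xi : borel V -> R).
Hypothesis hxi : rkhs_repr Pi h xi.
Let v := \int[Pi]_f (xi f ^+ 2).

Let cxi := rkhs_repr_closure hxi.

Let sxi := closure_sq_integrable gaussPi cxi.

Let mexp b : measurable_fun setT (fun f : borel V => (expR (b * xi f))%:E).
Proof.
apply/measurable_EFinP; apply: measurableT_comp => //.
by apply: measurable_funM => //; exact: cxi.1.
Qed.

Lemma rkhs_repr_mgf b :
  (\int[Pi]_f (expR (b * xi f))%:E)%E = (expR (b ^+ 2 / 2 * v))%:E.
Proof.
have := closure_mgf gaussPi (gaussian_closureDZ (dualZ 0 (inner_dual 0)) b cxi).
rewrite (_ : Rintegral _ _ _ = b ^+ 2 * v); last first.
  rewrite -RintegralZl//; last exact: sxi.2.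
  by apply: eq_Rintegral => f _ /=; rewrite /GRing.scale/= mul0r add0r exprMn.
rewrite (mulrAC _ v) => <-; apply: eq_integral => f _ /=.
by rewrite /GRing.scale/= mul0r add0r.
Qed.

Lemma rkhs_repr_exp_norm (a : R) :
  (\int[Pi]_f (expR (a * `|xi f|))%:E <= (2 * expR (a ^+ 2 / 2 * v))%:E)%E.
Proof.
apply: (@le_trans _ _ (\int[Pi]_f ((expR (a * xi f))%:E + (expR (- a * xi f))%:E))%E).
  apply: ge0_le_integral => //.
  - apply/measurable_EFinP; apply: measurableT_comp => //.
    apply: measurable_funM => //; apply: measurableT_comp => //; exact: cxi.1.
  - by apply: emeasurable_funD; exact: mexp.
  - move=> f _; rewrite -EFinD lee_fin.
    case: (ger0P (xi f)) => _; first by rewrite lerDl expR_ge0.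
    by rewrite mulrN -mulNr lerDr expR_ge0.
rewrite ge0_integralD//.
by rewrite !rkhs_repr_mgf -EFinD sqrrN lee_fin mulr2n mulrDl mul1r.
Qed.

(** In the exponential moments the shift contributes [tau * T h] and the tilt the cross term [tau]
    times the integral of [xi * T]; these agree by the representation clause of [rkhs_repr]. The
    square of [tau * xi] is cancelled by [tau ^+ 2 / 2 * v]. *)
Lemma cameron_martin (tau : R) (G : borel V -> \bar R) :
  measurable_fun setT G -> (forall f, 0 <= G f)%E ->
  (\int[Pi]_f G ((f : V) + tau *: h)%R =
   \int[Pi]_f (G f * (expR (tau * xi f - tau ^+ 2 / 2 * v))%:E))%E.
Proof.
move=> mG G0.
pose sh (f : borel V) : borel V := (f : V) + tau *: h.
have msh : measurable_fun setT sh.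
  apply: continuous_measurable_borel => f.
  by apply: cvgD; [exact: cvg_id|exact: cvg_cst].
pose Sh : {mfun borel V >-> borel V} := HB.pack sh (isMeasurableFun.Build _ _ _ _ _ msh).
pose l (f : borel V) := tau * xi f - tau ^+ 2 / 2 * v.
have ml : measurable_fun setT l.
  by apply: measurable_funB => //; apply: measurable_funM => //; exact: cxi.1.
pose L : {mfun borel V >-> R} := HB.pack l (isMeasurableFun.Build _ _ _ _ _ ml).
rewrite -[LHS](ge0_integral_distribution Sh)// -[RHS](ge0_integral_tilt Pi L)//.
have mexpT (T : dual V) : measurable_fun setT (fun f : borel V => (expR (T f))%:E).
  apply/measurable_EFinP; apply: measurableT_comp => //; exact: measurable_dual.
have E1 (T : dual V) : (\int[distribution Pi Sh]_f (expR (T f))%:E)%E =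
    (expR (2^-1 * (\int[Pi]_f (T f ^+ 2)) + tau * \int[Pi]_f (xi f * T f)))%:E.
  rewrite ge0_integral_distribution//.
  rewrite (eq_integral (fun f : borel V => ((expR (tau * T h))%:E * (expR (1 * T f))%:E)%E)); last first.
    move=> f _ /=; rewrite /sh linearD linearZ /= -EFinM -expRD.
    by rewrite mul1r addrC.
  rewrite ge0_integralZl//; last first.
    apply/measurable_EFinP; apply: measurableT_comp => //.
    by apply: measurable_funM => //; exact: measurable_dual.
  rewrite (dual_mgf gaussPi) -EFinM -expRD expr1n mul1r addrC.
  by have [_ _ ->] := hxi.
have E2 (T : dual V) : (\int[tilt Pi L]_f (expR (T f))%:E)%E =
    (expR (2^-1 * (\int[Pi]_f (T f ^+ 2)) + tau * \int[Pi]_f (xi f * T f)))%:E.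
  rewrite ge0_integral_tilt//.
  rewrite (eq_integral (fun f : borel V => ((expR (- (tau ^+ 2 / 2 * v)))%:E * (expR (T f + tau * xi f))%:E)%E)); last first.
    move=> f _ /=; rewrite -!EFinM -!expRD /l; congr (expR _)%:E; ring.
  rewrite ge0_integralZl//; last first.
    apply/measurable_EFinP; apply: measurableT_comp => //.
    apply: measurable_funD; first exact: measurable_dual.
    by apply: measurable_funM => //; exact: cxi.1.
  rewrite (closure_mgf gaussPi (gaussian_closureDZ T tau cxi)).
  rewrite Rintegral_sqD//; last exact: dual_sq_integrable.
  by rewrite -EFinM -expRD -/v; congr (expR _)%:E; field.
apply: eq_measure_integral => A mA _.
apply: eq_mgf_measure => // T.
- by have [] := ge0_Rintegrable (measurableT_comp (@measurable_expR R) (measurable_dual T)) (fun f => expR_ge0 _) (E1 T).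
- by have [] := ge0_Rintegrable (measurableT_comp (@measurable_expR R) (measurable_dual T)) (fun f => expR_ge0 _) (E2 T).
- by rewrite /Rintegral E1 E2.
Qed.

End shift.


(** The exponential moments in [dual_mgf] depend on [t] through [t ^+ 2] only. *)
Lemma gaussian_symmetric (G : borel V -> \bar R) :
  measurable_fun setT G -> (forall f, 0 <= G f)%E ->
  (\int[Pi]_f G (- (f : V))%R = \int[Pi]_f G f)%E.
Proof.
move=> mG G0.
have mop : measurable_fun setT (fun f : borel V => (- (f : V)) : borel V).
  by apply: continuous_measurable_borel => f; exact: opp_continuous.
pose Op : {mfun borel V >-> borel V} := HB.pack (fun f : borel V => (- (f : V)) : borel V)
  (isMeasurableFun.Build _ _ _ _ _ mop).
rewrite -[LHS](ge0_integral_distribution Op)//.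
have E1 (T : dual V) : (\int[distribution Pi Op]_f (expR (T f))%:E)%E =
    (\int[Pi]_f (expR (T f))%:E)%E.
  rewrite ge0_integral_distribution//; last first.
    apply/measurable_EFinP; apply: measurableT_comp => //; exact: measurable_dual.
  transitivity (\int[Pi]_f (expR (-1 * T f))%:E)%E.
    by apply: eq_integral => f _ /=; rewrite linearN mulN1r.
  rewrite (dual_mgf gaussPi) sqrrN -(dual_mgf gaussPi).
  by apply: eq_integral => f _; rewrite mul1r.
have E2 (T : dual V) : (\int[Pi]_f (expR (T f))%:E)%E =
    (expR (1 ^+ 2 / 2 * \int[Pi]_f (T f ^+ 2)))%:E.
  by rewrite -(dual_mgf gaussPi); apply: eq_integral => f _; rewrite mul1r.
apply: eq_measure_integral => A mA _.
apply: eq_mgf_measure => // T.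
- by have [] := ge0_Rintegrable (measurableT_comp (@measurable_expR R) (measurable_dual T)) (fun f => expR_ge0 _) (etrans (E1 T) (E2 T)).
- by have [] := ge0_Rintegrable (measurableT_comp (@measurable_expR R) (measurable_dual T)) (fun f => expR_ge0 _) (E2 T).
- by rewrite /Rintegral E1.
Qed.

(** By symmetry the balls about [h] and [- h] have the same mass. Averaging their Cameron-Martin
    densities gives [expR (- v / 2)] times the hyperbolic cosine of [xi], which is at least 1. *)
Lemma shifted_ball_lower_bound (h : V) (xi : borel V -> R) (r : R) :
  rkhs_repr Pi h xi ->
  ((expR (- (2^-1 * \int[Pi]_f (xi f ^+ 2))))%:E * Pi [set f : V | (`|f| <= r)%R] <=
    Pi [set f : V | (`|f - h| <= r)%R])%E.
Proof.
move=> hxi.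
set v := \int[Pi]_f (xi f ^+ 2).
pose B : set (borel V) := [set f : V | (`|f| <= r)%R].
have mB : measurable B.
  have := measurable_closed_norm_ball (0 : V) r.
  by under eq_set do rewrite subr0.
pose G (f : borel V) : \bar R := (\1_B f)%:E.
have mG : measurable_fun setT G by apply/measurable_EFinP; exact: measurable_indic.
have G0 f : (0 <= G f)%E by rewrite lee_fin.
pose G2 (f : borel V) : \bar R := G ((f : V) + -1 *: h).
have mG2 : measurable_fun setT G2.
  apply: (measurableT_comp mG); apply: continuous_measurable_borel => f.
  by apply: cvgD; [exact: cvg_id|exact: cvg_cst].
have mxi : measurable_fun setT xi by have [] := hxi.
have mexp (t : R) : measurable_fun setT (fun f : borel V => (expR (t * xi f - t ^+ 2 / 2 * v))%:E).
  apply/measurable_EFinP; apply: measurableT_comp => //.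
  by apply: measurable_funB => //; exact: measurable_funM.
have mBh : measurable ([set f : V | `|f - h| <= r] : set (borel V)).
  exact: measurable_closed_norm_ball.
have E : Pi [set f : V | (`|f - h| <= r)%R] = (\int[Pi]_f G2 f)%E.
  transitivity (\int[Pi]_f (\1_([set f : V | (`|f - h| <= r)%R] : set (borel V)) f)%:E)%E.
    by rewrite integral_indic ?setIT.
  apply: eq_integral => f _; rewrite /G2 /G; congr EFin; rewrite !indicE; congr (nat_of_bool _)%:R.
  by apply/idP/idP; rewrite !inE /B/= scaleN1r.
have E1 : (\int[Pi]_f G2 f = \int[Pi]_f (G f * (expR (-1 * xi f - (-1) ^+ 2 / 2 * v))%:E))%E.
  exact: cameron_martin.
have E2 : (\int[Pi]_f G2 f = \int[Pi]_f (G f * (expR (1 * xi f - 1 ^+ 2 / 2 * v))%:E))%E.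
  rewrite -(cameron_martin hxi 1 mG G0) -(gaussian_symmetric mG2); last by move=> f; exact: G0.
  apply: eq_integral => f _; rewrite /G2 /G; congr EFin; rewrite !indicE; congr (nat_of_bool _)%:R.
  by apply/idP/idP; rewrite !inE /B/= scaleN1r scale1r -opprD normrN.
have E3 : (\int[Pi]_f G2 f + \int[Pi]_f G2 f)%E = (\int[Pi]_f
   (G f * (expR (1 * xi f - 1 ^+ 2 / 2 * v))%:E + G f * (expR (-1 * xi f - (-1) ^+ 2 / 2 * v))%:E))%E.
  rewrite ge0_integralD//; first by rewrite -E1 -E2.
  - by move=> f _; rewrite mule_ge0// lee_fin expR_ge0.
  - by apply: emeasurable_funM.
  - by move=> f _; rewrite mule_ge0// lee_fin expR_ge0.
  - by apply: emeasurable_funM.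
have E4 : ((2 * expR (- (2^-1 * v)))%:E * Pi B <= \int[Pi]_f G2 f + \int[Pi]_f G2 f)%E.
  rewrite E3 -[X in Pi X]setIT -integral_indic// -ge0_integralZl//.
  apply: ge0_le_integral => //.
  - by apply: emeasurable_funM.
  - by apply: emeasurable_funD; apply: emeasurable_funM.
  - move=> f _; rewrite -!EFinM -EFinD lee_fin (mulrC _ (\1_B f)) -mulrDr ler_wpM2l//.
    rewrite sqrrN expr1n mul1r mulN1r !expRD -mulrDl div1r ler_wpM2r ?expR_ge0//.
    by have := expR_ge1Dx (xi f); have := expR_ge1Dx (- xi f); lra.
rewrite E; move: E4; rewrite -/B.
have fE : (\int[Pi]_f G2 f)%E \is a fin_num by rewrite -E; exact: fin_num_measure.
have fB : Pi B \is a fin_num by rewrite fin_num_measure.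
rewrite -(fineK fE) -(fineK fB) -!EFinM -EFinD !lee_fin; lra.
Qed.

End cameron_martin.

(** * White noise *)

Section white_noise_theory.
Context d (Omega : measurableType d) (R : realType) (P : probability Omega R).
Context (H : hilbertType R) (W : H -> {RV P >-> R}).
Hypothesis noiseW : white_noise W.

Lemma white_noise_cov x y : \int[P]_w (W x w * W y w) = inner x y.
Proof.
have [_ /(_ x y)] := noiseW; rewrite unlock => h.
by rewrite /Rintegral h.
Qed.

Lemma white_noise_sq x : (\int[P]_w ((W x w) ^+ 2)%:E)%E = (`|x| ^+ 2)%:E.
Proof.
have [_ /(_ x x)] := noiseW; rewrite unlock inner_normE => <-.
by apply: eq_integral => w _; rewrite expr2.
Qed.

Lemma white_noise_sq_integrable x : sq_integrable P (W x).
Proof.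
split => //; apply/integrableP; split.
  by apply/measurable_EFinP; exact: measurable_funX.
rewrite (eq_integral (fun w => ((W x w) ^+ 2)%:E)) ?white_noise_sq ?ltry//.
by move=> w _ /=; rewrite ger0_norm ?sqr_ge0.
Qed.

Lemma white_noise_mgf x (t : R) :
  (\int[P]_w (expR (t * W x w))%:E)%E = (expR (t ^+ 2 / 2 * `|x| ^+ 2))%:E.
Proof.
have lawW : has_centred_normal_law P (W x).
  have [/(_ 1%N (fun=> 1) (fun=> x))] := noiseW.
  rewrite (_ : (fun w => _) = W x)//.
  by apply/funext => w; rewrite big_ord1 mul1r.
have [v [Hv ->]] := @gaussian_mgf _ _ _ P (W x) (measurable_funP (W x)) lawW.
by move: Hv; rewrite white_noise_sq => -[->].
Qed.

(** The covariance makes the second moment of the difference vanish; linearity is available only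
    almost surely, for each choice of vectors. *)
Lemma white_noise_linear x y (t : R) :
  {ae P, forall w, W (x + t *: y) w = W x w + t * W y w}.
Proof.
have sx := white_noise_sq_integrable x.
have sy := white_noise_sq_integrable y.
have sxy := white_noise_sq_integrable (x + t *: y).
pose g w := W (x + t *: y) w + (-1) * W x w.
have sg : sq_integrable P g.
  exact: sq_integrableD sxy (sq_integrableZ (-1) sx).
pose Y w := g w + (- t) * W y w.
have sY : sq_integrable P Y by exact: sq_integrableD sg (sq_integrableZ (- t) sy).
have Y0 : \int[P]_w (Y w ^+ 2) = 0.
  rewrite (Rintegral_sqD (- t) sg sy) (Rintegral_sqD (-1) sxy sx).
  have -> : \int[P]_w (W y w * g w) = inner y (x + t *: y) - inner y x.
    rewrite -!white_noise_cov -RintegralB//; try exact: sq_integrableM.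
    by apply: eq_Rintegral => w _; rewrite /g; ring.
  have sqE z : \int[P]_w (W z w ^+ 2) = inner z z.
    by rewrite -white_noise_cov; apply: eq_Rintegral => w _; rewrite expr2.
  rewrite !sqE !white_noise_cov !innerDr !innerDl !innerZr !innerZl.
  by rewrite (innerC y x); ring.
have : (\int[P]_w `|(Y w ^+ 2)%:E|)%E = 0%E.
  rewrite -[RHS]/(0%:E) -Y0 /Rintegral fineK; last first.
    by apply: integrable_fin_num => //; exact: sY.2.
  by apply: eq_integral => w _; rewrite gee0_abs// lee_fin sqr_ge0.
have mY2 : measurable_fun setT (fun w => (Y w ^+ 2)%:E).
  by apply/measurable_EFinP/measurable_funX; exact: sY.1.
move=> /(ae_eq_integral_abs P measurableT mY2).
apply: filterS => w /(_ I) [] /eqP.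
rewrite sqrf_eq0 /Y /g => /eqP; lra.
Qed.

End white_noise_theory.

(** * Approximate characterization of the normal law *)

Lemma ge0_le_integral_add d (T : measurableType d) (R : realType)
    (mu : {measure set T -> \bar R}) (f g h : T -> \bar R) (a : \bar R) :
  measurable_fun setT f -> measurable_fun setT g -> measurable_fun setT h ->
  (forall x, 0 <= f x)%E -> (forall x, 0 <= g x)%E -> (forall x, 0 <= h x)%E ->
  (forall x, f x <= g x + h x)%E -> (\int[mu]_x h x <= a)%E ->
  (\int[mu]_x f x <= \int[mu]_x g x + a)%E.
Proof.
move=> mf mg mh f0 g0 h0 fgh ha.
apply: (@le_trans _ _ (\int[mu]_x (g x + h x))%E).
  by apply: ge0_le_integral => //; exact: emeasurable_funD.
by rewrite ge0_integralD// leeD2l.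
Qed.

Lemma tonelli_le d1 d2 (T1 : measurableType d1) (T2 : measurableType d2)
    (R : realType) (m1 : {sigma_finite_measure set T1 -> \bar R})
    (m2 : {sigma_finite_measure set T2 -> \bar R})
    (f g : T1 * T2 -> \bar R) (h : T2 -> \bar R) :
  measurable_fun setT f -> measurable_fun setT g -> measurable_fun setT h ->
  (forall x, 0 <= f x)%E -> (forall x, 0 <= g x)%E -> (forall x, 0 <= h x)%E ->
  (forall y, \int[m1]_x f (x, y) <= \int[m1]_x g (x, y) + h y)%E ->
  (\int[m1]_x \int[m2]_y f (x, y) <=
   \int[m1]_x \int[m2]_y g (x, y) + \int[m2]_y h y)%E.
Proof.
move=> mf mg mh f0 g0 h0 fgh.
rewrite (fubini_tonelli f)// (fubini_tonelli g)//.
apply: (@ge0_le_integral_add _ _ _ _ _ _ h) => //.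
- exact: measurable_fun_fubini_tonelli_G.
- exact: measurable_fun_fubini_tonelli_G.
- by move=> y; exact: integral_ge0.
- by move=> y; exact: integral_ge0.
Qed.

Lemma lee_fin_dist (R : realType) (a b c : R) : `|a - b| <= c ->
  (a%:E <= b%:E + c%:E /\ b%:E <= a%:E + c%:E)%E.
Proof.
rewrite -!EFinD !lee_fin ler_norml => /andP[h1 h2].
by split; lra.
Qed.

(* An asymptotic form of [g(x) phi(x-y) dnu = (g phi)(x+y) dnu], which holds for
   all [y] only if [nu] is the normal law: integrating [y] over [-r, r] makes
   the left-hand side tend to the integral of [g] with respect to [nu], and the
   right-hand side to the integral of [g * phi]. The exponential moments
   provide tightness. *)
Definition almost_normal (R : realType) (sigma K : R) (n : nat)
    (nu : probability R R) :=
  [/\ (\int[nu]_x (expR x)%:E <= K%:E)%E,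
      (\int[nu]_x (expR (- x))%:E <= K%:E)%E
    & forall g : R -> R, continuous g -> (forall x, 0 <= g x <= 1) ->
      forall q : rat, `|ratr q : R| <= n%:R ->
      `|\int[nu]_x (g x * normal_pdf 0 sigma (x - ratr q)) -
        \int[nu]_x (g (x + ratr q) * normal_pdf 0 sigma (x + ratr q))| <=
          n.+1%:R^-1].

Section almost_normal_theory.
Context (R : realType) (sigma K : R).
Hypothesis sigma0 : sigma != 0.
Local Notation mu := (@lebesgue_measure R).
Local Notation phi := (normal_pdf 0 sigma).

Let mphi : measurable_fun setT phi.
Proof. exact: measurable_normal_pdf. Qed.

Let cphi : continuous phi.
Proof. exact: continuous_normal_pdf. Qed.

Let integrable_bdd (nu : probability R R) (f : R -> R) (c : R) :
  measurable_fun setT f -> (forall x, `|f x| <= c) ->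
  nu.-integrable setT (EFin \o f).
Proof.
move=> mf fc; have ic : nu.-integrable setT (EFin \o (cst c : R -> R)).
  exact: finite_measure_integrable_cst.
exact: (integrable_le mf ic fc).
Qed.

Section one_measure.
Variables (n : nat) (nu : probability R R).
Hypothesis an : almost_normal sigma K n nu.
Variable g : R -> R.
Hypothesis cg : continuous g.
Hypothesis g01 : forall x, 0 <= g x <= 1.

Let mg : measurable_fun setT g.
Proof. exact: continuous_measurable_fun. Qed.

Let g_ge0 x : 0 <= g x. Proof. by have /andP[] := g01 x. Qed.
Let g_le1 x : g x <= 1. Proof. by have /andP[] := g01 x. Qed.

Let gphi_bound x y : `|g x * phi y| <= normal_peak sigma.
Proof.
rewrite normrM !ger0_norm ?normal_pdf_ge0// (le_trans _ (normal_pdf_ub 0 y sigma0))//.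
by rewrite ler_piMl ?normal_pdf_ge0.
Qed.

Let m1 y : measurable_fun setT (fun x => g x * phi (x - y)).
Proof.
apply: measurable_funM => //; apply: (measurableT_comp mphi).
exact: measurable_funB.
Qed.

Let m2 y : measurable_fun setT (fun x : R => g (x + y) * phi (x + y)).
Proof.
by apply: measurable_funM; [apply: (measurableT_comp mg)|apply: (measurableT_comp mphi)];
  exact: measurable_funD.
Qed.

(** Rational shifts decrease to [y], and the peak of the density dominates. The strict bound on [y]
    leaves room for rationals above [y] that stay below [n]. *)
Let almost_normal_real y : `|y| < n%:R ->
  `|\int[nu]_x (g x * phi (x - y)) - \int[nu]_x (g (x + y) * phi (x + y))| <=
    n.+1%:R^-1.
Proof.
move=> yn.
have qex (k : nat) : exists q : rat, y < ratr q < Num.min (y + k.+1%:R^-1) n%:R.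
  have : y < Num.min (y + k.+1%:R^-1) n%:R.
    by rewrite lt_min ltrDl invr_gt0 ltr0n/= (le_lt_trans _ yn)// ler_norm.
  move=> /rat_in_itvoo[q]; rewrite in_itv/= => yq; by exists q.
have [q Hq] := choice qex.
have qn k : `|ratr (q k) : R| <= n%:R.
  have /andP[h1] := Hq k; rewrite lt_min => /andP[_ h2].
  rewrite ler_norml (ltW h2) andbT (le_trans _ (ltW h1))//.
  by move: yn; rewrite ltr_norml => /andP[/ltW].
have cq : (ratr (q k) : R) @[k --> \oo] --> y.
  apply: (@squeeze_cvgr _ _ _ _ (cst y) (fun k => y + k.+1%:R^-1)).
  - apply: nearW => k; have /andP[/ltW -> /=] := Hq k.
    by rewrite lt_min => /andP[/ltW].
  - exact: cvg_cst.
  - rewrite -[X in _ --> X]addr0; apply: cvgD; first exact: cvg_cst.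
    exact: cvg_harmonic.
have ic : nu.-integrable setT (EFin \o (cst (normal_peak sigma) : R -> R)).
  exact: finite_measure_integrable_cst.
have c1 : \int[nu]_x (g x * phi (x - ratr (q k))) @[k --> \oo] -->
    \int[nu]_x (g x * phi (x - y)).
  apply: (@Rintegral_dominated_cvg _ _ _ nu _ _ (cst (normal_peak sigma))) => // x.
  apply: cvgM; first exact: cvg_cst.
  apply: (cvg_comp _ phi); last exact: cphi.
  by apply: cvgB => //; exact: cvg_cst.
have c2 : \int[nu]_x (g (x + ratr (q k)) * phi (x + ratr (q k))) @[k --> \oo] -->
    \int[nu]_x (g (x + y) * phi (x + y)).
  apply: (@Rintegral_dominated_cvg _ _ _ nu _ _ (cst (normal_peak sigma))) => // x.
  have cx : x + (ratr (q k) : R) @[k --> \oo] --> x + y.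
    by apply: cvgD => //; exact: cvg_cst.
  by apply: cvgM; [apply: (cvg_comp _ g cx)|apply: (cvg_comp _ phi cx)];
    [exact: cg|exact: cphi].
apply: (cvgr_to_le (cvg_norm (cvgB c1 c2))).
by apply: nearW => k; have [_ _] := an; apply.
Qed.

Let F1 (y : R) : \bar R := (\int[nu]_x (g x * phi (x - y))%:E)%E.
Let F2 (y : R) : \bar R := (\int[nu]_x (g (x + y) * phi (x + y))%:E)%E.

Let F12 y : `|y| < n%:R ->
  (F1 y <= F2 y + (n.+1%:R^-1)%:E)%E /\ (F2 y <= F1 y + (n.+1%:R^-1)%:E)%E.
Proof.
move=> /almost_normal_real.
have i1 := integrable_bdd nu (m1 y) (fun x => gphi_bound x _).
have i2 := integrable_bdd nu (m2 y) (fun x => gphi_bound _ _).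
have e1 : F1 y = (\int[nu]_x (g x * phi (x - y)))%:E.
  by rewrite /Rintegral fineK// (integrable_fin_num measurableT i1).
have e2 : F2 y = (\int[nu]_x (g (x + y) * phi (x + y)))%:E.
  by rewrite /Rintegral fineK// (integrable_fin_num measurableT i2).
by rewrite e1 e2; exact: lee_fin_dist.
Qed.

Variable r : R.
Hypotheses (r0 : 0 < r) (rn : r < n%:R).
Let I : set (measurableTypeR R) := `[- r, r]%classic.

Let f1 (z : R * measurableTypeR R) : \bar R := (g z.1 * phi (z.1 - z.2) * \1_I z.2)%:E.
Let f2 (z : R * measurableTypeR R) : \bar R :=
  (g (z.1 + z.2) * phi (z.1 + z.2) * \1_I z.2)%:E.

Let mI : measurable I. Proof. exact: measurable_itv. Qed.

Let mindI : measurable_fun setT (fun z : R * measurableTypeR R => \1_I z.2 : R).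
Proof. exact: (measurableT_comp (measurable_indic mI) measurable_snd). Qed.

Let mf1 : measurable_fun setT f1.
Proof.
apply/measurable_EFinP; apply: measurable_funM => //.
apply: measurable_funM; first exact: (measurableT_comp mg measurable_fst).
by apply: (measurableT_comp mphi); exact: measurable_funB.
Qed.

Let mf2 : measurable_fun setT f2.
Proof.
apply/measurable_EFinP; apply: measurable_funM => //.
by apply: measurable_funM; [apply: (measurableT_comp mg)|apply: (measurableT_comp mphi)];
  exact: measurable_funD.
Qed.

Let f1_ge0 z : (0 <= f1 z)%E.
Proof. by rewrite lee_fin !mulr_ge0 ?normal_pdf_ge0. Qed.

Let f2_ge0 z : (0 <= f2 z)%E.
Proof. by rewrite lee_fin !mulr_ge0 ?normal_pdf_ge0. Qed.

Let c : R := n.+1%:R^-1.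

Let slice y : (\int[nu]_x f1 (x, y) <= \int[nu]_x f2 (x, y) + (c * \1_I y)%:E /\
               \int[nu]_x f2 (x, y) <= \int[nu]_x f1 (x, y) + (c * \1_I y)%:E)%E.
Proof.
have S1 : (\int[nu]_x f1 (x, y) = if y \in I then F1 y else 0)%E.
  case: ifPn => yI.
    by apply: eq_integral => x _; rewrite /f1/= indicE yI mulr1.
  by rewrite integral0_eq// => x _; rewrite /f1/= indicE (negbTE yI) mulr0.
have S2 : (\int[nu]_x f2 (x, y) = if y \in I then F2 y else 0)%E.
  case: ifPn => yI.
    by apply: eq_integral => x _; rewrite /f2/= indicE yI mulr1.
  by rewrite integral0_eq// => x _; rewrite /f2/= indicE (negbTE yI) mulr0.
rewrite S1 S2; have [yI|yI] := boolP (y \in I); last first.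
  by rewrite indicE (negbTE yI) mulr0 adde0.
rewrite indicE yI mulr1; apply: F12; move: yI.
by rewrite inE /I/= in_itv/= -ler_norml => /le_lt_trans; exact.
Qed.

Let mu_slice : (\int[mu]_y (c * \1_I y)%:E)%E = (c * (2 * r))%:E.
Proof.
under eq_integral do rewrite EFinM.
rewrite ge0_integralZl//; last 2 first.
- by apply/measurable_EFinP.
- by rewrite lee_fin invr_ge0.
have -> : (\int[mu]_y (\1_I y)%:E)%E = (2 * r)%:E.
  rewrite integral_indic// setIT.
  apply: (etrans (@lebesgue_measure_itv R `[- r, r])).
  by rewrite /= lte_fin gtrN// -EFinB; congr EFin; ring.
by rewrite -EFinM.
Qed.

(** Both sides integrated over [y] in [[-r, r]]. For fixed [y] they are compared by [slice]; for
    fixed [x] the inner integral is against a normal density of mean [x] or [- x]. Tonelli joins the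
    two readings. *)
Let J1 := (\int[nu]_x \int[mu]_y f1 (x, y))%E.
Let J2 := (\int[nu]_x \int[mu]_y f2 (x, y))%E.

Let J12 : (J1 <= J2 + (c * (2 * r))%:E /\ J2 <= J1 + (c * (2 * r))%:E)%E.
Proof.
have mc : measurable_fun setT (fun y : measurableTypeR R => (c * \1_I y)%:E).
  by apply/measurable_EFinP; apply: measurable_funM.
have c0 y : (0 <= (c * \1_I y)%:E)%E by rewrite lee_fin mulr_ge0 ?invr_ge0.
rewrite -mu_slice; split.
- apply: (@tonelli_le _ _ _ _ _ nu mu f1 f2 (fun y => (c * \1_I y)%:E) mf1 mf2 mc f1_ge0 f2_ge0 c0).
  by move=> y; exact: (proj1 (slice y)).
- apply: (@tonelli_le _ _ _ _ _ nu mu f2 f1 (fun y => (c * \1_I y)%:E) mf2 mf1 mc f2_ge0 f1_ge0 c0).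
  by move=> y; exact: (proj2 (slice y)).
Qed.

Let T_le : (\int[nu]_x (normal_tail sigma r x)%:E <=
  (expR (- r) * (expR (sigma ^+ 2 / 2) * (K + K)))%:E)%E.
Proof.
have [h1 h2 _] := an.
have me1 : measurable_fun setT (fun x : R => (expR x)%:E) by apply/measurable_EFinP.
have me2 : measurable_fun setT (fun x : R => (expR (- x))%:E).
  by apply/measurable_EFinP; exact: measurableT_comp.
rewrite (eq_integral (fun x => (expR (- r) * expR (sigma ^+ 2 / 2))%:E *
   ((expR x)%:E + (expR (- x))%:E))%E); last first.
  by move=> x _; rewrite -EFinD -EFinM /normal_tail mulrA.
rewrite (ge0_integralZl _ measurableT (emeasurable_funD me1 me2)); last 2 first.
- by move=> x _; rewrite -EFinD lee_fin addr_ge0 ?expR_ge0.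
- by rewrite lee_fin mulr_ge0 ?expR_ge0.
rewrite [leRHS](_ : _ = (expR (- r) * expR (sigma ^+ 2 / 2))%:E * (K%:E + K%:E))%E; last first.
  by rewrite -EFinD -EFinM mulrA.
apply: lee_wpmul2l; first by rewrite lee_fin mulr_ge0 ?expR_ge0.
rewrite (ge0_integralD _ measurableT)//.
by rewrite leeD.
Qed.

Let Ig : \bar R := (\int[mu]_y (g y * phi y)%:E)%E.

Let mT : measurable_fun setT (fun x : R => (normal_tail sigma r x)%:E).
Proof.
apply/measurable_EFinP; apply: measurable_funM => //; apply: measurable_funM => //.
by apply: measurable_funD => //; exact: measurableT_comp.
Qed.

Let mJ1 := measurable_fun_fubini_tonelli_F (m2 := mu) f1 mf1 f1_ge0.
Let mJ2 := measurable_fun_fubini_tonelli_F (m2 := mu) f2 mf2 f2_ge0.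

Let restr (h : R -> R) :
  (\int[mu]_y (h y * \1_I y)%:E = \int[mu]_(y in I) (h y)%:E)%E.
Proof.
rewrite [RHS]integral_mkcond; apply: eq_integral => y _.
by rewrite patchE indicE; case: ifPn => _; rewrite ?mulr1 ?mulr0.
Qed.

Let mpdf m : measurable_fun setT (normal_pdf m sigma).
Proof. exact: measurable_normal_pdf. Qed.

Let f1E x : (\int[mu]_y f1 (x, y) =
  \int[mu]_(y in I) (g x * normal_pdf x sigma y)%:E)%E.
Proof.
rewrite -restr; apply: eq_integral => y _.
by rewrite /f1/= normal_pdf_subr.
Qed.

Let f2E x : (\int[mu]_y f2 (x, y) =
  \int[mu]_(y in I) (g (x + y) * normal_pdf (- x) sigma y)%:E)%E.
Proof.
rewrite -restr; apply: eq_integral => y _.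
by rewrite /f2/= normal_pdf_addr.
Qed.

Let gpdf x : (\int[mu]_y (g x * normal_pdf x sigma y)%:E = (g x)%:E)%E.
Proof.
under eq_integral do rewrite EFinM.
rewrite ge0_integralZl//; first by rewrite integral_normal_pdf mule1.
- by apply/measurable_EFinP; exact: mpdf.
- by move=> y _; rewrite lee_fin normal_pdf_ge0.
- by rewrite lee_fin.
Qed.

(** By translation invariance the integral over all [y] is the same for every [x]; hence [J2] is
    close to the constant [Ig], up to the tail. *)
Let IgE x : (Ig = \int[mu]_y (g (x + y) * normal_pdf (- x) sigma y)%:E)%E.
Proof.
rewrite /Ig -(@integral_translation _ (fun y => g y * phi y) x).
- by apply: eq_integral => y _; rewrite normal_pdf_addr.
- by move=> y; apply: cvgM; [exact: cg|exact: cphi].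
- by move=> y; rewrite mulr_ge0 ?normal_pdf_ge0.
Qed.

Let mw1 x : measurable_fun setT (fun y : measurableTypeR R => (g x * normal_pdf x sigma y)%:E).
Proof.
by apply/measurable_EFinP; exact: (measurable_funM (measurable_cst (g x)) (mpdf x)).
Qed.

Let mgx x : measurable_fun setT (fun y : R => g (x + y)).
Proof. by apply: (measurableT_comp mg); exact: measurable_funD. Qed.

Let mw2 x : measurable_fun setT (fun y : measurableTypeR R =>
  (g (x + y) * normal_pdf (- x) sigma y)%:E).
Proof. by apply/measurable_EFinP; exact: (measurable_funM (mgx x) (mpdf _)). Qed.

Let f1_le x : (\int[mu]_y f1 (x, y) <= (g x)%:E)%E.
Proof.
rewrite f1E -[leRHS]gpdf; apply: ge0_subset_integral => //.
by move=> y _; rewrite lee_fin mulr_ge0 ?normal_pdf_ge0.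
Qed.

Let f1_ge x : ((g x)%:E <= \int[mu]_y f1 (x, y) + (normal_tail sigma r x)%:E)%E.
Proof.
rewrite f1E -[leLHS]gpdf.
by apply: (@normal_tail_le _ _ sigma0 (cst (g x))) => // y; rewrite /= g_ge0 g_le1.
Qed.

Let f2_le x : (\int[mu]_y f2 (x, y) <= Ig)%E.
Proof.
rewrite f2E (IgE x); apply: ge0_subset_integral => //.
by move=> y _; rewrite lee_fin mulr_ge0 ?normal_pdf_ge0.
Qed.

Let f2_ge x : (Ig <= \int[mu]_y f2 (x, y) + (normal_tail sigma r x)%:E)%E.
Proof.
rewrite f2E (IgE x) (_ : normal_tail sigma r x = normal_tail sigma r (- x)).
  by apply: (@normal_tail_le _ _ sigma0 (fun y => g (x + y))) => // y; rewrite g_ge0 g_le1.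
by rewrite /normal_tail opprK (addrC (expR x)).
Qed.

Let bound := c * (2 * r) + expR (- r) * (expR (sigma ^+ 2 / 2) * (K + K)).

Let main : (\int[nu]_x (g x)%:E <= Ig + bound%:E /\
           Ig <= \int[nu]_x (g x)%:E + bound%:E)%E.
Proof.
have [J1J2 J2J1] := J12.
have t0 x : (0 <= (normal_tail sigma r x)%:E)%E by rewrite lee_fin normal_tail_ge0.
have J10 x : (0 <= \int[mu]_y f1 (x, y))%E by exact: integral_ge0.
have J20 x : (0 <= \int[mu]_y f2 (x, y))%E by exact: integral_ge0.
have mgE : measurable_fun setT (fun x => (g x)%:E) by exact/measurable_EFinP.
have Ig0 : (0 <= Ig)%E.
  by apply: integral_ge0 => y _; rewrite lee_fin mulr_ge0// normal_pdf_ge0.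
have cstI : (\int[nu]_x Ig = Ig)%E by rewrite integral_cst// [X in (_ * X)%E]probability_setT mule1.
have g0E x : (0 <= (g x)%:E)%E by rewrite lee_fin.
have B1 : (\int[nu]_x (g x)%:E <= J1 + (expR (- r) * (expR (sigma ^+ 2 / 2) * (K + K)))%:E)%E.
  exact: (@ge0_le_integral_add _ _ _ nu _ _ (fun x => (normal_tail sigma r x)%:E) _
    mgE mJ1 mT g0E J10 t0 f1_ge T_le).
have B2 : (Ig <= J2 + (expR (- r) * (expR (sigma ^+ 2 / 2) * (K + K)))%:E)%E.
  rewrite -[leLHS]cstI.
  exact: (@ge0_le_integral_add _ _ _ nu (cst Ig) _ (fun x => (normal_tail sigma r x)%:E) _
    (measurable_cst Ig) mJ2 mT (fun=> Ig0) J20 t0 f2_ge T_le).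
have B3 : (J2 <= Ig)%E.
  rewrite -[leRHS]cstI; apply: ge0_le_integral => [||||x _].
  - exact: measurableT.
  - by move=> x _; exact: J20.
  - exact: mJ2.
  - exact: measurable_cst.
  - exact: f2_le.
have B4 : (J1 <= \int[nu]_x (g x)%:E)%E.
  apply: ge0_le_integral => [||||x _].
  - exact: measurableT.
  - by move=> x _; exact: J10.
  - exact: mJ1.
  - exact: mgE.
  - exact: f1_le.
rewrite /bound EFinD !addeA; split.
- by rewrite (le_trans B1)// leeD2r// (le_trans J1J2)// leeD2r.
- by rewrite (le_trans B2)// leeD2r// (le_trans J2J1)// leeD2r.
Qed.

Lemma almost_normal_dist :
  `|\int[nu]_x g x - \int[centred_normal sigma]_x g x| <=
  2 * r / n.+1%:R + expR (- r) * (expR (sigma ^+ 2 / 2) * (K + K)).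
Proof.
have mgE : measurable_fun setT (fun x => (g x)%:E) by exact/measurable_EFinP.
have b1 x : `|g x| <= 1 by rewrite ger0_norm.
have IgE' : Ig = (\int[centred_normal sigma]_x (g x)%:E)%E.
  rewrite ge0_integral_centred_normal//.
have e1 : (\int[nu]_x (g x)%:E)%E = (\int[nu]_x g x)%:E.
  by rewrite /Rintegral fineK// (integrable_fin_num measurableT (integrable_bdd nu mg b1)).
have e2 : Ig = (\int[centred_normal sigma]_x g x)%:E.
  by rewrite IgE' /Rintegral fineK// (integrable_fin_num measurableT (integrable_bdd _ mg b1)).
have := main; rewrite e1 e2 -!EFinD !lee_fin => -[h1 h2].
rewrite (_ : 2 * r / n.+1%:R + _ = bound); last by rewrite /bound /c; congr (_ + _); rewrite mulrC.
by rewrite ler_norml; apply/andP; split; lra.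
Qed.

End one_measure.

Lemma almost_normal_weak_cvg (nu_ : nat -> probability R R) :
  (forall n, almost_normal sigma K n (nu_ n)) ->
  weak_cvg nu_ (centred_normal sigma).
Proof.
move=> an h ch [C hC].
(* Test functions of [almost_normal] take values in [[0, 1]], so [h] is rescaled; the [+ 1] keeps
   the divisor positive when [C] is 0. *)
pose D := C + 1.
have C0 : 0 <= C by rewrite (le_trans _ (hC 0)).
have D0 : 0 < D by rewrite ltr_wpDl.
pose g x := (h x / D + 1) / 2.
have hD x : `|h x / D| <= 1.
  rewrite normrM normfV (gtr0_norm D0) ler_pdivrMr// mul1r (le_trans (hC x))//.
  by rewrite lerDl.
have g01 x : 0 <= g x <= 1.
  by move: (hD x); rewrite ler_norml /g => /andP[h1 h2]; apply/andP; split; lra.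
have cg : continuous g.
  move=> x; apply: cvgMl; apply: cvgD; last exact: cvg_cst.
  by apply: cvgMl; exact: ch.
have mh : measurable_fun setT h by exact: continuous_measurable_fun.
have gE (nu : probability R R) : \int[nu]_x g x = 2^-1 * (D^-1 * \int[nu]_x h x + 1).
  have ih := integrable_bdd nu mh hC.
  have i1 : nu.-integrable setT (EFin \o (fun x => D^-1 * h x)).
    by have := integrableZl measurableT D^-1 ih.
  have i2 : nu.-integrable setT (EFin \o (cst 1 : R -> R)).
    exact: finite_measure_integrable_cst.
  rewrite -RintegralZl// -[X in _ * (_ + X)]mul1r.
  have <- : \int[nu]_x (cst 1 x) = 1 * 1 :> R.
    by rewrite Rintegral_cst// [X in fine X]probability_setT.
  rewrite -RintegralD// -RintegralZl//.
    by apply: eq_Rintegral => x _; rewrite /g/=; ring.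
  by have := integrableD measurableT i1 i2.
pose E := expR (sigma ^+ 2 / 2) * (K + K).
have cvg_g : \int[nu_ n]_x g x @[n --> \oo] --> \int[centred_normal sigma]_x g x.
  apply/cvgrPdist_le => e e0.
  (* Then [e / 2 * r] exceeds [|E|], and [r <= expR r] gives [expR (- r) * |E| <= e / 2]. With [r]
     fixed, [n] makes the other term small. *)
  pose r := 2 * `|E| / e + 1.
  have r0 : 0 < r by rewrite ltr_wpDl// divr_ge0 ?mulr_ge0 ?(ltW e0).
  near=> n.
  have rn : r < n%:R by near: n; exact: nbhs_infty_gtr.
  rewrite distrC (le_trans (almost_normal_dist (an n) cg g01 r0 rn))//.
  rewrite (splitr e) lerD//.
    rewrite ler_pdivrMr ?ltr0n//.
    have : 4 * r / e < n%:R by near: n; exact: nbhs_infty_gtr.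
    rewrite ltr_pdivrMr// => h1.
    have : e / 2 * n.+1%:R = e / 2 * n%:R + e / 2 by rewrite -[n.+1%:R]natr1 mulrDr mulr1.
    by move=> ->; lra.
  apply: (@le_trans _ _ (expR (- r) * `|E|)).
    by rewrite ler_wpM2l ?expR_ge0// ler_norm.
  rewrite expRN mulrC ler_pdivrMr ?expR_gt0//.
  have h2 : r <= expR r by have := expR_ge1Dx r; lra.
  apply: (@le_trans _ _ (e / 2 * r)); last by rewrite ler_wpM2l// divr_ge0// ltW.
  have -> : e / 2 * r = `|E| + e / 2 by rewrite /r; field; rewrite gt_eqF.
  by rewrite lerDl divr_ge0// ltW.
have hE (nu : probability R R) : \int[nu]_x h x = D * (2 * \int[nu]_x g x - 1).
  by rewrite gE; field; rewrite gt_eqF.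
rewrite hE; under eq_fun do rewrite hE.
by apply: cvgMr; apply: cvgB; [exact: cvgMr|exact: cvg_cst].
Unshelve. all: by end_near. Qed.

End almost_normal_theory.

(** * Null sets in products, posterior integrals, metrics for weak convergence *)

(** Identities for the likelihood hold almost surely for each [f], while the posterior requires
    them, for almost every noise path, at almost every [f]. Tonelli applied to the indicator of the
    exceptional set exchanges the two. *)
Lemma ae_swap d1 d2 (T1 : measurableType d1) (T2 : measurableType d2)
    (R : realType) (m1 : {sigma_finite_measure set T1 -> \bar R})
    (m2 : {sigma_finite_measure set T2 -> \bar R}) (N : set (T1 * T2)) :
  measurable N -> (forall x, {ae m2, forall y, ~ N (x, y)}) ->
  {ae m2, forall y, {ae m1, forall x, ~ N (x, y)}}.
Proof.
move=> mN aeN.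
pose F (z : T1 * T2) : \bar R := (\1_N z)%:E.
have mF : measurable_fun setT F by apply/measurable_EFinP; exact: measurable_indic.
have F0 z : (0 <= F z)%E by rewrite lee_fin.
have E0 : (\int[m2]_y \int[m1]_x F (x, y))%E = 0%E.
  rewrite -fubini_tonelli// integral0_eq// => x _.
  rewrite (ae_eq_integral (cst 0%E))//.
  - by rewrite integral0.
  - exact: (measurableT_comp mF).
  - by apply: filterS (aeN x) => y nN _; rewrite /F indicE memNset.
have mG : measurable_fun setT (fun y => \int[m1]_x F (x, y))%E.
  exact: measurable_fun_fubini_tonelli_G.
have := (ae_eq_integral_abs m2 measurableT mG).1.
rewrite (eq_integral (fun y => \int[m1]_x F (x, y))%E); last first.
  by move=> y _; rewrite gee0_abs// integral_ge0.
move=> /(_ E0); apply: filterS => y /(_ I) /= Fy0.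
have mFy : measurable_fun setT (fun x => F (x, y)).
  by apply: (measurableT_comp mF).
have := (ae_eq_integral_abs m1 measurableT mFy).1.
rewrite (eq_integral (fun x => F (x, y))); last by move=> x _; rewrite gee0_abs.
move=> /(_ Fy0); apply: filterS => x /(_ I) /= + Nxy.
by rewrite /F indicE mem_set// => -[] /eqP; rewrite oner_eq0.
Qed.

Lemma markov_ge0 d (T : measurableType d) (R : realType) (mu : probability T R)
    (f : T -> \bar R) (m a : R) : measurable_fun setT f -> (forall x, 0 <= f x)%E ->
  (\int[mu]_x f x <= m%:E)%E -> 0 < a ->
  (mu [set x | (a%:E < f x)%E] <= (m / a)%:E)%E.
Proof.
move=> mf f0 fm a0.
have h := @le_integral_abse _ _ _ mu setT measurableT f a mf a0.
have mA : measurable [set x | (a%:E < f x)%E].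
  rewrite -[X in measurable X]setTI.
  exact: emeasurable_fun_o_infty.
have mB : measurable [set x | (a%:E <= `|f x|)%E].
  rewrite -[X in measurable X]setTI.
  apply: emeasurable_fun_c_infty => //; exact: measurableT_comp.
have : (a%:E * mu [set x | (a%:E < f x)%E] <= m%:E)%E.
  apply: le_trans fm; apply: le_trans (le_trans h _).
    rewrite lee_pmul2l// setTI; apply: le_measure; rewrite ?inE//.
    by move=> x /= /ltW; rewrite gee0_abs.
  by rewrite (eq_integral f)// => x _; rewrite gee0_abs.
have fA : mu [set x | (a%:E < f x)%E] \is a fin_num by exact: fin_num_measure.
by rewrite -(fineK fA) -EFinM !lee_fin ler_pdivlMr// mulrC.
Qed.

(** Adding a constant to the log-likelihood does not change the posterior, hence the free [k], later
    the value at the truth. A positive finite [D] rules out the default value of [mnormalize]. *)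
Lemma ge0_integral_posterior d (X : measurableType d) (R : realType)
    (Pi : probability X R) (l : {mfun X >-> R}) (k D : R) (G : X -> \bar R) :
  0 < D -> (\int[Pi]_x (expR (l x - k))%:E)%E = D%:E ->
  measurable_fun setT G -> (forall x, 0 <= G x)%E ->
  (\int[posterior Pi l]_x G x =
   (D^-1)%:E * \int[Pi]_x (G x * (expR (l x - k))%:E))%E.
Proof.
move=> D0 DE mG G0.
have mexp : measurable_fun setT (fun x => (expR (l x - k))%:E).
  by apply/measurable_EFinP; apply: measurableT_comp => //; exact: measurable_funB.
have expE x : (expR (l x))%:E = ((expR k)%:E * (expR (l x - k))%:E)%E.
  by rewrite -EFinM -expRD addrC subrK.
have TE : tilt Pi l setT = (expR k * D)%:E.
  rewrite /tilt; under eq_integral do rewrite expE.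
  by rewrite ge0_integralZl// DE EFinM.
have kD0 : 0 < expR k * D by rewrite mulr_gt0 ?expR_gt0.
have kDge0 : 0 <= (expR k * D)^-1 by rewrite invr_ge0 ltW.
have TE' : (tilt Pi l : {measure set X -> \bar R}) [set: X] = (expR k * D)%:E := TE.
have postE A : mnormalize (tilt Pi l) Pi A = (tilt Pi l A * ((expR k * D)^-1)%:E)%E.
  by rewrite /mnormalize TE' eqe gt_eqF.
rewrite (@eq_measure_integral _ _ _ _ (mscale (NngNum kDge0) (tilt Pi l))); last first.
  by move=> A mA _; rewrite [LHS]postE muleC.
rewrite ge0_integral_mscale//= ge0_integral_tilt//.
under eq_integral do rewrite expE muleCA.
rewrite ge0_integralZl//.
- by rewrite muleA -EFinM invfM mulrAC mulVf ?mul1r// gt_eqF// expR_gt0.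
- exact: emeasurable_funM.
- by move=> x _; rewrite mule_ge0// lee_fin expR_ge0.
Qed.

(** [dist] is only known through the sequences that converge for it. If no [n] worked, one
    counterexample per [n] would form a sequence converging weakly but staying [eta] away. *)
Lemma weak_metric_modulus (R : realType) (sigma K eta : R)
    (dist : probability R R -> probability R R -> R) : sigma != 0 ->
  weak_metric dist -> 0 < eta ->
  exists n, forall nu, almost_normal sigma K n nu ->
    dist nu (centred_normal sigma) <= eta.
Proof.
move=> s0 [_ _ _ _ distP] eta0; apply: contrapT => /forallNP H.
have /choice[nu_ Hnu] : forall n, exists nu, almost_normal sigma K n nu /\
    eta < dist nu (centred_normal sigma).
  move=> n; have /existsNP[nu /not_implyP[h1 /negP h2]] := H n.
  by exists nu; rewrite ltNge.
have /distP : weak_cvg nu_ (centred_normal sigma).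
  by apply: (almost_normal_weak_cvg s0) => n; exact: (Hnu n).1.
move=> /cvgr_lt /(_ _ eta0) [N _ /(_ N (leqnn N)) /=].
by rewrite ltNge (ltW (Hnu N).2).
Qed.

(** * The posterior distribution *)

Lemma normr_expRB1_le (R : realType) (x : R) : `|expR x - 1| <= expR `|x| - 1.
Proof.
have [x0|x0] := leP 0 x.
  by rewrite !ger0_norm// subr_ge0 -expR0 ler_expR.
rewrite (ltr0_norm x0) ler0_norm; last first.
  by rewrite subr_le0 -[leRHS]expR0 ler_expR ltW.
by have := expR_ge1Dx x; have := expR_ge1Dx (- x); lra.
Qed.

(** Bounds the posterior mean of [expR (t * eps * |xi| + (t * eps) ^+ 2 / 2 * v)] on the good event.
    The first factor takes [lam * |xi|] at the threshold [(5 + v / 2) * lam ^+ 2 + 1]; the second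
    pays for larger values. *)
Definition tilt_factor (R : realType) (v eps lam t : R) : R :=
  expR (t * eps * ((5 + v / 2) * lam ^+ 2 + 1) / lam + (t * eps) ^+ 2 / 2 * v) *
  (1 + 2 * expR (- lam ^+ 2)).

Section posterior_analysis.
Context d (Omega : measurableType d) (R : realType) (P : probability Omega R).
Context (V H : hilbertType R) (A : {linear V -> H}) (W : H -> {RV P >-> R}).
Hypothesis sepV : separable V.
Hypothesis noiseW : white_noise W.
Variables (Pi : probability (borel V) R) (fdag : V).
Hypothesis gaussPi : centred_gaussian_measure Pi.
Variables (h : V) (xi : borel V -> R).
Hypothesis hxi : rkhs_repr Pi h xi.
Variable L : dual V.
Hypothesis LE : forall f, L f = - inner (A f) (A h).
Variable eps : R.
Hypothesis eps0 : 0 < eps.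
Variable l : Omega -> {mfun borel V >-> R}.
Hypothesis ml : measurable_fun setT (fun z : borel V * Omega => l z.2 z.1).
Hypothesis lE : forall f : V,
  {ae P, forall w, l w f = log_likelihood A W fdag eps f w}.

Let sigma := `|A h|.
Let v := \int[Pi]_f (xi f ^+ 2).
(** Almost surely [U] involves the noise only through [W (A (f - fdag))], so its exponential moments
    are explicit and [expR U] has mean 1. *)
Let U (z : borel V * Omega) : R := l z.2 z.1 - l z.2 fdag.
Let Psi w := L fdag - eps * W (A h) w.
Let Z w : borel V -> R := rescaled L eps (Psi w).

Let epsn0 : eps != 0. Proof. by rewrite gt_eqF. Qed.

Let mshift (g : V) : measurable_fun setT (fun f : borel V => (f : V) + g : borel V).
Proof.
apply: continuous_measurable_borel => f.
by apply: cvgD; [exact: cvg_id|exact: cvg_cst].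
Qed.

Let mlfdag : measurable_fun setT (fun w => l w fdag).
Proof.
exact: (measurable_fun_pair2 (fdag : borel V) ml).
Qed.

Let mU : measurable_fun setT U.
Proof.
apply: measurable_funB => //.
exact: (measurableT_comp mlfdag measurable_snd).
Qed.

Let U_ae (f : V) : {ae P, forall w, U ((f : borel V), w) =
  eps^-1 * W (A (f - fdag)) w - 2^-1 * (eps ^- 2 * `|A (f - fdag)| ^+ 2)}.
Proof.
have := white_noise_linear noiseW (A f) (A fdag) (-1).
have := lE f; have := lE fdag.
apply: filterS3 => w e1 e2 e3; rewrite /U /= e1 e2.
have -> : A (f - fdag) = A f + (-1) *: A fdag by rewrite scaleN1r linearB.
rewrite e3 /log_likelihood /observation -!inner_normE.
rewrite !innerDr !innerDl !innerZr !innerZl (innerC (A f) (A fdag)).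
by field.
Qed.

Let mexpU (s : R) (f : borel V) : measurable_fun setT (fun w => (expR (s * U (f, w)))%:E).
Proof.
apply/measurable_EFinP; apply: measurableT_comp => //; apply: measurable_funM => //.
exact: (measurable_fun_pair2 f mU).
Qed.

Let expU_mgf (s : R) (f : borel V) : (\int[P]_w (expR (s * U (f, w)))%:E)%E =
  (expR (2^-1 * (s ^+ 2 - s) * (eps ^- 2 * `|A ((f : V) - fdag)| ^+ 2)))%:E.
Proof.
set x := A ((f : V) - fdag).
have mexpW : measurable_fun setT (fun w => (expR (s / eps * W x w))%:E).
  by apply/measurable_EFinP; apply: measurableT_comp => //; exact: measurable_funM.
transitivity (\int[P]_w ((expR (- (s / 2 * (eps ^- 2 * `|x| ^+ 2))))%:E *
    (expR (s / eps * W x w))%:E))%E.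
  apply: ge0_ae_eq_integral => //.
  - exact: emeasurable_funM.
  - apply: filterS (U_ae f) => w -> _; rewrite -EFinM -expRD; congr (expR _)%:E.
    by rewrite -/x; field.
rewrite ge0_integralZl//.
by rewrite white_noise_mgf// -EFinM -expRD; congr (expR _)%:E; field.
Qed.

Let expU (f : borel V) : (\int[P]_w (expR (U (f, w)))%:E)%E = 1%E.
Proof.
have := expU_mgf 1 f; rewrite expr1n subrr mulr0 mul0r expR0 => <-.
by apply: eq_integral => w _; rewrite mul1r.
Qed.

Let expNU (f : borel V) : (\int[P]_w (expR (- U (f, w)))%:E)%E =
  (expR (eps ^- 2 * `|A ((f : V) - fdag)| ^+ 2))%:E.
Proof.
have := expU_mgf (-1) f.
rewrite sqrrN expr1n opprK (_ : 2^-1 * (1 + 1) = 1); last by field.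
rewrite mul1r => <-.
by apply: eq_integral => w _; rewrite mulN1r.
Qed.

Let mass (q : borel V -> R) w : \bar R := (\int[Pi]_f (q f * expR (U (f, w)))%:E)%E.

(** Tonelli and the unit mean of [expR U] reduce an unnormalized posterior integral to a prior
    one. *)
Let mass_mean (q : borel V -> R) : measurable_fun setT q -> (forall f, 0 <= q f) ->
  measurable_fun setT (mass q) /\
  (\int[P]_w mass q w = \int[Pi]_f (q f)%:E)%E.
Proof.
move=> mq q0.
pose F (z : borel V * Omega) : \bar R := (q z.1 * expR (U z))%:E.
have mF : measurable_fun setT F.
  apply/measurable_EFinP; apply: measurable_funM; last exact: measurableT_comp.
  exact: (measurableT_comp mq measurable_fst).
have F0 z : (0 <= F z)%E by rewrite lee_fin mulr_ge0 ?expR_ge0.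
split; first exact: (measurable_fun_fubini_tonelli_G (m1 := Pi) F).
transitivity (\int[P]_w \int[Pi]_f F (f, w))%E; first by [].
rewrite -(fubini_tonelli F)//; apply: eq_integral => f _.
rewrite /F /=; under eq_integral do rewrite EFinM.
rewrite ge0_integralZl//; last by rewrite lee_fin.
  by rewrite expU mule1.
by have := mexpU 1 f; under eq_fun do rewrite mul1r.
Qed.

(** The joint measurability of the version [l] makes the exceptional set [N] measurable, so that
    [ae_swap] applies to the almost sure identity at each [f]. *)
Let translation_ae (t : R) : {ae P, forall w, {ae Pi, forall f : borel V,
  l w ((f : V) + (t * eps) *: h) = l w f + t * Z w f - t ^+ 2 / 2 * sigma ^+ 2}}.
Proof.
pose N : set (borel V * Omega) := [set z | ((l z.2 ((z.1 : V) + (t * eps) *: h))%:E !=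
  (l z.2 z.1 + t * Z z.2 z.1 - t ^+ 2 / 2 * sigma ^+ 2)%:E)%E].
have mshift2 : measurable_fun setT (fun z : borel V * Omega =>
    (((z.1 : V) + (t * eps) *: h : borel V), z.2)).
  apply: measurable_fun_pair; last exact: measurable_snd.
  exact: (measurableT_comp (mshift ((t * eps) *: h)) measurable_fst).
have mZ : measurable_fun setT (fun z : borel V * Omega => Z z.2 z.1).
  apply: measurable_funM => //; apply: measurable_funB.
    exact: (measurableT_comp (measurable_dual L) measurable_fst).
  apply: measurable_funB => //; apply: measurable_funM => //.
  exact: (measurableT_comp (measurable_funP (W (A h))) measurable_snd).
have mN : measurable N.
  rewrite /N -[X in measurable X]setTI.
  apply: measurable_neqe => //; apply/measurable_EFinP.
    exact: (measurableT_comp ml mshift2).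
  by apply: measurable_funB => //; apply: measurable_funD => //; exact: measurable_funM.
have /(ae_swap Pi mN) : forall f : borel V, {ae P, forall w, ~ N (f, w)}.
  move=> f; have := white_noise_linear noiseW (A f) (A h) (t * eps).
  have := lE f; have := lE ((f : V) + (t * eps) *: h).
  apply: filterS3 => w e1 e2 e3; rewrite /N /= => /negP; apply; rewrite eqe; apply/eqP.
  rewrite e1 e2 /log_likelihood /observation /Z /rescaled /Psi !LE.
  rewrite linearD linearZ /= e3 /sigma -!inner_normE.
  rewrite !innerDr !innerDl !innerZr !innerZl (innerC (A h) (A f)).
  by field.
apply: filterS => w; apply: filterS => f /negP; rewrite negbK eqe => /eqP.
exact.
Qed.

(** The integral of [F (f + t * eps *: h)] is computed by [translation_ae] on one side and by
    [cameron_martin] on the other. Since [L h = - sigma ^+ 2], the translation lowers [Z] by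
    [t * sigma ^+ 2]. *)
Let quasi_invariance (t : R) w (G : R -> \bar R) :
  {ae Pi, forall f : borel V, l w ((f : V) + (t * eps) *: h) =
     l w f + t * Z w f - t ^+ 2 / 2 * sigma ^+ 2} ->
  measurable_fun setT G -> (forall x, 0 <= G x)%E ->
  (\int[Pi]_f (G (Z w f) * (expR (t * Z w f - t ^+ 2 / 2 * sigma ^+ 2 + U (f, w)))%:E) =
   \int[Pi]_f (G (Z w f + t * sigma ^+ 2)%R *
     (expR ((t * eps) * xi f - (t * eps) ^+ 2 / 2 * v + U (f, w)))%:E))%E.
Proof.
move=> tr mG G0.
have mZw : measurable_fun setT (Z w) by exact: measurable_funP.
have mlw : measurable_fun setT (l w) by exact: measurable_funP.
pose F (f : borel V) : \bar R :=
  (G (Z w f + t * sigma ^+ 2)%R * (expR (l w f - l w fdag))%:E)%E.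
have mF : measurable_fun setT F.
  apply: emeasurable_funM; last first.
    by apply/measurable_EFinP; apply: measurableT_comp => //; exact: measurable_funB.
  by apply: (measurableT_comp mG); exact: measurable_funD.
have F0 f : (0 <= F f)%E by rewrite mule_ge0// lee_fin expR_ge0.
transitivity (\int[Pi]_f F ((f : V) + (t * eps) *: h)%R)%E.
  apply: ge0_ae_eq_integral => //.
  - apply: emeasurable_funM; first exact: (measurableT_comp mG).
    apply/measurable_EFinP; apply: measurableT_comp => //; apply: measurable_funD.
      by apply: measurable_funB => //; exact: measurable_funM.
    exact: (measurable_fun_pair1 w mU).
  - exact: (measurableT_comp mF (mshift _)).
  - by move=> f _; rewrite mule_ge0// lee_fin expR_ge0.
  apply: filterS tr => f e _; rewrite /F e; congr (G _ * (expR _)%:E)%E.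
    have LhE : L h = - sigma ^+ 2 by rewrite LE inner_normE.
    have LsE : L ((f : V) + (t * eps) *: h) = L f - t * eps * sigma ^+ 2.
      by rewrite linearD linearZ LhE; congr (_ + _); exact: mulrN.
    by rewrite /Z /rescaled LsE; field.
  by rewrite /U/=; ring.
rewrite (cameron_martin sepV gaussPi hxi)//; apply: eq_integral => f _.
rewrite /F -muleA; congr (_ * _)%E; rewrite -EFinM -expRD; congr (expR _)%:E.
by rewrite /U/= -/v; ring.
Qed.

(** * The good event and the evidence *)

Variables (c delta : R).
Hypotheses (c0 : 0 < c) (delta0 : 0 < delta).
Hypothesis A_le : forall f, `|A f| <= c * `|f|.
Let lam := delta / eps.
Let r := lam ^+ 2.
(** On [B], [|A (f - fdag)| <= delta], so [expR (- U)] has mean at most [expR r] there. *)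
Let B : set (borel V) := [set f : V | `|f - fdag| <= delta / c].
Hypothesis small_ball : ((expR (- (r + 1)))%:E <= Pi B)%E.

Let lam0 : 0 < lam. Proof. by rewrite divr_gt0. Qed.

Let mxi : measurable_fun setT xi. Proof. by have [] := hxi. Qed.

Let mB : measurable B. Proof. exact: measurable_closed_norm_ball. Qed.

(** With rate [lam] the prior mean is at most [2 * expR (r / 2 * v)], whose logarithm has the same
    order [r] as that of the inverse evidence. *)
Let q (f : borel V) : R := expR (lam * `|xi f|).

Let mexpxi (a b : R) : measurable_fun setT (fun f : borel V => expR (a * `|xi f| + b)).
Proof.
apply: measurableT_comp => //; apply: measurable_funD => //.
by apply: measurable_funM => //; exact: measurableT_comp.
Qed.

Let mq : measurable_fun setT q.
Proof. by have := mexpxi lam 0; under eq_fun do rewrite addr0. Qed.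

Let mUw (s : R) w : measurable_fun setT (fun f : borel V => expR (s * U (f, w))).
Proof.
apply: measurableT_comp => //; apply: measurable_funM => //.
exact: (measurable_fun_pair1 w mU).
Qed.

Let p := fine (Pi B).

Let pE : Pi B = p%:E. Proof. by rewrite /p fineK// fin_num_measure. Qed.

Let p_ge : expR (- (r + 1)) <= p. Proof. by rewrite -lee_fin -pE. Qed.

Let p0 : 0 < p. Proof. by rewrite (lt_le_trans _ p_ge)// expR_gt0. Qed.

(** An upper bound on this integral of the inverse likelihood ratio becomes a lower bound on the
    evidence. *)
Let invmass w : \bar R := (\int[Pi]_f (\1_B f * expR (- U (f, w)))%:E)%E.

Let invmass_mean : measurable_fun setT invmass /\
  (\int[P]_w invmass w <= (p * expR r)%:E)%E.
Proof.
pose F (z : borel V * Omega) : \bar R := (\1_B z.1 * expR (- U z))%:E.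
have mF : measurable_fun setT F.
  apply/measurable_EFinP; apply: measurable_funM.
    exact: (measurableT_comp (measurable_indic mB) measurable_fst).
  by apply: measurableT_comp => //; exact: measurableT_comp.
have F0 z : (0 <= F z)%E by rewrite lee_fin mulr_ge0 ?expR_ge0.
split; first exact: (measurable_fun_fubini_tonelli_G (m1 := Pi) F).
rewrite [leLHS](_ : _ = \int[P]_w \int[Pi]_f F (f, w))%E//.
rewrite -(fubini_tonelli F)//.
apply: (@le_trans _ _ (\int[Pi]_f ((expR r)%:E * (\1_B f)%:E))%E); last first.
  rewrite ge0_integralZl//; last exact/measurable_EFinP/measurable_indic.
  by rewrite integral_indic// setIT [X in (_ * X)%E]pE -EFinM mulrC.
apply: ge0_le_integral => //.
- by move=> f _; exact: integral_ge0.
- exact: (measurable_fun_fubini_tonelli_F (m2 := P) F).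
- by apply: emeasurable_funM => //; exact/measurable_EFinP/measurable_indic.
move=> f _; rewrite /F /=; under eq_integral do rewrite EFinM.
rewrite ge0_integralZl//; last first.
  by have := mexpU (-1) f; under eq_fun do rewrite mulN1r.
rewrite expNU -!EFinM lee_fin mulrC; have [fB|fB] := boolP (f \in B); last first.
  by rewrite indicE (negbTE fB) !mulr0.
rewrite indicE fB !mulr1 ler_expR /r /lam expr_div_n mulrC ler_wpM2r//.
  by rewrite invr_ge0 exprn_ge0// ltW.
rewrite lerXn2r ?nnegrE ?(ltW delta0)// (le_trans (A_le _))//.
by move: fB; rewrite inE /B/= -ler_pdivlMl// mulrC.
Qed.

(** Each threshold is [expR r] times the bound on the mean, so by Markov each event has probability
    at most [expR (- r)]. *)
Let bad : set Omega := [set w | ((expR r * (2 * expR (r / 2 * v)))%:E < mass q w)%E] `|`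
  [set w | ((p * expR (2 * r))%:E < invmass w)%E].

Let bad_measurable : measurable bad.
Proof.
apply: measurableU; rewrite -[X in measurable X]setTI.
  apply: emeasurable_fun_o_infty => //; exact: (mass_mean mq (fun f => expR_ge0 _)).1.
by apply: emeasurable_fun_o_infty => //; exact: invmass_mean.1.
Qed.

Let bad_le : (P bad <= (2 * expR (- r))%:E)%E.
Proof.
have [m1 h1] := mass_mean mq (fun f => expR_ge0 _).
have [m2 h2] := invmass_mean.
rewrite (_ : 2 * expR (- r) = expR (- r) + expR (- r)); last by ring.
apply: (le_trans (measureU2 _ _ _)).
- by rewrite -[X in measurable X]setTI; apply: emeasurable_fun_o_infty => //; try exact: m1; try exact: m2.
- by rewrite -[X in measurable X]setTI; apply: emeasurable_fun_o_infty => //; try exact: m1; try exact: m2.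
rewrite EFinD leeD//.
  apply: le_trans (@markov_ge0 _ _ _ P (mass q) (2 * expR (r / 2 * v)) _ m1 _ _ _) _.
  - by move=> w; apply: integral_ge0 => f _; rewrite lee_fin mulr_ge0 ?expR_ge0.
  - by rewrite h1; exact: (rkhs_repr_exp_norm gaussPi hxi lam).
  - by rewrite !mulr_gt0 ?expR_gt0.
  by rewrite lee_fin invfM mulrCA mulfV ?mulr1 ?expRN// gt_eqF// mulr_gt0 ?expR_gt0.
apply: le_trans (@markov_ge0 _ _ _ P invmass (p * expR r) _ m2 _ h2 _) _.
- by move=> w; apply: integral_ge0 => f _; rewrite lee_fin mulr_ge0 ?expR_ge0.
- by rewrite mulr_gt0 ?expR_gt0.
rewrite lee_fin (_ : 2 * r = r + r); last by ring.
rewrite expRD expRN; have pn := gt_eqF p0; have en := gt_eqF (expR_gt0 r).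
by rewrite le_eqVlt; apply/orP; left; apply/eqP; field; rewrite pn en.
Qed.

(** The threshold for [mass q] divided by [expR (- (3 * r + 1))], the lower bound on the evidence:
    [2 * r] from the threshold for [invmass], [r + 1] from [small_ball]. *)
Let E := 2 * expR ((4 + v / 2) * r + 1).

Let good_mass w : ~ bad w -> exists D : R,
  [/\ 0 < D, mass (cst 1%R) w = D%:E & (mass q w <= (D * E)%:E)%E].
Proof.
move=> /not_orP[/negP + /negP]; rewrite -!leNgt => b1 b2.
have q1 f : 1 <= q f by rewrite -expR0 ler_expR mulr_ge0// ltW.
have mUw1 : measurable_fun setT (fun f : borel V => expR (U (f, w))).
  by have := mUw 1 w; under eq_fun do rewrite mul1r.
have mUwN : measurable_fun setT (fun f : borel V => expR (- U (f, w))).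
  by have := mUw (-1) w; under eq_fun do rewrite mulN1r.
have m1 : measurable_fun setT (fun f : borel V => (cst 1 f * expR (U (f, w)))%:E).
  by apply/measurable_EFinP; exact: measurable_funM.
have m1q : (mass (cst 1%R) w <= mass q w)%E.
  apply: ge0_le_integral => //.
  - by move=> f _; rewrite lee_fin mulr_ge0 ?expR_ge0.
  - by apply/measurable_EFinP; exact: measurable_funM.
  - by move=> f _; rewrite lee_fin ler_wpM2r ?expR_ge0//; exact: q1.
have mfin : mass (cst 1%R) w \is a fin_num.
  rewrite ge0_fin_numE; last first.
    by apply: integral_ge0 => f _; rewrite lee_fin mulr_ge0 ?expR_ge0.
  by rewrite (le_lt_trans m1q)// (le_lt_trans b1)// ltry.
exists (fine (mass (cst 1%R) w)).
set D := fine _; have DE : mass (cst 1%R) w = D%:E by rewrite /D fineK.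
(* The maximizer of [2 * la * p - la ^+ 2 * (p * expR (2 * r))]; the maximum is [la * p]. *)
pose la := expR (- (2 * r)).
have la0 : 0 < la by exact: expR_gt0.
have mInd : measurable_fun setT (fun f : borel V => (\1_B f : R)%:E).
  exact/measurable_EFinP/measurable_indic.
have mInv : measurable_fun setT (fun f : borel V => (\1_B f * expR (- U (f, w)))%:E).
  by apply/measurable_EFinP; apply: measurable_funM => //; exact: measurable_indic.
have Inv0 (f : borel V) : (0 <= (\1_B f * expR (- U (f, w)))%:E)%E.
  by rewrite lee_fin mulr_ge0 ?expR_ge0.
have la2 : (0 <= (la ^+ 2)%:E)%E by rewrite lee_fin sqr_ge0.
have la1 : (0 <= (2 * la)%:E)%E by rewrite lee_fin mulr_ge0// ltW.
(* Integrate [x >= 2 la - la ^+ 2 / x], valid for all [x > 0], over [B]. *)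
have lower : la * p <= D.
  have hint : (\int[Pi]_f ((la ^+ 2)%:E * (\1_B f * expR (- U (f, w)))%:E) <=
      (la * p)%:E)%E.
    rewrite (ge0_integralZl _ measurableT mInv)//.
    apply: le_trans (lee_wpmul2l _ b2) _; first by rewrite lee_fin sqr_ge0.
    rewrite -EFinM lee_fin /la -expRM_natl.
    rewrite mulrCA -expRD mulrC ler_wpM2r ?(ltW p0)// ler_expR.
    by rewrite -/r; lra.
  have := @ge0_le_integral_add _ _ _ Pi (fun f => (2 * la)%:E * (\1_B f)%:E)%E
    (fun f => (cst 1 f * expR (U (f, w)))%:E)
    (fun f => (la ^+ 2)%:E * (\1_B f * expR (- U (f, w)))%:E)%E (la * p)%:E.
  rewrite (ge0_integralZl _ measurableT mInd)//.
  rewrite integral_indic// setIT [X in (_ * X <= _)%E]pE -/(mass (cst 1%R) w) DE -EFinM -EFinD lee_fin.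
  move=> hint2; suff : 2 * la * p <= D + la * p by lra.
  apply: hint2 => //.
  - exact: emeasurable_funM.
  - exact: emeasurable_funM.
  - by move=> f; rewrite mule_ge0.
  - by move=> f; rewrite lee_fin mulr_ge0// expR_ge0.
  - by move=> f; rewrite mule_ge0.
  move=> f; rewrite -!EFinM -EFinD lee_fin mul1r.
  have [fB|fB] := boolP (f \in B); rewrite indicE; last first.
    by rewrite (negbTE fB) !mul0r !mulr0 addr0 expR_ge0.
  rewrite fB mulr1 mul1r expRN.
  have e0 := expR_gt0 (U (f, w)); move: (expR _) e0 => e e0.
  rewrite -subr_ge0 (_ : _ - _ = (e - la) ^+ 2 / e); last by field; rewrite gt_eqF.
  by rewrite divr_ge0 ?sqr_ge0 ?ltW.
have D0 : 0 < D by rewrite (lt_le_trans _ lower)// mulr_gt0.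
split => //; apply: (le_trans b1); rewrite lee_fin.
have h1 : expR (- (3 * r + 1)) <= D.
  apply: le_trans lower; apply: (@le_trans _ _ (la * expR (- (r + 1)))).
    by rewrite /la -expRD ler_expR; lra.
  by rewrite ler_wpM2l// ltW.
apply: (@le_trans _ _ (expR (- (3 * r + 1)) * E)); last first.
  by rewrite ler_wpM2r// /E mulr_ge0// expR_ge0.
rewrite /E mulrCA [leRHS]mulrCA -!expRD ler_wpM2l// ler_expR.
rewrite le_eqVlt; apply/orP; left; apply/eqP; field; exact: isT.
Qed.

(* Chosen so that [E * expR (- a) = 2 * expR (- r)]. *)
Let a := (5 + v / 2) * r + 1.

Let v0 : 0 <= v. Proof. by apply: Rintegral_ge0 => f _; exact: sqr_ge0. Qed.

Let a0 : 0 <= a.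
Proof. by rewrite addr_ge0// mulr_ge0 ?sqr_ge0// addr_ge0// divr_ge0. Qed.

Let kap (t : R) := expR (t * eps * a / lam + (t * eps) ^+ 2 / 2 * v).
Let rho (t : R) := tilt_factor v eps lam t.

Let rhoE t : rho t = kap t * (1 + 2 * expR (- r)). Proof. by []. Qed.

Let good w D := [/\ 0 < D, mass (cst 1%R) w = D%:E & (mass q w <= (D * E)%:E)%E].

(** The integrand is at most [kap t - 1 + kap t * expR (- a) * q]; the first part has mass
    [(kap t - 1) * D], the second at most [kap t * 2 * expR (- r) * D] by the choice of [a]. *)
Let excess (t : R) w D : 0 <= t -> t * eps <= lam -> good w D ->
  (mass (fun f => expR (t * eps * `|xi f| + (t * eps) ^+ 2 / 2 * v) - 1)%R w <=
    ((rho t - 1) * D)%:E)%E.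
Proof.
move=> t0 tlam [D0 DE qE].
have te0 : 0 <= t * eps by rewrite mulr_ge0// ltW.
have kap1 : 1 <= kap t.
  rewrite -expR0 ler_expR addr_ge0//; last by rewrite mulr_ge0// divr_ge0// sqr_ge0.
  by rewrite divr_ge0 ?(ltW lam0)// mulr_ge0.
have kap0 : 0 <= kap t by rewrite (le_trans ler01).
have mUw1 : measurable_fun setT (fun f : borel V => expR (U (f, w))).
  by have := mUw 1 w; under eq_fun do rewrite mul1r.
have m1 : measurable_fun setT (fun f : borel V => (cst 1 f * expR (U (f, w)))%:E).
  by apply/measurable_EFinP; exact: measurable_funM.
have m2 : measurable_fun setT (fun f : borel V => (q f * expR (U (f, w)))%:E).
  by apply/measurable_EFinP; exact: measurable_funM.
have p1 f : (0 <= (cst 1 f * expR (U (f, w)))%:E)%E.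
  by rewrite lee_fin mulr_ge0// expR_ge0.
have p2 f : (0 <= (q f * expR (U (f, w)))%:E)%E by rewrite lee_fin mulr_ge0 ?expR_ge0.
have k1 : (0 <= (kap t - 1)%:E)%E by rewrite lee_fin subr_ge0.
have k2 : (0 <= (kap t * expR (- a))%:E)%E by rewrite lee_fin mulr_ge0// expR_ge0.
rewrite [leRHS](_ : _ = (kap t - 1)%:E * mass (cst 1%R) w + (kap t * expR (- a) * (D * E))%:E)%E; last first.
  rewrite DE -EFinM -EFinD; congr EFin; rewrite /E.
  rewrite (_ : kap t * expR (- a) * (D * _) =
    D * kap t * 2 * (expR (- a) * expR ((4 + v / 2) * r + 1))); last by ring.
  rewrite -expRD (_ : - a + _ = - r); last by rewrite /a; ring.
  by rewrite rhoE; ring.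
rewrite -(ge0_integralZl _ measurableT m1)//.
apply: (@ge0_le_integral_add _ _ _ Pi _ (fun f => (kap t - 1)%:E * (cst 1 f * expR (U (f, w)))%:E)%E
  (fun f => (kap t * expR (- a))%:E * (q f * expR (U (f, w)))%:E)%E).
- apply/measurable_EFinP; apply: measurable_funM => //; apply: measurable_funB => //.
- exact: emeasurable_funM.
- exact: emeasurable_funM.
- move=> f; rewrite lee_fin mulr_ge0 ?expR_ge0// subr_ge0 -expR0 ler_expR addr_ge0//.
    by rewrite mulr_ge0.
  by rewrite mulr_ge0// divr_ge0// sqr_ge0.
- by move=> f; rewrite mule_ge0.
- by move=> f; rewrite mule_ge0.
- move=> f; rewrite -!EFinM -EFinD lee_fin mul1r mulrA -mulrDl ler_wpM2r ?expR_ge0//.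
  (* [expR (t * eps * x + b) <= kap t * (1 + expR (lam * x - a))]: if [lam * x > a]
     use [t * eps <= lam]. *)
  rewrite addrAC lerB// /q -(mulrA (kap t)) -(expRD (- a)).
  have [le_a|a_le] := leP (lam * `|xi f|) a.
    apply: (@le_trans _ _ (kap t)); last by rewrite lerDl mulr_ge0 ?expR_ge0.
    rewrite ler_expR lerD2r ler_pdivlMr// -(mulrA (t * eps)) ler_wpM2l//.
    by rewrite mulrC.
  apply: (@le_trans _ _ (kap t * expR (- a + lam * `|xi f|))); last by rewrite lerDr.
  rewrite -expRD ler_expR.
  rewrite [leRHS]addrAC lerD2r.
  rewrite -subr_ge0 (_ : _ - _ = (1 - t * eps / lam) * (lam * `|xi f| - a)); last first.
    by field; rewrite gt_eqF.
  rewrite mulr_ge0// subr_ge0 ?(ltW a_le)//.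
  by rewrite ler_pdivrMr// mul1r.
apply: le_trans (_ : ((kap t * expR (- a))%:E * mass q w <= _)%E).
  by rewrite (ge0_integralZl _ measurableT m2).
by rewrite [leRHS]EFinM; exact: lee_wpmul2l.
Qed.

Let tilt_bound (t T : R) (f : borel V) : `|t| <= T ->
  `|expR (t * eps * xi f - (t * eps) ^+ 2 / 2 * v) - 1| <=
  expR (T * eps * `|xi f| + (T * eps) ^+ 2 / 2 * v) - 1.
Proof.
move=> tT; have T0 : 0 <= T by rewrite (le_trans _ tT).
apply: (le_trans (normr_expRB1_le _)); rewrite lerB// ler_expR.
apply: (le_trans (ler_normB _ _)); rewrite lerD//.
  by rewrite !normrM (gtr0_norm eps0) ler_wpM2r// ler_wpM2r// ltW.
rewrite ger0_norm; last by rewrite mulr_ge0// divr_ge0// sqr_ge0.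
rewrite ler_wpM2r// ler_wpM2r// -(real_normK (num_real (t * eps))).
rewrite lerXn2r ?nnegrE ?mulr_ge0 ?(ltW eps0)//.
by rewrite normrM (gtr0_norm eps0) ler_wpM2r// ltW.
Qed.

(** The Cameron-Martin factor differs from 1 by at most the integrand of [excess], so dropping it
    costs a fraction [M * (rho T - 1)] of the evidence. *)
Let mass_tilt (t T M : R) w D (G : borel V -> R) : `|t| <= T -> T * eps <= lam ->
  good w D -> measurable_fun setT G -> (forall f, 0 <= G f <= M) ->
  let G' := fun f => G f * expR (t * eps * xi f - (t * eps) ^+ 2 / 2 * v) in
  (mass G' w <= mass G w + (M * ((rho T - 1) * D))%:E /\
   mass G w <= mass G' w + (M * ((rho T - 1) * D))%:E)%E.
Proof.
move=> tT Tlam gw mG G0M G'.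
have T0 : 0 <= T by rewrite (le_trans _ tT).
have G0 f : 0 <= G f by have /andP[] := G0M f.
have GM f : G f <= M by have /andP[] := G0M f.
have M0 : 0 <= M by rewrite (le_trans (G0 0)).
have mU1 : measurable_fun setT (fun f : borel V => expR (U (f, w))).
  by have := mUw 1 w; under eq_fun do rewrite mul1r.
have mt : measurable_fun setT (fun f => expR (t * eps * xi f - (t * eps) ^+ 2 / 2 * v)).
  by apply: measurableT_comp => //; apply: measurable_funB => //; exact: measurable_funM.
have mGU : measurable_fun setT (fun f : borel V => (G f * expR (U (f, w)))%:E).
  by apply/measurable_EFinP; exact: measurable_funM.
have mG'U : measurable_fun setT (fun f : borel V => (G' f * expR (U (f, w)))%:E).
  by apply/measurable_EFinP; apply: measurable_funM => //; exact: measurable_funM.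
pose k f := expR (T * eps * `|xi f| + (T * eps) ^+ 2 / 2 * v) - 1.
have mk : measurable_fun setT (fun f : borel V => (k f * expR (U (f, w)))%:E).
  by apply/measurable_EFinP; apply: measurable_funM => //; exact: measurable_funB.
have k0 f : 0 <= k f by rewrite (le_trans _ (tilt_bound f tT)).
have GU0 f : (0 <= (G f * expR (U (f, w)))%:E)%E by rewrite lee_fin mulr_ge0 ?expR_ge0.
have G'U0 f : (0 <= (G' f * expR (U (f, w)))%:E)%E.
  by rewrite lee_fin !mulr_ge0 ?expR_ge0.
have kU0 f : (0 <= (k f * expR (U (f, w)))%:E)%E by rewrite lee_fin mulr_ge0 ?expR_ge0.
have M0' : (0 <= M%:E)%E by rewrite lee_fin.
have kU : (\int[Pi]_f (M%:E * (k f * expR (U (f, w)))%:E) <=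
    (M * ((rho T - 1) * D))%:E)%E.
  rewrite (ge0_integralZl _ measurableT mk)// [leRHS]EFinM.
  by apply: lee_wpmul2l => //; exact: excess.
have mMk := emeasurable_funM (measurable_cst M%:E) mk.
have Mk0 f : (0 <= M%:E * (k f * expR (U (f, w)))%:E)%E by rewrite mule_ge0.
have close f : `|G f - G' f| <= M * k f.
  rewrite /G' -[X in X - _]mulr1 -mulrBr normrM ger0_norm// ler_pM//.
  by rewrite distrC; exact: tilt_bound.
split.
- apply: (@ge0_le_integral_add _ _ _ Pi _ _ _ _ mG'U mGU mMk G'U0 GU0 Mk0 _ kU) => f.
  rewrite -EFinM -EFinD lee_fin mulrA -mulrDl ler_wpM2r ?expR_ge0//.
  by move: (close f); rewrite ler_norml => /andP[h1 _]; lra.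
- apply: (@ge0_le_integral_add _ _ _ Pi _ _ _ _ mGU mG'U mMk GU0 G'U0 Mk0 _ kU) => f.
  rewrite -EFinM -EFinD lee_fin mulrA -mulrDl ler_wpM2r ?expR_ge0//.
  by move: (close f); rewrite ler_norml => /andP[_ h1]; lra.
Qed.

(** * The posterior law of the rescaled functional *)

Let translated t w := {ae Pi, forall f : borel V, l w ((f : V) + (t * eps) *: h) =
  l w f + t * Z w f - t ^+ 2 / 2 * sigma ^+ 2}.

Let law w : probability R R :=
  distribution (posterior Pi (l w)) (rescaled L eps (Psi w)).

Let mZ w : measurable_fun setT (Z w). Proof. exact: measurable_funP. Qed.

Let law_integral w D (G : R -> \bar R) : good w D -> measurable_fun setT G ->
  (forall x, 0 <= G x)%E ->
  (\int[law w]_x G x =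
   (D^-1)%:E * \int[Pi]_f (G (Z w f) * (expR (U (f, w)))%:E))%E.
Proof.
move=> [D0 DE _] mG G0; rewrite ge0_integral_distribution//.
rewrite (@ge0_integral_posterior _ _ _ Pi (l w) (l w fdag) D)//.
- by rewrite -DE; apply: eq_integral => f _; rewrite mul1r.
- exact: (measurableT_comp mG (mZ w)).
by move=> f; exact: G0.
Qed.

(** [quasi_invariance] with constant [G] equates the posterior mean of
    [expR (t * Z - sigma ^+ 2 / 2)] with that of the Cameron-Martin factor, at most [rho T]. The
    values 1 and -1 of [t] supply the tightness clauses of [almost_normal]. *)
Let law_moment t T w D : `|t| = 1 -> 1 <= T -> T * eps <= lam -> rho T <= 2 ->
  good w D -> translated t w ->
  (\int[law w]_x (expR (t * x))%:E <= (2 * expR (sigma ^+ 2 / 2))%:E)%E.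
Proof.
move=> t1 T1 Tlam rho2 gw tr.
have t2 : t ^+ 2 = 1 by rewrite -(real_normK (num_real t)) t1 expr1n.
have me : measurable_fun setT (fun x : R => (expR (t * x))%:E).
  by apply/measurable_EFinP; apply: measurableT_comp => //; exact: measurable_funM.
have meZ : measurable_fun setT (fun f : borel V =>
    (expR (t * Z w f - t ^+ 2 / 2 * sigma ^+ 2 + U (f, w)))%:E).
  apply/measurable_EFinP; apply: measurableT_comp => //; apply: measurable_funD.
    by apply: measurable_funB => //; exact: measurable_funM.
  exact: (measurable_fun_pair1 w mU).
rewrite (law_integral gw me)//.
rewrite (eq_integral (fun f => (expR (sigma ^+ 2 / 2))%:E *
    (expR (t * Z w f - t ^+ 2 / 2 * sigma ^+ 2 + U (f, w)))%:E)%E); last first.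
  by move=> f _; rewrite -!EFinM -!expRD t2; congr (expR _)%:E; ring.
rewrite ge0_integralZl//.
have /= := @quasi_invariance t w (fun=> 1%E) tr (measurable_cst 1%E) (fun=> lee01).
under eq_integral do rewrite mul1e.
move=> ->; under eq_integral do rewrite mul1e expRD.
have tT : `|t| <= T by rewrite t1.
have c01 (f : borel V) : 0 <= cst (1 : R) f <= 1 by rewrite ler01 lexx.
have [h1 _] := mass_tilt tT Tlam gw (measurable_cst (1 : R)) c01.
have [D0 DE _] := gw.
have h2 : (\int[Pi]_f (expR (t * eps * xi f - (t * eps) ^+ 2 / 2 * v) *
    expR (U (f, w)))%:E <= (2 * D)%:E)%E.
  rewrite (eq_integral (fun f => (1 * expR (t * eps * xi f - (t * eps) ^+ 2 / 2 * v) *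
    expR (U (f, w)))%:E)); last by move=> f _; rewrite mul1r.
  apply: (le_trans h1); rewrite DE mul1r -EFinD lee_fin.
  rewrite (_ : D + _ = rho T * D); last by ring.
  by rewrite ler_wpM2r// ltW.
apply: (@le_trans _ _ ((D^-1)%:E * ((expR (sigma ^+ 2 / 2))%:E * (2 * D)%:E))%E).
  by rewrite lee_wpmul2l ?lee_fin ?invr_ge0 ?(ltW D0)// lee_wpmul2l.
rewrite -!EFinM lee_fin le_eqVlt; apply/orP; left; apply/eqP; field.
by rewrite gt_eqF.
Qed.

Let bounded_integral (nu : probability R R) (k : R -> R) (M : R) :
  measurable_fun setT k -> (forall x, `|k x| <= M) ->
  (\int[nu]_x (k x)%:E)%E = (\int[nu]_x k x)%:E.
Proof.
move=> mk kM; rewrite /Rintegral fineK//.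
have iM : nu.-integrable setT (EFin \o (cst M : R -> R)).
  exact: finite_measure_integrable_cst.
exact: (integrable_fin_num measurableT (integrable_le mk iM kM)).
Qed.

(** With [t = y / sigma ^+ 2], multiplying the density at [x] by
    [expR (t * x - t ^+ 2 / 2 * sigma ^+ 2)] gives the density at [x - y]. Hence [quasi_invariance]
    for [g] times the density is the identity of [almost_normal], up to the Cameron-Martin
    factor. *)
Let law_shift (T : R) (g : R -> R) (y : R) w D : sigma != 0 -> continuous g ->
  (forall x, 0 <= g x <= 1) -> `|y / sigma ^+ 2| <= T -> T * eps <= lam ->
  good w D -> translated (y / sigma ^+ 2) w ->
  `|\int[law w]_x (g x * normal_pdf 0 sigma (x - y)) -
    \int[law w]_x (g (x + y) * normal_pdf 0 sigma (x + y))| <=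
  normal_peak sigma * (rho T - 1).
Proof.
move=> sn0 cg g01 yT Tlam gw tr; set t := y / _ in yT tr.
have g0 x : 0 <= g x by have /andP[] := g01 x.
have g1 x : g x <= 1 by have /andP[] := g01 x.
have ty : t * sigma ^+ 2 = y by rewrite /t divfK// sqrf_eq0.
pose phi := normal_pdf 0 sigma.
have mphi : measurable_fun setT phi by exact: measurable_normal_pdf.
have phi0 x : 0 <= phi x by exact: normal_pdf_ge0.
have mg : measurable_fun setT g by exact: continuous_measurable_fun.
pose k x := g x * phi x.
have mk : measurable_fun setT k by exact: measurable_funM.
have k0 x : 0 <= k x by rewrite mulr_ge0.
have kM x y' : g x * phi y' <= normal_peak sigma.
  by rewrite (le_trans _ (normal_pdf_ub 0 y' sn0))// ler_piMl.
have m1 : measurable_fun setT (fun x => g x * phi (x - y)).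
  by apply: measurable_funM => //; apply: (measurableT_comp mphi); exact: measurable_funB.
have m2 : measurable_fun setT (fun x : R => k (x + y)).
  by apply: (measurableT_comp mk); exact: measurable_funD.
have I1 : (\int[law w]_x (g x * phi (x - y))%:E)%E =
    (\int[law w]_x (g x * phi (x - y)))%:E.
  apply: (@bounded_integral (law w) _ (normal_peak sigma)) => // x.
  by rewrite ger0_norm ?mulr_ge0.
have I2 : (\int[law w]_x (k (x + y))%:E)%E = (\int[law w]_x k (x + y))%:E.
  apply: (@bounded_integral (law w) _ (normal_peak sigma)) => // x.
  by rewrite ger0_norm// kM.
pose G f := k (Z w f + y).
have mG : measurable_fun setT G by apply: (measurableT_comp mk); exact: measurable_funD.
have [D0 DE _] := gw.
have Di0 : 0 <= D^-1 by rewrite invr_ge0 ltW.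
have E2 : (\int[law w]_x (k (x + y))%:E = (D^-1)%:E * mass G w)%E.
  have m2E : measurable_fun setT (fun x : R => (k (x + y))%:E) by exact/measurable_EFinP.
  have k0E x : (0 <= (k (x + y))%:E)%E by rewrite lee_fin.
  rewrite (law_integral gw m2E k0E).
  by congr (_ * _)%E; apply: eq_integral => f _; rewrite -EFinM.
have E1 : (\int[law w]_x (g x * phi (x - y))%:E = (D^-1)%:E *
    mass (fun f => G f * expR (t * eps * xi f - (t * eps) ^+ 2 / 2 * v))%R w)%E.
  have m1E : measurable_fun setT (fun x : R => (g x * phi (x - y))%:E).
    exact/measurable_EFinP.
  have p1E x : (0 <= (g x * phi (x - y))%:E)%E by rewrite lee_fin mulr_ge0.
  rewrite (law_integral gw m1E p1E).
  congr (_ * _)%E.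
  have mkE : measurable_fun setT (EFin \o k) by exact/measurable_EFinP.
  have := quasi_invariance tr mkE (fun x => k0 x); rewrite ty => qi.
  apply: etrans (etrans qi _); last first.
    rewrite /mass; apply: eq_integral => f _; rewrite /= -EFinM expRD; congr EFin.
    by rewrite [LHS]mulrA.
  apply: eq_integral => f _; rewrite /= -!EFinM; congr EFin.
  rewrite [in RHS]expRD [RHS]mulrA; congr (_ * _).
  rewrite /k -[RHS]mulrA; congr (_ * _).
  rewrite /phi !normal_pdfE//; apply: etrans (mulrA _ _ _); congr (_ * _).
  rewrite /normal_fun -expRD; congr (expR _); rewrite /t; field.
  by rewrite sn0.
have G0M f : 0 <= G f <= normal_peak sigma by rewrite k0 kM.
have [h1 h2] := mass_tilt yT Tlam gw mG G0M.
move: I1 I2; rewrite E1 E2 => I1 I2.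
have step (a1 a2 : \bar R) (b1 b2 : R) : ((D^-1)%:E * a1 = b1%:E)%E -> ((D^-1)%:E * a2 = b2%:E)%E ->
    (0 <= a2)%E -> (a1 <= a2 + (normal_peak sigma * ((rho T - 1) * D))%:E)%E ->
    b1 <= b2 + normal_peak sigma * (rho T - 1).
  move=> e1 e2 a20 le12; rewrite -lee_fin EFinD -e1 -e2.
  rewrite (_ : (normal_peak sigma * (rho T - 1))%:E =
    (D^-1)%:E * (normal_peak sigma * ((rho T - 1) * D))%:E)%E; last first.
    by rewrite -EFinM; congr EFin; field; rewrite gt_eqF.
  rewrite -muleDr//; first by rewrite lee_wpmul2l// lee_fin.
  exact: fin_num_adde_defl.
have m0 (k' : borel V -> R) : (forall f, 0 <= k' f) -> (0 <= mass k' w)%E.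
  by move=> k'0; apply: integral_ge0 => f _; rewrite lee_fin mulr_ge0 ?expR_ge0.
have s1 := step _ _ _ _ I1 I2 (m0 _ (fun f => k0 _)) h1.
have s2 := step _ _ _ _ I2 I1 (m0 _ (fun f => mulr_ge0 (k0 _) (expR_ge0 _))) h2.
rewrite ler_norml; apply/andP; split; last by rewrite lerBlDl; exact: s1.
by rewrite lerNl opprB lerBlDl; exact: s2.
Qed.

Lemma posterior_almost_normal n T : sigma != 0 -> 1 <= T ->
  n%:R <= T * sigma ^+ 2 -> T * eps <= lam -> rho T <= 2 ->
  normal_peak sigma * (rho T - 1) <= n.+1%:R^-1 ->
  exists N, [/\ measurable N, (P N <= (2 * expR (- r))%:E)%E &
    forall w, ~ N w -> almost_normal sigma (2 * expR (sigma ^+ 2 / 2)) n (law w)].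
Proof.
move=> sn0 T1 nT Tlam rho2 peak_le.
have T0 : 0 <= T by rewrite (le_trans ler01).
(* One null set for the two moment bounds and for all rational shifts, enumerated by [unpickle];
   indices that decode to nothing fall back on the shift 0. *)
have [M [mM M0 NM]] : {ae P, forall w, translated 1 w /\ translated (-1) w /\
    forall k, translated (ratr (odflt (0 : rat) (unpickle k)) / sigma ^+ 2) w}.
  apply: filterS3 (translation_ae 1) (translation_ae (-1))
    (ae_foralln (fun k => translation_ae (ratr (odflt (0 : rat) (unpickle k)) / sigma ^+ 2))).
  by move=> w h1 h2 h3; split => //; split.
exists (bad `|` M); split; first exact: (measurableU _ _ bad_measurable mM).
  apply: (le_trans (measureU2 _ bad_measurable mM)).
  by rewrite [X in (_ + X)%E]M0 adde0 bad_le.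
move=> w /not_orP[/good_mass [D gw] nM].
have {nM} [tr1 [trN1 trq]] := contrapT (contra_not (@NM w) nM).
split.
- under eq_integral do rewrite -[_%:E]/((expR _)%:E) -{1}[X in expR X]mul1r.
  by apply: (law_moment _ T1 Tlam rho2 gw tr1); rewrite normr1.
- under eq_integral do rewrite -mulN1r.
  by apply: (law_moment _ T1 Tlam rho2 gw trN1); rewrite normrN1.
move=> g cg g01 y yn; apply: le_trans peak_le.
apply: (law_shift (D := D)) => //.
  rewrite normrM normfV (ger0_norm (sqr_ge0 _)) ler_pdivrMr; last by rewrite lt0r sqrf_eq0 sn0 sqr_ge0.
  exact: (le_trans yn).
by have := trq (pickle y); rewrite pickleK.
Qed.

End posterior_analysis.

(** * Asymptotics of the rate and mass of small balls *)

Lemma cvg_expRN_sqr (R : realType) (f : R -> R) (F : set_system R) :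
  ProperFilter F -> f x @[x --> F] --> +oo ->
  expR (- f x ^+ 2) @[x --> F] --> (0 : R).
Proof.
move=> FF finf.
have f0 : \forall x \near F, 0 < f x by move/cvgryPgt : (finf); apply.
have inv0 : (f x)^-1 @[x --> F] --> (0 : R) by exact: (gtr0_cvgV0 f0).2.
apply: (@squeeze_cvgr _ _ _ _ (cst 0) (fun x => (f x)^-1)) => //; last exact: cvg_cst.
near=> x; rewrite expR_ge0/= expRN.
have f1 : 1 < f x by near: x; move/cvgryPgt : (finf); apply.
rewrite lef_pV2 ?posrE ?expR_gt0//; last by rewrite (lt_trans _ f1).
apply: (@le_trans _ _ (f x ^+ 2)).
  by rewrite expr2 ler_peMl ?(ltW f1)// ltW// (lt_trans _ f1).
by rewrite (le_trans _ (expR_ge1Dx _))// lerDr.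
Unshelve. all: by end_near. Qed.

Lemma cvg_tilt_factor (R : realType) (v t : R) (delta : R -> R) :
  delta eps @[eps --> 0^'+] --> 0 -> delta eps / eps @[eps --> 0^'+] --> +oo ->
  tilt_factor v eps (delta eps / eps) t @[eps --> 0^'+] --> (1 : R).
Proof.
move=> d0 dinf.
have id0 : (eps : R) @[eps --> 0^'+] --> (0 : R) by exact/cvg_at_right_filter/cvg_id.
have lam0 : \forall eps \near 0^'+, 0 < delta eps / eps.
  by move/cvgryPgt : (dinf); apply.
have inv0 : (delta eps / eps)^-1 @[eps --> 0^'+] --> (0 : R).
  exact: (gtr0_cvgV0 lam0).2.
have exp0 : expR (- (delta eps / eps) ^+ 2) @[eps --> 0^'+] --> (0 : R).
  exact: cvg_expRN_sqr.
(* Uses [eps * lam = delta]: the exponent becomes a sum of terms that visibly tend to 0. *)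
pose k eps := expR (t * ((5 + v / 2) * delta eps + eps * (delta eps / eps)^-1) +
  (t * eps) ^+ 2 / 2 * v) * (1 + 2 * expR (- (delta eps / eps) ^+ 2)).
suff : k eps @[eps --> 0^'+] --> (1 : R).
  apply: cvg_trans; apply: near_eq_cvg; near=> eps.
  have e0 : 0 < eps by near: eps; exact: nbhs_right_gt.
  have l0 : 0 < delta eps / eps by near: eps.
  rewrite /k /tilt_factor; congr (expR _ * _); field.
  rewrite !gt_eqF//.
  by move: l0; rewrite pmulr_lgt0 ?invr_gt0.
rewrite /k -[X in _ --> X](_ : expR (t * ((5 + v / 2) * 0 + 0 * 0) + (t * 0) ^+ 2 / 2 * v) * (1 + 2 * 0) = 1); last first.
  by rewrite !(mulr0, mul0r, addr0) expr0n/= !mul0r addr0 expR0 mul1r.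
apply: cvgM; last first.
  by apply: cvgD; [exact: cvg_cst|exact: cvgMr].
apply: (cvg_comp _ expR); last exact: continuous_expR.
apply: cvgD.
  by apply: cvgMr; apply: cvgD; [exact: cvgMr|exact: cvgM].
apply: cvgMl; apply: cvgMl; apply: (cvg_comp _ (fun x => x ^+ 2)); last first.
  exact: exprn_continuous.
by apply: cvgMr.
Unshelve. all: by end_near. Qed.

Section concentration.
Context (R : realType) (V : hilbertType R) (Pi : probability (borel V) R).
Hypothesis sepV : separable V.
Hypothesis gaussPi : centred_gaussian_measure Pi.

(** The witness is the representer that [xget] selects inside [rkhs_norm]. *)
Lemma rkhs_norm_repr h : rkhs Pi h ->
  exists2 xi, rkhs_repr Pi h xi & \int[Pi]_f (xi f ^+ 2) = rkhs_norm Pi h ^+ 2.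
Proof.
move=> hh; have hxi := xgetPex (cst 0 : borel V -> R) hh.
exists (xget (cst 0) (rkhs_repr Pi h)) => //.
rewrite /rkhs_norm; set xi := xget _ _ in hxi *.
have [mxi isq] := closure_sq_integrable gaussPi (rkhs_repr_closure hxi).
set N := ('N[Pi]_2%:E[EFin \o xi])%E.
have N2 : (N `^ 2)%E = (\int[Pi]_f (xi f ^+ 2))%:E.
  rewrite /N powR_Lnorm// /Rintegral fineK; last exact: integrable_fin_num.
  apply: eq_integral => f _ /=.
  by rewrite ?poweR_EFin powR_mulrn// -normrX ger0_norm// sqr_ge0.
have N0 : (0 <= N)%E by exact: Lnorm_ge0.
move: N2 N0; case: N => [x|//|//] /= + x0.
  by rewrite ?poweR_EFin powR_mulrn// => -[<-].
by rewrite pnatr_eq0.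
Qed.

(** An element [g] within [s] of [f0] that attains the infimum up to 1, hence [r + 1], has its ball
    of radius [s] inside the ball of radius [2 * s] about [f0]; [shifted_ball_lower_bound] bounds
    the mass of the former. *)
Lemma concentration_ball (f0 : V) (s r : R) :
  (concentration_function Pi f0 s <= r%:E)%E ->
  ((expR (- (r + 1)))%:E <= Pi [set f : V | (`|f - f0| <= 2 * s)%R])%E.
Proof.
rewrite /concentration_function; set S := [set _ | _ in _].
pose B : set (borel V) := [set f : V | (`|f| <= s)%R].
rewrite -/B; set I := ereal_inf S.
have I0 : (0 <= I)%E.
  by apply: le_ereal_inf_tmp => _ [g _ <-]; rewrite lee_fin divr_ge0// sqr_ge0.
have mB (g : V) t : measurable ([set f : V | (`|f - g| <= t)%R] : set (borel V)).
  exact: measurable_closed_norm_ball.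
have mB' : measurable (B : set (borel V)).
  have -> : B = [set f : V | (`|f - 0| <= s)%R].
    by apply/seteqP; split => f; rewrite /B/= subr0.
  exact: mB.
have pfin : Pi B \is a fin_num by exact: fin_num_measure.
have p0 : 0 <= fine (Pi B) by rewrite fine_ge0.
move: (fineK pfin) p0; set p := fine _ => pE p0; rewrite -pE.
(* A null ball would make the concentration function infinite, against the bound by [r]. *)
have [p00|p0'] := eqVneq p 0.
  rewrite p00 /= lexx /= addey// ?leye_eq//.
  by rewrite gt_eqF// (lt_le_trans _ I0).
have {p0 p0'}p0 : 0 < p by rewrite lt_neqAle eq_sym p0'.
rewrite lne_EFin// leeBlDr// -EFinD => Ir.
have Ifin : I \is a fin_num by rewrite ge0_fin_numE// (le_lt_trans Ir)// ltry.
have [_ [g [hg gf0] <-]] := lb_ereal_inf_adherent ltr01 Ifin.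
rewrite -/I => gI.
have {gI}gI : rkhs_norm Pi g ^+ 2 / 2 <= r + ln p + 1.
  by rewrite -lee_fin (le_trans (ltW gI))// [leRHS]EFinD leeD2r.
have [xi hxi xi2] := rkhs_norm_repr hg.
have := shifted_ball_lower_bound sepV gaussPi s hxi.
rewrite -/B -pE xi2 -EFinM => h1.
apply: (@le_trans _ _ (expR (- (2^-1 * rkhs_norm Pi g ^+ 2)) * p)%:E).
  rewrite lee_fin -[X in _ * X](lnK p0) -expRD ler_expR.
  by move: gI; rewrite mulrC; lra.
apply: (le_trans h1); apply: le_measure; rewrite ?inE; [exact: mB|exact: mB|].
move=> f /= fg; rewrite -(subrKA g) (le_trans (ler_normD _ _))//.
by rewrite mulr2n mulrDl mul1r lerD.
Qed.

End concentration.

Lemma continuous_eq0_dense (V : topologicalType) (R : realType) (f : V -> R)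
    (S : set V) : dense S -> continuous f -> (forall x, S x -> f x = 0) ->
  forall x, f x = 0.
Proof.
move=> dS cf fS x; apply/eqP; rewrite -[_ == _]negbK; apply/negP => fx.
have oO : open (f @^-1` [set y | y != 0]).
  by apply: open_comp => [y _|]; [exact: cf|exact: open_neq].
have [|y [/= fy Sy]] := dS _ _ oO; first by exists x.
by move: fy; rewrite (fS y Sy) eqxx.
Qed.

(** * Convergence in probability *)

Section main.
Context (R : realType) (V H : hilbertType R).
Hypothesis sepV : separable V.
Context (A : {linear V -> H}) (c : R).
Hypotheses (c0 : 0 < c) (A_le : forall f, `|A f| <= c * `|f|).
Context d (Omega : measurableType d) (P : probability Omega R).
Context (W : H -> {RV P >-> R}).
Hypothesis noiseW : white_noise W.
Variables (fdag : V) (Pi : probability (borel V) R).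
Hypothesis gaussPi : centred_gaussian_measure Pi.
Hypothesis concPi : concentration_condition Pi c fdag.
Variable l : R -> Omega -> {mfun borel V >-> R}.
Hypothesis lE : log_likelihood_version A W fdag l.
Variables (L : dual V) (h : V).
Hypothesis rkhs_h : rkhs Pi h.
Hypothesis LE : forall f, L f = - inner (A f) (A h).

Let Psi eps w := L fdag - eps * W (A h) w.

Let law eps w : probability R R :=
  distribution (posterior Pi (l eps w)) (rescaled L eps (Psi eps w)).

Lemma posterior_cvg_nondegenerate : A h != 0 ->
  weak_cvg_in_probability P law (centred_normal `|A h|).
Proof.
rewrite -normr_eq0 => sn0 dist wd eta eta0.
have [delta [d0 dinf conc]] := concPi.
have [xi hxi] := rkhs_h.
set v := \int[Pi]_f (xi f ^+ 2).
set sigma := `|A h| in sn0 *.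
have [n Hn] := weak_metric_modulus (2 * expR (sigma ^+ 2 / 2)) sn0 wd eta0.
have s0 : 0 < sigma by rewrite lt0r sn0 normr_ge0.
(* Covers [t = 1] and [t = -1] for the moments and [t = y / sigma ^+ 2] for every shift
   [|y| <= n]. *)
pose T := Num.max 1 (n%:R / sigma ^+ 2).
have T1 : 1 <= T by rewrite le_max lexx.
have T0 : 0 < T by rewrite (lt_le_trans ltr01).
have nT : n%:R <= T * sigma ^+ 2.
  by rewrite -ler_pdivrMr ?exprn_gt0// le_max lexx orbT.
have peak0 : 0 < normal_peak sigma by exact: normal_peak_gt0.
have tilt1 := cvg_tilt_factor v T d0 dinf.
apply: (@squeeze_cvge _ _ _ _ (cst 0%E) _
    (fun eps => (2 * expR (- (delta eps / eps) ^+ 2))%:E)); last 2 first.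
- exact: cvg_cst.
- apply: cvg_EFin; first exact: nearW.
  rewrite -[X in _ --> X](mulr0 2); apply: cvgMr; exact: cvg_expRN_sqr.
near=> eps.
have eps0 : 0 < eps by near: eps; exact: nbhs_right_gt.
have lam1 : 1 <= delta eps / eps.
  by near: eps; move/cvgryPge : (dinf); apply.
have del0 : 0 < delta eps.
  by move: (lt_le_trans ltr01 lam1); rewrite pmulr_lgt0 ?invr_gt0.
have conceps : (concentration_function Pi fdag (delta eps / (2 * c)) <=
    ((delta eps / eps) ^+ 2)%:E)%E by near: eps.
have Tlam : T * eps <= delta eps / eps.
  apply: le_trans lam1; rewrite -ler_pdivlMl// mulr1 ltW//.
  by near: eps; apply: nbhs_right_lt; rewrite invr_gt0.
have tilt2 : tilt_factor v eps (delta eps / eps) T <= 2.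
  by near: eps; apply: (cvgr_le _ tilt1); rewrite ltr1n.
have tiltn : normal_peak sigma * (tilt_factor v eps (delta eps / eps) T - 1) <= n.+1%:R^-1.
  rewrite -ler_pdivlMl// lerBlDr.
  near: eps; apply: (cvgr_le _ tilt1).
  by rewrite ltrDr; apply: mulr_gt0; rewrite invr_gt0.
have ball : ((expR (- ((delta eps / eps) ^+ 2 + 1)))%:E <=
    Pi [set f : V | (`|f - fdag| <= delta eps / c)%R])%E.
  have := concentration_ball sepV gaussPi conceps.
  by rewrite (_ : 2 * (delta eps / (2 * c)) = delta eps / c)//; field; rewrite gt_eqF.
have [mleps leps] := lE eps0.
have [N [mN PN Nnorm]] := posterior_almost_normal sepV noiseW gaussPi hxi LE eps0 mleps leps
  c0 del0 A_le ball sn0 T1 nT Tlam tilt2 tiltn.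
(* The event [dist > eta] need not be measurable; its outer probability is bounded through the
   measurable set [N] that contains it. *)
rewrite mu_ext_ge0/=.
apply: le_trans PN; rewrite -measurable_mu_extE//; apply: le_mu_ext => w /= lt_eta.
apply: contrapT => /Nnorm /Hn; have [dist0 _ _ _ _] := wd.
by rewrite leNgt -[X in eta < X]ger0_norm ?lt_eta// dist0.
Unshelve. all: by end_near. Qed.

(** Here [L] vanishes, and so does [W 0] almost surely, so the rescaled functional is identically 0
    and its posterior law is the point mass that [centred_normal 0] denotes. The distance is then 0
    off a null set that does not depend on [eps]. *)
Lemma posterior_cvg_degenerate : A h = 0 ->
  weak_cvg_in_probability P law (centred_normal `|A h|).
Proof.
move=> Ah0 dist [dist0 dist_eq0 _ _ _] eta eta0.
have [M [mM M0 WM]] : {ae P, forall w, W 0 w = 0}.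
  apply: filterS (white_noise_linear noiseW 0 0 1) => w.
  by rewrite scaler0 addr0 mul1r => /eqP; rewrite -subr_eq0 opprD addNKr oppr_eq0 => /eqP.
apply: cvg_near_cst; near=> eps; apply/le_anti/andP; split; last exact: mu_ext_ge0.
rewrite -M0 -[leRHS]measurable_mu_extE//; apply: le_mu_ext => w /= lt_eta; apply: WM => /= W0.
move: lt_eta; rewrite (dist_eq0 _ _).2 ?normr0 ?ltNge ?(ltW eta0)// => B mB.
rewrite /centred_normal Ah0 normr0 eqxx /law /distribution /pushforward/=.
have -> : rescaled L eps (Psi eps w) = cst 0.
  apply/funext => f; rewrite /rescaled /Psi Ah0 W0 mulr0 subr0 !LE Ah0.
  have inner0 x : inner x (0 : H) = 0 by rewrite -(scale0r (0 : H)) innerZr mul0r.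
  by rewrite !inner0 subrr mulr0.
rewrite preimage_cst diracE; case: ifPn => _; first exact: probability_setT.
exact: measure0.
Unshelve. all: by end_near. Qed.

End main.

Theorem theorem2 (R : realType)
  (W1 W2 Wbar : hilbertType R)
  (sepW1 : separable W1) (sepW2 : separable W2) (sepWbar : separable Wbar)
  (* A : W1 -> W2 and its adjoint *)
  (A : {linear W1 -> W2}) (Astar : W2 -> W1)
  (bndA : bounded_operator A) (injA : injective A)
  (adjA : is_adjoint A Astar)
  (* W1 is a dense subspace of Wbar, to which A extends continuously *)
  (incl : {linear W1 -> Wbar}) (inj_incl : injective incl)
  (dense_incl : dense (range incl))
  (Abar : {linear Wbar -> W2}) (AbarE : forall f, Abar (incl f) = A f)
  (cont_Abar : continuous Abar)
  (c : R) (c_gt0 : 0 < c) (Abar_le : forall f, `|Abar f| <= c * `|f|)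
  (* white noise *)
  (d : measure_display) (Omega : measurableType d) (P : probability Omega R)
  (W : W2 -> {RV P >-> R}) (noiseW : white_noise W)
  (* truth and prior *)
  (fdag : Wbar) (Pi : probability (borel Wbar) R)
  (gaussPi : centred_gaussian_measure Pi)
  (concPi : concentration_condition Pi c fdag)
  (l : R -> Omega -> {mfun borel Wbar >-> R})
  (lE : log_likelihood_version Abar W fdag l)
  (* psi and the continuous extension of <., psi> to Wbar *)
  (psi : W1) (C : R) (C_gt0 : 0 < C)
  (psi_le : forall phi : W1, `|inner psi phi| <= C * `|incl phi|)
  (psi_ext : dual Wbar) (psi_extE : forall phi, psi_ext (incl phi) = inner phi psi)
  (psit : Wbar) (psit_rkhs : rkhs Pi psit) (psiE : psi = - Astar (Abar psit)) :
  let Psihat (eps : R) (w : Omega) : R :=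
    psi_ext fdag - eps * W (Abar psit) w in
  weak_cvg_in_probability P
    (fun eps w =>
       distribution (posterior Pi (l eps w)) (rescaled psi_ext eps (Psihat eps w)))
    (centred_normal `|Abar psit|).
Proof.
(* On the image of [W1] this is [psiE] read through the adjoint; density and continuity of both
   sides extend it to [Wbar]. *)
have LE f : psi_ext f = - inner (Abar f) (Abar psit).
  apply/eqP; rewrite -addr_eq0; apply/eqP.
  pose g f := psi_ext f + inner (Abar f) (Abar psit).
  apply: (@continuous_eq0_dense _ _ g (range incl)) => //.
    move=> x; apply: cvgD; first exact: dual_continuous.
    apply: (cvg_comp Abar (fun u => inner u (Abar psit))); first exact: cont_Abar.
    exact: inner_continuousl.
  move=> _ [phi _ <-]; rewrite /g psi_extE psiE AbarE innerNr adjA; exact: addNr.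
have [A0|A0] := eqVneq (Abar psit) 0.
- exact: posterior_cvg_degenerate.
- exact: (posterior_cvg_nondegenerate sepWbar c_gt0 Abar_le noiseW gaussPi concPi lE psit_rkhs LE A0).
Qed.
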